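(* Let $X\neq\{0\}$ be a complex Banach space with open unit ball $\mathbb{B}$ and let $\frac12\le\lambda\le 1$. Let $g:\mathbb{B}\to\mathbb{C}$ be holomorphic with $g(0)=1$, define $F(x)=g(x)x$ for $x\in\mathbb{B}$, and suppose that $F\in\widehat{\mathcal{F}}_{\lambda}(\mathbb{B})$. Then for every $x_0\in X$ with $\|x_0\|=1$ (and every $T_{x_0}\in T(x_0)$), $$-\frac{(2\lambda-1)^2(2\lambda+5)^2}{64\lambda(2\lambda+3)}\le T_{3,1}(F)\le\begin{cases}1,&\lambda\in\left[\frac12,\frac{\sqrt{153}-5}{8}\right],\\[1mm] 1+\dfrac{(1+2\lambda)^2(4\lambda^2+5\lambda-8)}{18},&\lambda\in\left(\frac{\sqrt{153}-5}{8},1\right].\end{cases}$$ The inequalities are sharp: for every $\lambda\in[\frac12,1]$ and for each of the lower and the upper bound there exist such an $F$, $x_0$ and $T_{x_0}$ for which equality holds.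
   Context: $X$ is a complex Banach space with norm $\|\cdot\|$ and $\mathbb{B}=\{x\in X:\|x\|<1\}$. For $x\in X\setminus\{0\}$, $T(x)$ is the set of bounded linear functionals $T_x:X\to\mathbb{C}$ with $T_x(x)=\|x\|$ and $\|T_x\|=1$. $D^nF(x)$ denotes the $n$th Fréchet derivative of $F$ at $x$ (a bounded symmetric $n$-linear map $X^n\to X$). A holomorphic map $F:\mathbb{B}\to X$ is normalized if $F(0)=0$ and $DF(0)=I$; it is locally biholomorphic if $DF(x)$ is invertible with bounded inverse for every $x\in\mathbb{B}$. For $\frac12\le\lambda\le1$, $\widehat{\mathcal{F}}_{\lambda}(\mathbb{B})$ is the class of normalized locally biholomorphic maps $F:\mathbb{B}\to X$ such that $$\operatorname{Re}\left\{T_x\left(\frac{(DF(x))^{-1}\bigl(D^2F(x)(x,x)+DF(x)x\bigr)}{\|x\|}\right)\right\}\ge\frac12-\lambda$$ for every $x\in\mathbb{B}\setminus\{0\}$ and every $T_x\in T(x)$. For $\|x_0\|=1$ and $T_{x_0}\in T(x_0)$, put $A_n=\frac{1}{n!}T_{x_0}\bigl(D^nF(0)(x_0,\ldots,x_0)\bigr)$ for $n=2,3$, and define the Hermitian–Toeplitz determinant $$T_{3,1}(F)=\begin{vmatrix}1&A_2&A_3\\\overline{A_2}&1&A_2\\\overline{A_3}&\overline{A_2}&1\end{vmatrix}=1-2|A_2|^2+2\operatorname{Re}(A_2^2\overline{A_3})-|A_3|^2 .$$ *)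

(* Defs.v *)
From Stdlib Require Export Reals List Factorial ClassicalEpsilon.
From Stdlib Require Import Lra.
From Coquelicot Require Export Coquelicot.
Export ListNotations.
Open Scope R_scope.

Set Implicit Arguments.
Unset Strict Implicit.

Section FrechetDerivatives.
Context {X Y : NormedModule C_AbsRing}.

(* An n-linear map X^n -> Y is a function on lists, of which only the values on
   lists of length n matter. *)

Definition prod_norm (v : list X) : R :=
  fold_right (fun u p => norm u * p) 1 v.

Definition is_bounded_multilinear (n : nat) (L : list X -> Y) : Prop :=
  (forall l1 l2 : list X, (length l1 + S (length l2))%nat = n ->
     is_linear (fun y : X => L (l1 ++ y :: l2))) /\
  (exists M : R, forall v : list X, length v = n ->
     norm (L v) <= M * prod_norm v).

(* L, seen as the bounded linear map h |-> L (h :: _) from X to the bounded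
   n-linear maps with the operator norm, is the Frechet derivative at x of the
   map G into the bounded n-linear maps: compare [filterdiff] and [is_domin]. *)
Definition is_frechet_derivative (n : nat) (G : X -> list X -> Y) (x : X)
    (L : list X -> Y) : Prop :=
  is_bounded_multilinear (S n) L /\
  forall eps : posreal, locally x (fun y : X =>
    forall v : list X, length v = n ->
      norm (minus (minus (G y v) (G x v)) (L (minus y x :: v)))
        <= eps * norm (minus y x) * prod_norm v).

(* [frechet_D n F x [v1; ...; vn]] is D^n F(x)(v1, ..., vn); the value is
   unspecified when the derivative does not exist. *)
Fixpoint frechet_D (n : nat) (F : X -> Y) (x : X) : list X -> Y :=
  match n with
  | O => fun _ => F x
  | S m => epsilon (inhabits (fun _ : list X => zero))
             (is_frechet_derivative m (frechet_D m F) x)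
  end.

Definition holomorphic_on_ball (F : X -> Y) : Prop :=
  forall x : X, norm x < 1 -> ex_filterdiff F (locally x).

End FrechetDerivatives.

Section BanachSpace.
Context {X : NormedModule C_AbsRing}.

Definition is_bounded_inverse (A J : X -> X) : Prop :=
  is_linear J /\ (forall h, J (A h) = h) /\ (forall h, A (J h) = h).

(* Unspecified when A has no bounded inverse. *)
Definition bounded_inverse (A : X -> X) : X -> X :=
  epsilon (inhabits (fun h : X => h)) (is_bounded_inverse A).

Definition is_operator_norm (T : X -> C) (r : R) : Prop :=
  is_lub (fun s : R => exists y : X, norm y <= 1 /\ s = Cmod (T y)) r.

(* T belongs to the set T(x). *)
Definition support_functional (x : X) (T : X -> C) : Prop :=
  is_linear (V := C_NormedModule) T /\
  T x = RtoC (norm x) /\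
  is_operator_norm T 1.

Definition normalized (F : X -> X) : Prop :=
  F zero = zero /\ forall h : X, frechet_D 1 F zero [h] = h.

Definition locally_biholomorphic (F : X -> X) : Prop :=
  holomorphic_on_ball F /\
  forall x : X, norm x < 1 ->
    exists J : X -> X, is_bounded_inverse (fun h => frechet_D 1 F x [h]) J.

Definition class_F (lambda : R) (F : X -> X) : Prop :=
  normalized F /\
  locally_biholomorphic F /\
  forall (x : X) (T : X -> C),
    norm x < 1 -> x <> zero -> support_functional x T ->
    Re (T (scal (RtoC (/ norm x))
             (bounded_inverse (fun h => frechet_D 1 F x [h])
                (plus (frechet_D 2 F x [x; x]) (frechet_D 1 F x [x])))))
      >= 1 / 2 - lambda.

Definition coefA (n : nat) (F : X -> X) (x0 : X) (T : X -> C) : C :=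
  Cdiv (T (frechet_D n F zero (repeat x0 n))) (RtoC (INR (fact n))).

End BanachSpace.

Definition det3 (a11 a12 a13 a21 a22 a23 a31 a32 a33 : C) : C :=
  (a11 * (a22 * a33 - a23 * a32)
   - a12 * (a21 * a33 - a23 * a31)
   + a13 * (a21 * a32 - a22 * a31))%C.

Definition toeplitz3 (a2 a3 : C) : C :=
  det3 1            a2         a3
       (Cconj a2)   1          a2
       (Cconj a3)   (Cconj a2) 1.

Lemma toeplitz3E (a2 a3 : C) :
  toeplitz3 a2 a3 =
  RtoC (1 - 2 * Cmod a2 ^ 2 + 2 * Re (a2 ^ 2 * Cconj a3)%C - Cmod a3 ^ 2).
Proof.
destruct a2 as [a b], a3 as [c d].
unfold Cmod; rewrite !pow2_sqrt; simpl; try nra.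
unfold toeplitz3, det3, RtoC, Cconj, Cminus, Cplus, Copp, Cmult; simpl.
f_equal; ring.
Qed.

(* The determinant is a real number by [toeplitz3E]. *)
Definition T31 {X : NormedModule C_AbsRing} (F : X -> X) (x0 : X)
    (T : X -> C) : R :=
  Re (toeplitz3 (coefA 2 F x0 T) (coefA 3 F x0 T)).

Definition T31_lower (lambda : R) : R :=
  - ((2 * lambda - 1) ^ 2 * (2 * lambda + 5) ^ 2
     / (64 * lambda * (2 * lambda + 3))).

Definition T31_upper (lambda : R) : R :=
  if Rle_dec lambda ((sqrt 153 - 5) / 8) then 1
  else 1 + (1 + 2 * lambda) ^ 2 * (4 * lambda ^ 2 + 5 * lambda - 8) / 18.

(* Main.v *)
(** Along the slice z |-> z x0 the class condition is Re (1 + z f''/f') >= 1/2 - lambda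
    for f z = z g(z x0), so Caratheodory's inequality for the first two coefficients
    of (1 + z f''/f' + mu - 1) / mu, with mu = lambda + 1/2, confines A_3 - A_2^2 to an
    annulus whose radii depend on |A_2|; since
    T_{3,1} = (1 - |A_2|^2)^2 - |A_3 - A_2^2|^2, both bounds become one-variable
    inequalities.

    That g has the Frechet derivatives of higher order used here comes from Goursat's
    theorem, through the maximum principle: it bounds dg on each complex line, hence
    also the increments of dg. The second difference of g then makes
    E(k, h) = dg(y + k) h - dg(y) h symmetric up to terms of third order, so
    E(t k, h) / t is Cauchy as t tends to 0 and its limit is the second derivative.

    For sharpness, F x = h(T x) x with T a support functional (Hahn-Banach) and
    f z = z h z the primitive of (1 - 2 c z + z^2)^(-mu). As mu - 1 <= 1/2, f is
    close-to-convex with respect to the primitive of 1 / (1 - 2 c z + z^2), which maps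
    the disc onto a strip or a half-plane; hence h has no zero. *)
Require Import Defs.
From Stdlib Require Import Reals List Lra Lia ClassicalEpsilon.
From Coquelicot Require Import Coquelicot.
From mathcomp.classical Require classical_sets boolp.
Open Scope R_scope.

(** * Goursat's theorem and the maximum principle *)

(** Only complex differentiability at each point is given, while the class condition speaks of
    derivatives in operator norm that are chosen by [epsilon]. Such derivatives must therefore be
    shown to exist in this strong sense and to be unique. The complex analysis is drawn from one
    fact: if [Re chi >= 0] on a circle, then also at its centre. With a difference quotient in [chi]
    it yields Cauchy's estimate, and with [P |f|^2], corrected on the circle, Caratheodory's
    inequality; neither Cauchy's formula nor a power series occurs.

    Radial maps reduce to one variable because [D F(x)] maps the line through [x] into itself. The
    third derivative of [F] is evaluated only at the origin, where continuity of the second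
    derivative of [g] suffices.

    In [s = |A_2|^2] the lower bound is the minimum of a quadratic polynomial. The upper bound is
    the larger of 1 and the value at [s = mu^2] of a convex function; the identity attains the
    former and [c = 1] the latter, whence the two cases. *)

Definition total_diff (U : R -> R -> R) (s t a b : R) : Prop :=
  forall eps, 0 < eps -> exists d, 0 < d /\ forall s' t',
    Rabs (s' - s) < d -> Rabs (t' - t) < d ->
    Rabs (U s' t' - U s t - a * (s' - s) - b * (t' - t))
      <= eps * (Rabs (s' - s) + Rabs (t' - t)).

Lemma total_diff_swap (U : R -> R -> R) (s t a b : R) :
  total_diff U s t a b -> total_diff (fun x y => U y x) t s b a.
Proof.
intros H eps He; destruct (H eps He) as [d [Hd K]].
exists d; split; [exact Hd|]; intros t' s' Ht Hs.
specialize (K s' t' Hs Ht).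
replace (U s' t' - U s t - b * (t' - t) - a * (s' - s))
  with (U s' t' - U s t - a * (s' - s) - b * (t' - t)) by ring.
lra.
Qed.

Lemma total_diff_continuous_r (U : R -> R -> R) (s t a b : R) :
  total_diff U s t a b -> continuous (fun y => U s y) t.
Proof.
intros H; apply continuity_pt_filterlim; intros eps He.
destruct (H 1 Rlt_0_1) as [d [Hd K]].
assert (Hb := Rabs_pos b).
assert (Hp : 0 < eps / (2 + Rabs b)) by (apply Rdiv_lt_0_compat; lra).
exists (Rmin d (eps / (2 + Rabs b))); split; [now apply Rmin_glb_lt|].
intros y [_ Hy]; simpl in *; unfold Rdist in *.
assert (H1 : Rabs (y - t) < d) by (eapply Rlt_le_trans; [exact Hy|apply Rmin_l]).
assert (H2 : Rabs (y - t) < eps / (2 + Rabs b))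
  by (eapply Rlt_le_trans; [exact Hy|apply Rmin_r]).
assert (H0 : Rabs (s - s) < d) by (rewrite Rminus_diag, Rabs_R0; exact Hd).
specialize (K s y H0 H1); rewrite Rminus_diag, Rabs_R0 in K.
replace (U s y - U s t)
  with ((U s y - U s t - a * 0 - b * (y - t)) + b * (y - t)) by ring.
eapply Rle_lt_trans; [apply Rabs_triang|]; rewrite Rabs_mult.
apply <- Rlt_div_r in H2; [|lra].
assert (Hq := Rabs_pos (y - t)); nra.
Qed.

Section Green.
Variables (U V : R -> R -> R) (s0 s1 t0 t1 : R).
Hypothesis (Hs : s0 <= s1) (Ht : t0 <= t1).
Hypothesis dUV : forall s t, s0 <= s <= s1 -> t0 <= t <= t1 ->
  exists a b c, total_diff U s t a b /\ total_diff V s t c a.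

(** The integral of [V ds + U dt] once counterclockwise around the rectangle. The form is closed:
    [U_s] and [V_t] share the value [a] in [dUV]. *)
Let defect a b c d :=
  RInt (U b) c d - RInt (U a) c d
  - (RInt (fun s => V s d) a b - RInt (fun s => V s c) a b).

Lemma green_ex_U s c d :
  s0 <= s <= s1 -> t0 <= c -> c <= d -> d <= t1 -> ex_RInt (U s) c d.
Proof.
intros H1 H2 H3 H4; apply (@ex_RInt_continuous R_CompleteNormedModule).
rewrite Rmin_left, Rmax_right by lra; intros z Hz.
destruct (dUV s z H1) as [a [b [c' [K _]]]]; [lra|].
exact (total_diff_continuous_r _ _ _ _ _ K).
Qed.

Lemma green_ex_V t a b :
  t0 <= t <= t1 -> s0 <= a -> a <= b -> b <= s1 -> ex_RInt (fun s => V s t) a b.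
Proof.
intros H1 H2 H3 H4; apply (@ex_RInt_continuous R_CompleteNormedModule).
rewrite Rmin_left, Rmax_right by lra; intros z Hz.
destruct (dUV z t) as [a' [b' [c' [_ K]]]]; [lra|lra|].
exact (total_diff_continuous_r _ _ _ _ _ (total_diff_swap _ _ _ _ _ K)).
Qed.

Lemma green_split a m b c n d :
  s0 <= a -> a <= m -> m <= b -> b <= s1 ->
  t0 <= c -> c <= n -> n <= d -> d <= t1 ->
  defect a b c d =
  defect a m c n + defect m b c n + defect a m n d + defect m b n d.
Proof.
intros; unfold defect.
assert (CU : forall s, s0 <= s <= s1 ->
  RInt (U s) c d = RInt (U s) c n + RInt (U s) n d).
{ intros s Hs'; symmetry; apply (RInt_Chasles (V := R_CompleteNormedModule));
  apply green_ex_U; lra. }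
assert (CV : forall t, t0 <= t <= t1 ->
  RInt (fun s => V s t) a b = RInt (fun s => V s t) a m + RInt (fun s => V s t) m b).
{ intros s Hs'; symmetry;
  apply (RInt_Chasles (V := R_CompleteNormedModule) (fun x => V x s));
  apply green_ex_V; lra. }
rewrite (CU a), (CU b), (CV c), (CV d) by lra; ring.
Qed.

(** The affine parts of [U] and [V] at [(s, t)] contribute [p] times the area to each of the two
    differences of integrals, so they cancel. What remains is the error of differentiability, at
    most [eps * w] times the length of a side. The estimate uses the derivatives at the single point
    [(s, t)]. *)
Lemma green_small s t eps :
  s0 <= s <= s1 -> t0 <= t <= t1 -> 0 < eps ->
  exists d, 0 < d /\ forall a b c e,
    s0 <= a -> a <= s -> s <= b -> b <= s1 ->
    t0 <= c -> c <= t -> t <= e -> e <= t1 ->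
    b - a < d -> e - c < d ->
    Rabs (defect a b c e) <= eps * ((b - a) + (e - c)) ^ 2.
Proof.
intros H1 H2 He.
destruct (dUV s t H1 H2) as [p [q [r [K L]]]].
destruct (K (eps / 2)) as [d1 [Hd1 K1]]; [lra|].
destruct (L (eps / 2)) as [d2 [Hd2 L1]]; [lra|].
exists (Rmin d1 d2); split; [now apply Rmin_glb_lt|].
intros a b c e Ha Has Hsb Hb Hc Hct Hte Hee Hab Hce.
assert (M1 := Rmin_l d1 d2); assert (M2 := Rmin_r d1 d2).
set (w := (b - a) + (e - c)).
assert (EU : forall x y, a <= x <= b -> c <= y <= e ->
  Rabs (U x y - U s t - p * (x - s) - q * (y - t)) <= eps / 2 * w).
{ intros x y Hx Hy.
  assert (X : Rabs (x - s) <= b - a) by (apply Rabs_le; lra).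
  assert (Y : Rabs (y - t) <= e - c) by (apply Rabs_le; lra).
  eapply Rle_trans; [apply K1; lra|].
  apply Rmult_le_compat_l; unfold w; lra. }
assert (EV : forall x y, a <= x <= b -> c <= y <= e ->
  Rabs (V x y - V s t - r * (x - s) - p * (y - t)) <= eps / 2 * w).
{ intros x y Hx Hy.
  assert (X : Rabs (x - s) <= b - a) by (apply Rabs_le; lra).
  assert (Y : Rabs (y - t) <= e - c) by (apply Rabs_le; lra).
  eapply Rle_trans; [apply L1; lra|].
  apply Rmult_le_compat_l; unfold w; lra. }
assert (IU : Rabs (RInt (U b) c e - RInt (U a) c e - p * (b - a) * (e - c))
             <= (e - c) * (eps * w)).
{ assert (E1 : ex_RInt (U b) c e) by (apply green_ex_U; lra).
  assert (E2 : ex_RInt (U a) c e) by (apply green_ex_U; lra).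
  assert (E3 := ex_RInt_minus _ _ _ _ E1 E2).
  assert (E4 := ex_RInt_const (V := R_NormedModule) c e (p * (b - a))).
  replace (RInt (U b) c e - RInt (U a) c e - p * (b - a) * (e - c)) with
    (RInt (fun y => minus (minus (U b y) (U a y)) (p * (b - a))) c e).
  2:{ rewrite (RInt_minus (V := R_CompleteNormedModule)) by assumption.
      rewrite (RInt_minus (V := R_CompleteNormedModule)) by assumption.
      rewrite (RInt_const (V := R_CompleteNormedModule)).
      unfold minus, plus, opp, scal; simpl; unfold mult; simpl; ring. }
  apply abs_RInt_le_const; [lra|exact (ex_RInt_minus _ _ _ _ E3 E4)|].
  intros y Hy; unfold minus, plus, opp; simpl.
  replace (U b y + - U a y + - (p * (b - a))) with
    ((U b y - U s t - p * (b - s) - q * (y - t)) -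
     (U a y - U s t - p * (a - s) - q * (y - t))) by ring.
  eapply Rle_trans; [apply Rabs_triang|]; rewrite Rabs_Ropp.
  assert (F1 := EU b y); assert (F2 := EU a y).
  assert (F3 := F1 ltac:(lra) Hy); assert (F4 := F2 ltac:(lra) Hy); lra. }
assert (IV : Rabs (RInt (fun x => V x e) a b - RInt (fun x => V x c) a b
                   - p * (b - a) * (e - c)) <= (b - a) * (eps * w)).
{ assert (E1 : ex_RInt (fun x => V x e) a b) by (apply green_ex_V; lra).
  assert (E2 : ex_RInt (fun x => V x c) a b) by (apply green_ex_V; lra).
  assert (E3 := ex_RInt_minus _ _ _ _ E1 E2).
  assert (E4 := ex_RInt_const (V := R_NormedModule) a b (p * (e - c))).
  replace (RInt (fun x => V x e) a b - RInt (fun x => V x c) a b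
           - p * (b - a) * (e - c)) with
    (RInt (fun x => minus (minus (V x e) (V x c)) (p * (e - c))) a b).
  2:{ rewrite (RInt_minus (V := R_CompleteNormedModule)) by assumption.
      rewrite (RInt_minus (V := R_CompleteNormedModule)) by assumption.
      rewrite (RInt_const (V := R_CompleteNormedModule)).
      unfold minus, plus, opp, scal; simpl; unfold mult; simpl; ring. }
  apply abs_RInt_le_const; [lra|exact (ex_RInt_minus _ _ _ _ E3 E4)|].
  intros y Hy; unfold minus, plus, opp; simpl.
  replace (V y e + - V y c + - (p * (e - c))) with
    ((V y e - V s t - r * (y - s) - p * (e - t)) -
     (V y c - V s t - r * (y - s) - p * (c - t))) by ring.
  eapply Rle_trans; [apply Rabs_triang|]; rewrite Rabs_Ropp.
  assert (F1 := EV y e Hy ltac:(lra)); assert (F2 := EV y c Hy ltac:(lra)); lra. }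
unfold defect.
match goal with |- Rabs ?z <= _ => replace z with
 ((RInt (U b) c e - RInt (U a) c e - p * (b - a) * (e - c)) -
  (RInt (fun x => V x e) a b - RInt (fun x => V x c) a b
                   - p * (b - a) * (e - c))) by ring end.
eapply Rle_trans; [apply Rabs_triang|]; rewrite Rabs_Ropp; unfold w in *; nra.
Qed.

Let wd (n : nat) := / 2 ^ n.

Lemma green_halving n : wd n = 2 * wd (S n).
Proof. unfold wd; simpl; field; apply pow_nonzero; lra. Qed.

Theorem green_rectangle :
  RInt (U s1) t0 t1 - RInt (U s0) t0 t1 =
  RInt (fun s => V s t1) s0 s1 - RInt (fun s => V s t0) s0 s1.
Proof.
set (p := s1 - s0); set (q := t1 - t0).
set (D := fun (x : R * R) n =>
  defect (fst x) (fst x + p * wd n) (snd x) (snd x + q * wd n)).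
assert (Hwd : forall n, 0 < wd n) by (intros n; apply Rinv_0_lt_compat, pow_lt; lra).
assert (Hp : 0 <= p) by (unfold p; lra); assert (Hq : 0 <= q) by (unfold q; lra).
enough (Hbad : ~ 0 < Rabs (defect s0 s1 t0 t1)).
{ assert (H := Rabs_pos (defect s0 s1 t0 t1)).
  assert (E : defect s0 s1 t0 t1 = 0) by (apply Rabs_eq_0; lra).
  unfold defect in E; lra. }
intros Hbad; set (m := Rabs (defect s0 s1 t0 t1)) in *.
set (inside := fun (x : R * R) n =>
  s0 <= fst x /\ fst x + p * wd n <= s1 /\ t0 <= snd x /\ snd x + q * wd n <= t1).
set (nextto := fun (n : nat) (x y : R * R) =>
  fst x <= fst y /\ fst y + p * wd (S n) <= fst x + p * wd n /\
  snd x <= snd y /\ snd y + q * wd (S n) <= snd x + q * wd n).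
(* Goursat's bisection: one quarter carries at least a quarter of the defect. *)
assert (Hstep : forall n x, exists y, inside x n -> m * wd n ^ 2 <= Rabs (D x n) ->
  nextto n x y /\ m * wd (S n) ^ 2 <= Rabs (D y (S n))).
{ intros n x.
  destruct (excluded_middle_informative
    (inside x n /\ m * wd n ^ 2 <= Rabs (D x n))) as [[Hin Hx]|Hno].
  2: now exists x; intros H1 H2; destruct Hno.
  set (w := wd (S n)).
  assert (Ew : wd n = 2 * w) by apply green_halving.
  assert (Hw : 0 < w) by apply Hwd.
  assert (Hpw : 0 <= p * w) by nra.
  assert (Hqw : 0 <= q * w) by nra.
  destruct x as [x y]; unfold inside, nextto, D in *; simpl fst in *; simpl snd in *.
  rewrite Ew in *; fold w.
  rewrite (green_split x (x + p * w) _ y (y + q * w)) in Hx by lra.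
  assert (NN : forall z, m * w ^ 2 <= Rabs z \/ Rabs z < m * w ^ 2) by (intros; lra).
  assert (E1 : x + p * (2 * w) = x + p * w + p * w) by ring.
  assert (E2 : y + q * (2 * w) = y + q * w + q * w) by ring.
  rewrite E1, E2 in Hx |- *.
  set (d1 := defect x _ y _) in Hx.
  set (d2 := defect (x + p * w) _ y _) in Hx.
  set (d3 := defect x _ (y + q * w) _) in Hx.
  set (d4 := defect (x + p * w) _ (y + q * w) _) in Hx.
  destruct (NN d1) as [N1|N1]; [exists (x, y); simpl; intros; repeat split; try lra; exact N1|].
  destruct (NN d2) as [N2|N2];
    [exists (x + p * w, y); simpl; intros; repeat split; try lra; exact N2|].
  destruct (NN d3) as [N3|N3];
    [exists (x, y + q * w); simpl; intros; repeat split; try lra; exact N3|].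
  destruct (NN d4) as [N4|N4];
    [exists (x + p * w, y + q * w); simpl; intros; repeat split; try lra; exact N4|].
  exfalso.
  assert (T1 := Rabs_triang (d1 + d2 + d3) d4).
  assert (T2 := Rabs_triang (d1 + d2) d3).
  assert (T3 := Rabs_triang d1 d2).
  replace (m * (2 * w) ^ 2) with (4 * (m * w ^ 2)) in Hx by ring; lra. }
(* [Hstep] keeps its premises under the existential, so that a quarter is chosen for every [n] and
   [x] and the recursion [u] carries no proofs. *)
set (f := fun (nx : nat * (R * R)) =>
  proj1_sig (constructive_indefinite_description _ (Hstep (fst nx) (snd nx)))).
assert (Hf : forall nx, inside (snd nx) (fst nx) ->
  m * wd (fst nx) ^ 2 <= Rabs (D (snd nx) (fst nx)) ->
  nextto (fst nx) (snd nx) (f nx) /\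
  m * wd (S (fst nx)) ^ 2 <= Rabs (D (f nx) (S (fst nx)))).
{ intros nx; exact (proj2_sig (constructive_indefinite_description _
    (Hstep (fst nx) (snd nx)))). }
clearbody f.
set (u := fix u n := match n with O => (s0, t0) | S k => f (k, u k) end).
assert (Hu : forall n, inside (u n) n /\ m * wd n ^ 2 <= Rabs (D (u n) n)).
{ induction n as [|n [I1 I2]].
  - unfold inside, D, u, wd; simpl.
    rewrite Rinv_1, !Rmult_1_r; unfold p, q, m.
    replace (s0 + (s1 - s0)) with s1 by ring.
    replace (t0 + (t1 - t0)) with t1 by ring.
    repeat split; lra.
  - destruct (Hf (n, u n) I1 I2) as [J1 J2]; simpl in J1, J2.
    split; [|exact J2].
    unfold inside, nextto in *; simpl u; simpl fst in *; simpl snd in *.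
    lra. }
assert (Hnx : forall n, nextto n (u n) (u (S n))).
{ intros n; destruct (Hu n) as [I1 I2]; exact (proj1 (Hf (n, u n) I1 I2)). }
assert (Hmon : forall n k, fst (u n) <= fst (u (n + k)%nat) /\
    fst (u (n + k)%nat) + p * wd (n + k) <= fst (u n) + p * wd n /\
    snd (u n) <= snd (u (n + k)%nat) /\
    snd (u (n + k)%nat) + q * wd (n + k) <= snd (u n) + q * wd n).
{ intros n; induction k as [|k IH]; [rewrite Nat.add_0_r; lra|].
  rewrite Nat.add_succ_r; assert (K := Hnx (n + k)%nat); unfold nextto in K; lra. }
(* Every lower end lies below every upper end, so the nested rectangles have a common point
   [(s, t)]. *)
assert (Hcross : forall n k, fst (u n) <= fst (u k) + p * wd k /\
                             snd (u n) <= snd (u k) + q * wd k).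
{ intros n k; assert (A := Hmon n (Nat.max n k - n)%nat).
  assert (B := Hmon k (Nat.max n k - k)%nat).
  replace (n + (Nat.max n k - n))%nat with (Nat.max n k) in A by lia.
  replace (k + (Nat.max n k - k))%nat with (Nat.max n k) in B by lia.
  assert (W := Hwd (Nat.max n k)).
  assert (0 <= p * wd (Nat.max n k)) by nra.
  assert (0 <= q * wd (Nat.max n k)) by nra. lra. }
assert (Lim : forall (v r : nat -> R), (forall n k, v n <= r k) ->
  exists l, forall n, v n <= l <= r n).
{ intros v r H.
  destruct (completeness (fun x => exists n, x = v n)) as [l [L1 L2]].
  - exists (r O); intros x [n ->]; apply H.
  - now exists (v O), O.
  - exists l; intros n; split; [apply L1; now exists n|].
    apply L2; intros x [k ->]; apply H. }
destruct (Lim (fun n => fst (u n)) (fun n => fst (u n) + p * wd n)) as [s Hsl];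
  [intros; apply Hcross|].
destruct (Lim (fun n => snd (u n)) (fun n => snd (u n) + q * wd n)) as [t Htl];
  [intros; apply Hcross|].
assert (Hin0 := proj1 (Hu O)).
assert (Hs' : s0 <= s <= s1) by (assert (K := Hsl O); unfold inside in Hin0; lra).
assert (Ht' : t0 <= t <= t1) by (assert (K := Htl O); unfold inside in Hin0; lra).
assert (Hpq : 0 < (p + q) ^ 2 + 1) by nra.
(* With this constant the bound for the [n]th rectangle is at most half of [m * wd n ^ 2], which its
   defect is known to reach. The [+ 1] covers a rectangle that is a single point. *)
destruct (green_small s t (m / (2 * ((p + q) ^ 2 + 1))) Hs' Ht') as [d [Hd K]];
  [apply Rdiv_lt_0_compat; lra|].
destruct (pow_lt_1_zero (1 / 2) ltac:(rewrite Rabs_pos_eq; lra) (d / (p + q + 1)))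
  as [n Hn]; [apply Rdiv_lt_0_compat; lra|].
specialize (Hn n (le_n n)).
assert (Ew : (1 / 2) ^ n = wd n).
{ unfold wd, Rdiv; rewrite Rmult_1_l, pow_inv; reflexivity. }
rewrite Ew, Rabs_pos_eq in Hn by (left; apply Hwd).
assert (Hnd : wd n * (p + q + 1) < d).
{ apply <- Rlt_div_r in Hn; [|lra]; lra. }
destruct (Hu n) as [I1 I2]; unfold inside in I1.
assert (A1 := Hsl n); assert (A2 := Htl n).
assert (W := Hwd n); simpl in A1, A2.
assert (Hpw : 0 <= p * wd n) by nra.
assert (Hqw : 0 <= q * wd n) by nra.
specialize (K (fst (u n)) (fst (u n) + p * wd n) (snd (u n)) (snd (u n) + q * wd n)).
assert (K' : Rabs (D (u n) n) <= m / (2 * ((p + q) ^ 2 + 1)) *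
  (fst (u n) + p * wd n - fst (u n) + (snd (u n) + q * wd n - snd (u n))) ^ 2)
  by (apply K; lra).
replace (fst (u n) + p * wd n - fst (u n) + (snd (u n) + q * wd n - snd (u n)))
  with ((p + q) * wd n) in K' by ring.
replace (m / (2 * ((p + q) ^ 2 + 1)) * ((p + q) * wd n) ^ 2) with
  ((m * wd n ^ 2) * ((p + q) ^ 2 / ((p + q) ^ 2 + 1)) / 2) in K' by (field; lra).
assert (Hfr : (p + q) ^ 2 / ((p + q) ^ 2 + 1) <= 1).
{ apply Rle_div_l; [lra|]; lra. }
assert (Hm2 : 0 < m * wd n ^ 2) by (apply Rmult_lt_0_compat; [lra|apply pow_lt; lra]).
nra.
Qed.
End Green.

(** * Continuity and derivatives in one complex variable *)

Definition Ccts (f : C -> C) (z : C) : Prop :=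
  forall eps, 0 < eps -> exists d, 0 < d /\ forall w,
    Cmod (w - z)%C < d -> Cmod (f w - f z)%C < eps.

Definition Cder (f : C -> C) (z l : C) : Prop :=
  forall eps, 0 < eps -> exists d, 0 < d /\ forall w,
    Cmod (w - z)%C < d ->
    Cmod (f w - f z - l * (w - z))%C <= eps * Cmod (w - z)%C.

Lemma Cmod_minus_sym (z w : C) : Cmod (z - w)%C = Cmod (w - z)%C.
Proof. rewrite <- Cmod_opp; f_equal; ring. Qed.

Lemma Ccts_ext_loc (f g : C -> C) (z : C) (d0 : R) :
  0 < d0 -> (forall w, Cmod (w - z)%C < d0 -> f w = g w) -> Ccts f z -> Ccts g z.
Proof.
intros Hd0 E H eps He; destruct (H eps He) as [d [Hd K]].
exists (Rmin d d0); split; [now apply Rmin_glb_lt|]; intros w Hw.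
assert (Z : Cmod (z - z)%C < d0)
  by (replace (z - z)%C with (RtoC 0) by ring; rewrite Cmod_0; exact Hd0).
rewrite <- (E w), <- (E z Z).
- apply K; eapply Rlt_le_trans; [exact Hw|apply Rmin_l].
- eapply Rlt_le_trans; [exact Hw|apply Rmin_r].
Qed.

Lemma Ccts_const (c z : C) : Ccts (fun _ => c) z.
Proof.
intros eps He; exists 1; split; [lra|]; intros w _.
replace (c - c)%C with (RtoC 0) by ring; rewrite Cmod_0; exact He.
Qed.

Lemma Ccts_id (z : C) : Ccts (fun w => w) z.
Proof. intros eps He; exists eps; split; auto. Qed.

Lemma Ccts_comp (f g : C -> C) (z : C) :
  Ccts f z -> Ccts g (f z) -> Ccts (fun w => g (f w)) z.
Proof.
intros F G eps He; destruct (G eps He) as [d [Hd K]].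
destruct (F d Hd) as [d' [Hd' K']]; exists d'; split; auto.
Qed.

Lemma Ccts_plus (f g : C -> C) (z : C) :
  Ccts f z -> Ccts g z -> Ccts (fun w => f w + g w)%C z.
Proof.
intros F G eps He; destruct (F (eps / 2)) as [d [Hd K]]; [lra|].
destruct (G (eps / 2)) as [d' [Hd' K']]; [lra|].
exists (Rmin d d'); split; [now apply Rmin_glb_lt|]; intros w Hw.
assert (H1 := K w (Rlt_le_trans _ _ _ Hw (Rmin_l _ _))).
assert (H2 := K' w (Rlt_le_trans _ _ _ Hw (Rmin_r _ _))).
replace (f w + g w - (f z + g z))%C with ((f w - f z) + (g w - g z))%C by ring.
eapply Rle_lt_trans; [apply Cmod_triangle|lra].
Qed.

Lemma Ccts_mult (f g : C -> C) (z : C) :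
  Ccts f z -> Ccts g z -> Ccts (fun w => f w * g w)%C z.
Proof.
intros F G eps He.
set (B := 1 + Cmod (f z) + Cmod (g z)).
assert (P1 := Cmod_ge_0 (f z)); assert (P2 := Cmod_ge_0 (g z)).
assert (Hq : 0 < Rmin 1 (eps / (2 * B)))
  by (apply Rmin_glb_lt; [lra|apply Rdiv_lt_0_compat; unfold B; lra]).
destruct (F _ Hq) as [d [Hd K]]; destruct (G _ Hq) as [d' [Hd' K']].
exists (Rmin d d'); split; [now apply Rmin_glb_lt|]; intros w Hw.
assert (H1 := K w (Rlt_le_trans _ _ _ Hw (Rmin_l _ _))).
assert (H2 := K' w (Rlt_le_trans _ _ _ Hw (Rmin_r _ _))).
assert (R1 := Rmin_l 1 (eps / (2 * B))); assert (R2 := Rmin_r 1 (eps / (2 * B))).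
replace (f w * g w - f z * g z)%C
  with ((f w - f z) * (g w - g z) + f z * (g w - g z) + (f w - f z) * g z)%C by ring.
eapply Rle_lt_trans; [apply Cmod_triangle|].
eapply Rle_lt_trans; [apply Rplus_le_compat_r, Cmod_triangle|].
rewrite !Cmod_mult.
assert (Hqe : Rmin 1 (eps / (2 * B)) * B <= eps / 2).
{ apply Rmult_le_compat_r with (r := B) in R2; [|unfold B; lra].
  replace (eps / (2 * B) * B) with (eps / 2) in R2; [lra|field; unfold B; lra]. }
assert (Q1 := Cmod_ge_0 (f w - f z)); assert (Q2 := Cmod_ge_0 (g w - g z)).
set (q := Rmin 1 (eps / (2 * B))) in *.
assert (Y1 : Cmod (f w - f z) * Cmod (g w - g z) <= q * 1) by (apply Rmult_le_compat; lra).
assert (Y2 : Cmod (f z) * Cmod (g w - g z) <= Cmod (f z) * q) by (apply Rmult_le_compat_l; lra).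
assert (Y3 : Cmod (f w - f z) * Cmod (g z) <= q * Cmod (g z)) by (apply Rmult_le_compat_r; lra).
unfold B in Hqe; lra.
Qed.

Lemma Ccts_inv (f : C -> C) (z : C) :
  Ccts f z -> f z <> 0%C -> Ccts (fun w => / f w)%C z.
Proof.
intros F N eps He; assert (Hm := proj1 (Cmod_gt_0 (f z)) N).
set (m := Cmod (f z)) in *.
assert (Hq : 0 < Rmin (m / 2) (eps * (m * m / 2)))
  by (apply Rmin_glb_lt; [lra|apply Rmult_lt_0_compat; nra]).
destruct (F _ Hq) as [d [Hd K]]; exists d; split; [exact Hd|]; intros w Hw.
specialize (K w Hw).
destruct (Rmin_Rgt_l _ _ _ K) as [K1 K2].
assert (Hfw : m / 2 < Cmod (f w)).
{ assert (T := Cmod_triangle (f w) (f z - f w)).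
  replace (f w + (f z - f w))%C with (f z) in T by ring; fold m in T.
  rewrite Cmod_minus_sym in T; lra. }
assert (Nw : f w <> 0%C) by (intros E; rewrite E, Cmod_0 in Hfw; lra).
replace (/ f w - / f z)%C with (- (f w - f z) / (f w * f z))%C by (field; auto).
rewrite Cmod_div by (now apply Cmult_neq_0).
rewrite Cmod_opp, Cmod_mult; fold m.
apply Rmult_lt_reg_r with (Cmod (f w) * m); [nra|].
unfold Rdiv; rewrite Rmult_assoc, Rinv_l by nra; rewrite Rmult_1_r.
eapply Rlt_le_trans; [exact K2|].
apply Rmult_le_compat_l; [lra|]; nra.
Qed.

(** Caratheodory's form of the derivative: a slope function continuous at [z]. The rules of
    differentiation below become rules for continuous functions, and the slope also serves as [chi]
    in the maximum principle. *)
Lemma Cder_slope (f : C -> C) (z l : C) : Cder f z l ->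
  exists Q, Ccts Q z /\ Q z = l /\ forall w, f w = (f z + Q w * (w - z))%C.
Proof.
intros H.
exists (fun w => if Ceq_dec w z then l else ((f w - f z) / (w - z))%C).
assert (E0 : (if Ceq_dec z z then l else ((f z - f z) / (z - z))%C) = l)
  by (destruct (Ceq_dec z z); congruence).
split; [|split; [exact E0|]].
- intros eps He; destruct (H (eps / 2)) as [d [Hd K]]; [lra|].
  exists d; split; [exact Hd|]; intros w Hw; rewrite E0.
  destruct (Ceq_dec w z) as [->|N].
  + replace (l - l)%C with (RtoC 0) by ring; rewrite Cmod_0; exact He.
  + assert (N' : (w - z)%C <> 0%C).
    { intros E; apply N; replace w with ((w - z) + z)%C by ring; rewrite E; ring. }
    assert (P := proj1 (Cmod_gt_0 _) N').
    replace ((f w - f z) / (w - z) - l)%C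
      with ((f w - f z - l * (w - z)) / (w - z))%C by (field; exact N').
    rewrite Cmod_div by exact N'.
    apply Rmult_lt_reg_r with (Cmod (w - z)); [exact P|].
    unfold Rdiv; rewrite Rmult_assoc, Rinv_l by lra.
    specialize (K w Hw); nra.
- intros w; destruct (Ceq_dec w z) as [->|N]; [ring|].
  field; intros E; apply N; replace w with ((w - z) + z)%C by ring; rewrite E; ring.
Qed.

Lemma slope_Cder (f Q : C -> C) (z l : C) :
  Ccts Q z -> Q z = l -> (forall w, f w = (f z + Q w * (w - z))%C) -> Cder f z l.
Proof.
intros H E K eps He; destruct (H eps He) as [d [Hd L]].
exists d; split; [exact Hd|]; intros w Hw; rewrite (K w), <- E.
replace (f z + Q w * (w - z) - f z - Q z * (w - z))%C
  with ((Q w - Q z) * (w - z))%C by ring.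
rewrite Cmod_mult; apply Rmult_le_compat_r; [apply Cmod_ge_0|]; left; auto.
Qed.

Lemma Cder_Ccts (f : C -> C) (z l : C) : Cder f z l -> Ccts f z.
Proof.
intros H; destruct (Cder_slope _ _ _ H) as [Q [H1 [H2 H3]]].
apply (Ccts_ext_loc (fun w => f z + Q w * (w + - z))%C _ _ 1); [lra|intros; symmetry; apply H3|].
apply Ccts_plus; [apply Ccts_const|apply Ccts_mult; [exact H1|]].
apply Ccts_plus; [apply Ccts_id|apply Ccts_const].
Qed.

Lemma Cder_ext_loc (f g : C -> C) (z l : C) (d0 : R) :
  0 < d0 -> (forall w, Cmod (w - z)%C < d0 -> f w = g w) ->
  Cder f z l -> Cder g z l.
Proof.
intros Hd0 E H eps He; destruct (H eps He) as [d [Hd K]].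
exists (Rmin d d0); split; [now apply Rmin_glb_lt|]; intros w Hw.
assert (Z : Cmod (z - z)%C < d0)
  by (replace (z - z)%C with (RtoC 0) by ring; rewrite Cmod_0; exact Hd0).
rewrite <- (E w), <- (E z Z).
- apply K; eapply Rlt_le_trans; [exact Hw|apply Rmin_l].
- eapply Rlt_le_trans; [exact Hw|apply Rmin_r].
Qed.

Lemma Cder_const (c z : C) : Cder (fun _ => c) z 0%C.
Proof. apply (slope_Cder _ (fun _ => 0%C)); [apply Ccts_const|auto|intros; ring]. Qed.

Lemma Cder_id (z : C) : Cder (fun w => w) z 1%C.
Proof. apply (slope_Cder _ (fun _ => 1%C)); [apply Ccts_const|auto|intros; ring]. Qed.

Lemma Cder_plus (f g : C -> C) (z a b : C) :
  Cder f z a -> Cder g z b -> Cder (fun w => f w + g w)%C z (a + b)%C.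
Proof.
intros F G; destruct (Cder_slope _ _ _ F) as [P [P1 [P2 P3]]].
destruct (Cder_slope _ _ _ G) as [Q [Q1 [Q2 Q3]]].
apply (slope_Cder _ (fun w => P w + Q w)%C);
  [now apply Ccts_plus|congruence|intros w; rewrite (P3 w), (Q3 w); ring].
Qed.

Lemma Cder_mult (f g : C -> C) (z a b : C) :
  Cder f z a -> Cder g z b -> Cder (fun w => f w * g w)%C z (a * g z + f z * b)%C.
Proof.
intros F G; destruct (Cder_slope _ _ _ F) as [P [P1 [P2 P3]]].
destruct (Cder_slope _ _ _ G) as [Q [Q1 [Q2 Q3]]].
apply (slope_Cder _ (fun w => P w * g w + f z * Q w)%C).
- apply Ccts_plus; apply Ccts_mult; auto; [eapply Cder_Ccts; eauto|apply Ccts_const].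
- now rewrite P2, Q2.
- intros w; rewrite (P3 w), (Q3 w); ring.
Qed.

Lemma Cder_scal (c : C) (f : C -> C) (z a : C) :
  Cder f z a -> Cder (fun w => c * f w)%C z (c * a)%C.
Proof.
intros F; replace (c * a)%C with (0 * f z + c * a)%C by ring.
apply (Cder_mult (fun _ => c)); [apply Cder_const|exact F].
Qed.

Lemma Cder_opp (f : C -> C) (z a : C) : Cder f z a -> Cder (fun w => - f w)%C z (- a)%C.
Proof.
intros F; destruct (Cder_slope _ _ _ F) as [P [P1 [P2 P3]]].
apply (slope_Cder _ (fun w => (- 1) * P w)%C).
- apply Ccts_mult; [apply Ccts_const|exact P1].
- rewrite P2; ring.
- intros w; rewrite (P3 w); ring.
Qed.

Lemma Cder_minus (f g : C -> C) (z a b : C) :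
  Cder f z a -> Cder g z b -> Cder (fun w => f w - g w)%C z (a - b)%C.
Proof. intros F G; apply Cder_plus; [exact F|now apply Cder_opp]. Qed.

Lemma Cder_inv (f : C -> C) (z a : C) :
  Cder f z a -> f z <> 0%C -> Cder (fun w => / f w)%C z (- a / (f z * f z))%C.
Proof.
intros F N; destruct (Cder_slope _ _ _ F) as [P [P1 [P2 P3]]].
assert (Hm := proj1 (Cmod_gt_0 (f z)) N).
destruct (Cder_Ccts _ _ _ F _ Hm) as [d [Hd K]].
assert (Nz : forall w, Cmod (w - z) < d -> f w <> 0%C).
{ intros w Hw E; specialize (K w Hw); rewrite E in K.
  replace (0 - f z)%C with (- f z)%C in K by ring; rewrite Cmod_opp in K; lra. }
apply (Cder_ext_loc
  (fun w => / f z + (- P w * / (f w * f z)) * (w - z))%C _ _ _ d Hd).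
- intros w Hw; assert (Nw := Nz w Hw).
  assert (E : (P w * (w - z) = f w - f z)%C) by (rewrite (P3 w); ring).
  replace (- P w * / (f w * f z) * (w - z))%C
    with (- (P w * (w - z)) * / (f w * f z))%C by ring.
  rewrite E; field; auto.
- apply (slope_Cder _ (fun w => - P w * / (f w * f z))%C).
  + apply Ccts_mult.
    * apply (Ccts_ext_loc (fun w => (- 1) * P w)%C _ _ 1); [lra|intros; ring|].
      apply Ccts_mult; [apply Ccts_const|exact P1].
    * apply Ccts_inv; [|now apply Cmult_neq_0].
      apply Ccts_mult; [eapply Cder_Ccts; eauto|apply Ccts_const].
  + now rewrite P2.
  + intros w; ring.
Qed.

Lemma Cder_div (f g : C -> C) (z a b : C) :
  Cder f z a -> Cder g z b -> g z <> 0%C ->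
  Cder (fun w => f w / g w)%C z ((a * g z - f z * b) / (g z * g z))%C.
Proof.
intros F G N.
replace ((a * g z - f z * b) / (g z * g z))%C
  with (a * / g z + f z * (- b / (g z * g z)))%C by (field; auto).
apply (Cder_mult f (fun w => / g w)%C); [exact F|now apply Cder_inv].
Qed.

Lemma Cder_comp (f g : C -> C) (z a b : C) :
  Cder f z a -> Cder g (f z) b -> Cder (fun w => g (f w)) z (b * a)%C.
Proof.
intros F G; destruct (Cder_slope _ _ _ F) as [P [P1 [P2 P3]]].
destruct (Cder_slope _ _ _ G) as [Q [Q1 [Q2 Q3]]].
apply (slope_Cder _ (fun w => Q (f w) * P w)%C).
- apply Ccts_mult; auto; apply (Ccts_comp f Q); [eapply Cder_Ccts; eauto|auto].
- now rewrite P2, Q2.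
- intros w; rewrite (Q3 (f w)).
  assert (E : (f w - f z = P w * (w - z))%C) by (rewrite (P3 w); ring).
  rewrite E; ring.
Qed.

Lemma Cder_unique (f : C -> C) (z a b : C) : Cder f z a -> Cder f z b -> a = b.
Proof.
intros F G; destruct (Ceq_dec a b) as [E|N]; [exact E|exfalso].
assert (Hm : 0 < Cmod (a - b)).
{ apply Cmod_gt_0; intros E; apply N; replace a with ((a - b) + b)%C by ring.
  rewrite E; ring. }
destruct (F (Cmod (a - b) / 4)) as [d [Hd K]]; [lra|].
destruct (G (Cmod (a - b) / 4)) as [d' [Hd' K']]; [lra|].
set (e := Rmin d d' / 2).
assert (He : 0 < Rmin d d') by now apply Rmin_glb_lt.
assert (M1 := Rmin_l d d'); assert (M2 := Rmin_r d d').
assert (Ew : Cmod (z + RtoC e - z) = e).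
{ replace (z + RtoC e - z)%C with (RtoC e) by ring; rewrite Cmod_R.
  apply Rabs_pos_eq; unfold e; lra. }
assert (A := K (z + RtoC e)%C); assert (B := K' (z + RtoC e)%C).
rewrite Ew in A, B.
assert (A' := A ltac:(unfold e; lra)); assert (B' := B ltac:(unfold e; lra)).
assert (T := Cmod_triangle
  (- (f (z + RtoC e) - f z - a * (z + RtoC e - z)))%C
  (f (z + RtoC e) - f z - b * (z + RtoC e - z))%C).
rewrite Cmod_opp in T.
replace (- (f (z + RtoC e) - f z - a * (z + RtoC e - z)) +
  (f (z + RtoC e) - f z - b * (z + RtoC e - z)))%C
  with ((a - b) * (z + RtoC e - z))%C in T by ring.
rewrite Cmod_mult, Ew in T; unfold e in *; nra.
Qed.

Lemma re_le_Cmod (z : C) : Rabs (fst z) <= Cmod z.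
Proof. eapply Rle_trans; [apply Rmax_l|apply Rmax_Cmod]. Qed.

Lemma im_le_Cmod (z : C) : Rabs (snd z) <= Cmod z.
Proof. eapply Rle_trans; [apply Rmax_r|apply Rmax_Cmod]. Qed.

Lemma Cmod_le_abs (z : C) : Cmod z <= Rabs (fst z) + Rabs (snd z).
Proof.
replace z with (RtoC (fst z) + Ci * RtoC (snd z))%C at 1.
- eapply Rle_trans; [apply Cmod_triangle|]; rewrite Cmod_mult, Cmod_Ci, !Cmod_R; lra.
- destruct z as [x y]; unfold Ci, RtoC, Cplus, Cmult; simpl; f_equal; ring.
Qed.

(** * The complex exponential and averages over circles *)

Definition Cexp (z : C) : C :=
  (exp (fst z) * cos (snd z), exp (fst z) * sin (snd z)).

Lemma Cexp_plus (z w : C) : Cexp (z + w)%C = (Cexp z * Cexp w)%C.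
Proof.
destruct z as [a b], w as [c d]; unfold Cexp, Cplus, Cmult; simpl.
rewrite exp_plus, cos_plus, sin_plus; f_equal; ring.
Qed.

Lemma Cexp_0 : Cexp 0%C = 1%C.
Proof. unfold Cexp; simpl; rewrite exp_0, cos_0, sin_0; unfold RtoC; f_equal; ring. Qed.

Lemma Cmod_Cexp (z : C) : Cmod (Cexp z) = exp (fst z).
Proof.
unfold Cexp, Cmod; simpl.
replace (_ + _) with (exp (fst z) ^ 2 * (Rsqr (sin (snd z)) + Rsqr (cos (snd z))))
  by (unfold Rsqr; ring).
rewrite sin2_cos2, Rmult_1_r; apply sqrt_pow2; left; apply exp_pos.
Qed.

Lemma Cexp_neq_0 (z : C) : Cexp z <> 0%C.
Proof. apply Cmod_gt_0; rewrite Cmod_Cexp; apply exp_pos. Qed.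

Lemma derivable_pt_lim_le (f : R -> R) (x l eps : R) :
  derivable_pt_lim f x l -> 0 < eps -> exists d, 0 < d /\ forall h, Rabs h < d ->
  Rabs (f (x + h) - f x - l * h) <= eps * Rabs h.
Proof.
intros H He; destruct (H eps He) as [d K]; exists d; split; [apply cond_pos|].
intros h Hh; destruct (Req_dec h 0) as [->|N].
- rewrite Rplus_0_r; replace (f x - f x - l * 0) with 0 by ring.
  rewrite Rabs_R0; lra.
- specialize (K h N Hh).
  replace (f (x + h) - f x - l * h) with (((f (x + h) - f x) / h - l) * h)
    by (field; exact N).
  rewrite Rabs_mult; apply Rmult_le_compat_r; [apply Rabs_pos|lra].
Qed.

Lemma Cder_Cexp_0 : Cder Cexp 0%C 1%C.
Proof.
(* The four error terms at the end add up to at most [9 * e * m], where [m = Cmod z < e]. *)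
intros eps He; set (e := Rmin 1 (eps / 20)).
assert (E1 := Rmin_l 1 (eps / 20)); assert (E2 := Rmin_r 1 (eps / 20)); fold e in E1, E2.
assert (Hee : 0 < e) by (apply Rmin_glb_lt; lra).
destruct (derivable_pt_lim_le exp 0 1 e derivable_pt_lim_exp_0 Hee) as [d1 [H1 K1]].
assert (D2 : derivable_pt_lim cos 0 0)
  by (replace 0 with (- sin 0) at 2 by (rewrite sin_0; ring); apply derivable_pt_lim_cos).
assert (D3 : derivable_pt_lim sin 0 1)
  by (rewrite <- cos_0; apply derivable_pt_lim_sin).
destruct (derivable_pt_lim_le cos 0 0 e D2 Hee) as [d2 [H2 K2]].
destruct (derivable_pt_lim_le sin 0 1 e D3 Hee) as [d3 [H3 K3]].
exists (Rmin e (Rmin d1 (Rmin d2 d3))).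
split; [apply Rmin_glb_lt; [lra|]; repeat apply Rmin_glb_lt; lra|].
intros z; rewrite Cexp_0.
replace (z - 0)%C with z by ring; intros Hz.
destruct (Rmin_Rgt_l _ _ _ Hz) as [M0 M].
destruct (Rmin_Rgt_l _ _ _ M) as [M1 M'].
destruct (Rmin_Rgt_l _ _ _ M') as [M2 M3].
assert (A := re_le_Cmod z); assert (B := im_le_Cmod z).
set (m := Cmod z) in *; destruct z as [h k]; simpl in A, B.
specialize (K1 h ltac:(lra)); specialize (K2 k ltac:(lra)); specialize (K3 k ltac:(lra)).
rewrite Rplus_0_l, exp_0 in K1; rewrite Rplus_0_l, cos_0 in K2; rewrite Rplus_0_l, sin_0 in K3.
assert (Hh := Rabs_pos h); assert (Hk := Rabs_pos k).
assert (X1 : Rabs (exp h - 1) <= 2 * m).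
{ replace (exp h - 1) with ((exp h - 1 - 1 * h) + h) by ring.
  eapply Rle_trans; [apply Rabs_triang|]; nra. }
assert (X2 : Rabs (exp h) <= 3).
{ replace (exp h) with ((exp h - 1) + 1) by ring.
  eapply Rle_trans; [apply Rabs_triang|]; rewrite Rabs_R1; nra. }
unfold Cexp; simpl fst; simpl snd.
eapply Rle_trans; [apply Cmod_le_abs|]; unfold Cminus, Cplus, Copp, Cmult, RtoC; simpl.
replace (exp h * cos k + - (1) + - (1 * h - 0 * k)) with
  ((exp h - 1 - 1 * h) + exp h * (cos k - 1 - 0 * k)) by ring.
replace (exp h * sin k + - 0 + - (1 * k + 0 * h)) with
  (exp h * (sin k - 0 - 1 * k) + (exp h - 1) * k) by ring.
assert (T1 := Rabs_triang (exp h - 1 - 1 * h) (exp h * (cos k - 1 - 0 * k))).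
assert (T2 := Rabs_triang (exp h * (sin k - 0 - 1 * k)) ((exp h - 1) * k)).
rewrite Rabs_mult in T1; rewrite !Rabs_mult in T2.
assert (Y1 : Rabs (exp h) * Rabs (cos k - 1 - 0 * k) <= 3 * (e * m)).
{ apply Rmult_le_compat; try apply Rabs_pos; [exact X2|nra]. }
assert (Y2 : Rabs (exp h) * Rabs (sin k - 0 - 1 * k) <= 3 * (e * m)).
{ apply Rmult_le_compat; try apply Rabs_pos; [exact X2|nra]. }
assert (Y3 : Rabs (exp h - 1) * Rabs k <= 2 * m * m).
{ apply Rmult_le_compat; try apply Rabs_pos; lra. }
nra.
Qed.

Lemma Cder_Cexp (z : C) : Cder Cexp z (Cexp z).
Proof.
apply (Cder_ext_loc (fun w => Cexp z * Cexp (w - z))%C _ _ _ 1 Rlt_0_1).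
- intros w _; rewrite <- Cexp_plus; f_equal; ring.
- assert (E : (Cexp z * (1 * (1 - 0)) = Cexp z)%C) by ring.
  refine (eq_ind _ (Cder _ z) _ _ E).
  apply Cder_scal, (Cder_comp (fun w => w - z)%C Cexp).
  + apply Cder_minus; [apply Cder_id|apply Cder_const].
  + replace (z - z)%C with (RtoC 0) by ring; apply Cder_Cexp_0.
Qed.

(* The Cauchy-Riemann equations, in the form that [green_rectangle] takes. *)
Lemma Cder_total_diff (f : C -> C) (s t : R) (l : C) : Cder f (s, t) l ->
  total_diff (fun s t => fst (f (s, t))) s t (fst l) (- snd l) /\
  total_diff (fun s t => snd (f (s, t))) s t (snd l) (fst l).
Proof.
intros H.
assert (K : forall eps, 0 < eps -> exists d, 0 < d /\ forall s' t',
  Rabs (s' - s) < d -> Rabs (t' - t) < d ->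
  Cmod (f (s', t') - f (s, t) - l * ((s' - s)%R, (t' - t)%R))%C
    <= eps * (Rabs (s' - s) + Rabs (t' - t))).
{ intros eps He; destruct (H eps He) as [d [Hd K]].
  exists (d / 2); split; [lra|]; intros s' t' Hs Ht.
  assert (B := Cmod_le_abs (s' - s, t' - t)); simpl in B.
  assert (E : ((s', t') - (s, t))%C = (s' - s, t' - t))
    by (unfold Cminus, Cplus, Copp; simpl; f_equal; ring).
  specialize (K (s', t')); rewrite E in K.
  eapply Rle_trans; [apply K; lra|]; apply Rmult_le_compat_l; lra. }
split; intros eps He; destruct (K eps He) as [d [Hd L]];
  exists d; (split; [exact Hd|]); intros s' t' Hs Ht;
  (eapply Rle_trans; [|apply (L s' t' Hs Ht)]).
- eapply Rle_trans; [|apply re_le_Cmod]; right; f_equal.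
  unfold Cminus, Cplus, Copp, Cmult; simpl; ring.
- eapply Rle_trans; [|apply im_le_Cmod]; right; f_equal.
  unfold Cminus, Cplus, Copp, Cmult; simpl; ring.
Qed.

(* Green's theorem for chi(exp w) on a 2 pi i-periodic strip makes the circle
   averages of Re chi independent of the radius; no continuity of the derivative
   of chi is needed. *)
Theorem re_ge_0_of_circle (chi : C -> C) (R r : R) :
  (forall z, 0 < Cmod z < R -> exists l, Cder chi z l) -> Ccts chi 0%C ->
  0 < r < R -> (forall z, Cmod z = r -> 0 <= fst (chi z)) -> 0 <= fst (chi 0%C).
Proof.
intros D C0 [Hr0 HrR] Hpos.
destruct (Rle_dec 0 (fst (chi 0%C))) as [E|N]; [exact E|exfalso].
(* By contradiction: [Re chi] stays negative near 0, so its average over a small circle is negative,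
   while the equal average over the circle of radius [r] is not. *)
set (eps := - fst (chi 0%C)); assert (He : 0 < eps) by (unfold eps; lra).
destruct (C0 eps He) as [d [Hd K]].
set (r0 := Rmin (r / 2) (d / 2)).
assert (Hr0' : 0 < r0) by (apply Rmin_glb_lt; lra).
assert (M1 := Rmin_l (r / 2) (d / 2)); assert (M2 := Rmin_r (r / 2) (d / 2)).
fold r0 in M1, M2.
set (Phi := fun w => chi (Cexp w)).
assert (DP : forall s t, s <= ln r -> exists l, Cder Phi (s, t) l).
{ intros s t Hs.
  destruct (D (Cexp (s, t))) as [l Hl].
  { rewrite Cmod_Cexp; simpl; split; [apply exp_pos|].
    eapply Rle_lt_trans; [|exact HrR]; rewrite <- (exp_ln r Hr0).
    destruct Hs as [Hs|Hs]; [left; now apply exp_increasing|rewrite Hs; lra]. }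
  exists (l * Cexp (s, t))%C; apply (Cder_comp Cexp chi); [apply Cder_Cexp|exact Hl]. }
assert (Hln : ln r0 <= ln r) by (left; apply ln_increasing; lra).
assert (Hpi := PI_RGT_0).
assert (G := green_rectangle (fun s t => fst (Phi (s, t))) (fun s t => snd (Phi (s, t)))
  (ln r0) (ln r) 0 (2 * PI) Hln ltac:(lra)).
simpl in G.
assert (Per : forall s, Phi (s, 2 * PI) = Phi (s, 0)).
{ intros s; unfold Phi, Cexp; simpl; now rewrite cos_2PI, sin_2PI, cos_0, sin_0. }
rewrite (RInt_ext (fun s => snd (Phi (s, 2 * PI))) (fun s => snd (Phi (s, 0)))) in G
  by (intros; now rewrite Per).
assert (dT : forall s t, s <= ln r -> exists a b c,
  total_diff (fun s t => fst (Phi (s, t))) s t a b /\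
  total_diff (fun s t => snd (Phi (s, t))) s t c a).
{ intros s t Hs; destruct (DP s t Hs) as [l Hl].
  destruct (Cder_total_diff _ _ _ _ Hl) as [T1 T2].
  exists (fst l), (- snd l), (snd l); split; assumption. }
assert (EX : forall s, s <= ln r -> ex_RInt (fun t => fst (Phi (s, t))) 0 (2 * PI)).
{ intros s Hs; apply (@ex_RInt_continuous R_CompleteNormedModule); intros t _.
  destruct (dT s t Hs) as [a [b [c [T _]]]].
  exact (total_diff_continuous_r _ _ _ _ _ T). }
assert (I1 : 0 <= RInt (fun t => fst (Phi (ln r, t))) 0 (2 * PI)).
{ apply RInt_ge_0; [lra|apply EX; lra|]; intros t _; apply Hpos.
  rewrite Cmod_Cexp; simpl; now apply exp_ln. }
assert (I2 : RInt (fun t => fst (Phi (ln r0, t))) 0 (2 * PI) < 0).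
{ assert (E0 : RInt (fun _ => 0) 0 (2 * PI) = 0).
  { rewrite (RInt_const (V := R_CompleteNormedModule)).
    unfold scal; simpl; unfold mult; simpl; ring. }
  apply Rlt_le_trans with (2 := Req_le _ _ E0).
  apply RInt_lt; [lra| | |].
  - intros; apply continuous_const.
  - intros t Ht; destruct (dT (ln r0) t Hln) as [a [b [c [T _]]]].
    exact (total_diff_continuous_r _ _ _ _ _ T).
  - intros t _; assert (B := K (Cexp (ln r0, t))).
    replace (Cexp (ln r0, t) - 0)%C with (Cexp (ln r0, t)) in B by ring.
    rewrite Cmod_Cexp in B; simpl in B; rewrite exp_ln in B by exact Hr0'.
    specialize (B ltac:(lra)).
    assert (B' := re_le_Cmod (chi (Cexp (ln r0, t)) - chi 0)%C).
    apply Rle_lt_trans with (2 := B) in B'; apply Rabs_def2 in B'.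
    unfold Phi, eps in *; simpl in B'; lra. }
assert (dT' : forall s t, ln r0 <= s <= ln r -> 0 <= t <= 2 * PI -> exists a b c,
  total_diff (fun s t => fst (Phi (s, t))) s t a b /\
  total_diff (fun s t => snd (Phi (s, t))) s t c a)
  by (intros s t [_ Hs] _; now apply dT).
specialize (G dT'); lra.
Qed.

Lemma C_unimodular_rotation (z : C) :
  exists u, Cmod u = 1 /\ (u * z)%C = RtoC (Cmod z).
Proof.
destruct (Ceq_dec z 0%C) as [->|N].
- exists 1%C; rewrite Cmod_1, Cmod_0; split; [auto|ring].
- assert (P := proj1 (Cmod_gt_0 z) N).
  assert (NM : RtoC (Cmod z) <> 0%C) by (intros E; apply (f_equal fst) in E; simpl in E; lra).
  exists (RtoC (Cmod z) / z)%C; split; [|field; exact N].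
  rewrite Cmod_div by exact N; rewrite Cmod_R, Rabs_pos_eq by lra; field; lra.
Qed.

(** Positivity applied to [K - u chi], with [u] rotating [chi 0] onto the positive axis. At 0 mere
    continuity is assumed so that [chi] may be a difference quotient continued by the derivative. *)
Theorem Cmod_le_of_circle (chi : C -> C) (R r K : R) :
  (forall z, 0 < Cmod z < R -> exists l, Cder chi z l) -> Ccts chi 0%C ->
  0 < r < R -> (forall z, Cmod z = r -> Cmod (chi z) <= K) -> Cmod (chi 0%C) <= K.
Proof.
intros D C0 Hr Hb; destruct (C_unimodular_rotation (chi 0%C)) as [u [U1 U2]].
enough (H : 0 <= fst (RtoC K - u * chi 0)%C) by (rewrite U2 in H; simpl in H; lra).
apply (re_ge_0_of_circle (fun z => RtoC K - u * chi z)%C R r); [| |exact Hr|].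
- intros z Hz; destruct (D z Hz) as [l Hl]; exists (0 - u * l)%C.
  apply Cder_minus; [apply Cder_const|now apply Cder_scal].
- apply (Ccts_ext_loc (fun z => RtoC K + (- u) * chi z)%C _ _ 1); [lra|intros; ring|].
  apply Ccts_plus; [apply Ccts_const|apply Ccts_mult; [apply Ccts_const|exact C0]].
- intros z Hz; assert (B := Hb z Hz).
  assert (B' := re_le_Cmod (u * chi z)); rewrite Cmod_mult, U1, Rmult_1_l in B'.
  assert (B2 := Rle_abs (fst (u * chi z)%C)); unfold Cminus; simpl in *; lra.
Qed.

(** * Holomorphic functions on a normed space *)

Lemma scaled_error_le (eps a n : R) : 0 <= eps -> 0 <= a -> 0 <= n ->
  eps / (1 + n) * (a * n) <= eps * a.
Proof.
intros He Ha Hn; replace (eps / (1 + n) * (a * n)) with (eps * a * (n / (1 + n)))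
  by (field; lra).
rewrite <- (Rmult_1_r (eps * a)) at 2; apply Rmult_le_compat_l; [nra|].
apply Rle_div_l; lra.
Qed.

Section Holomorphy.
Context {X : NormedModule C_AbsRing}.
Implicit Types (x y h k : X) (g : X -> C).

(* Copies of [plus] and [scal] with a fixed structure argument, so that
   rewriting is not hindered by the several canonical paths to C_AbsRing. *)
Definition vadd x y : X := plus x y.
Definition vscal (c : C) x : X := scal c x.

Lemma vaddA x y z : vadd x (vadd y z) = vadd (vadd x y) z.
Proof. exact (plus_assoc x y z). Qed.

Lemma vaddC x y : vadd x y = vadd y x.
Proof. exact (plus_comm x y). Qed.

Lemma vadd0 x : vadd x zero = x.
Proof. exact (plus_zero_r x). Qed.

Lemma vscalA (c d : C) x : vscal c (vscal d x) = vscal (c * d)%C x.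
Proof. exact (scal_assoc c d x). Qed.

Lemma vscal1 x : vscal 1%C x = x.
Proof. exact (scal_one x). Qed.

Lemma vscal0 x : vscal 0%C x = zero.
Proof. exact (scal_zero_l x). Qed.

Lemma vscal_zero (c : C) : vscal c zero = zero.
Proof. exact (scal_zero_r c). Qed.

Lemma vscalDl (c d : C) x : vscal (c + d)%C x = vadd (vscal c x) (vscal d x).
Proof. exact (scal_distr_r c d x). Qed.

Lemma vscalDr (c : C) x y : vscal c (vadd x y) = vadd (vscal c x) (vscal c y).
Proof. exact (scal_distr_l c x y). Qed.

Lemma norm_vadd x y : norm (vadd x y) <= norm x + norm y.
Proof. exact (norm_triangle x y). Qed.

(** The axiom [norm_scal] is an inequality; for [/ c] it gives the reverse one. *)
Lemma norm_vscal (c : C) x : norm (vscal c x) = Cmod c * norm x.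
Proof.
apply Rle_antisym; [exact (norm_scal c x)|].
destruct (Ceq_dec c 0%C) as [->|N].
- rewrite Cmod_0, Rmult_0_l; apply norm_ge_0.
- assert (P := proj1 (Cmod_gt_0 c) N).
  assert (K : norm (vscal (/ c)%C (vscal c x)) <= Cmod (/ c)%C * norm (vscal c x))
    by exact (norm_scal _ _).
  assert (E : (/ c * c = 1)%C) by (field; exact N).
  rewrite vscalA, E, vscal1, Cmod_inv in K by exact N.
  apply Rmult_le_compat_l with (r := Cmod c) in K; [|lra].
  rewrite <- Rmult_assoc, Rinv_r, Rmult_1_l in K by lra; exact K.
Qed.

Lemma vadd_vscal_shift y h (z w : C) :
  vadd y (vscal w h) = vadd (vadd y (vscal z h)) (vscal (w - z)%C h).
Proof. rewrite <- vaddA, <- vscalDl; do 2 f_equal; ring. Qed.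

Definition Clinear (L : X -> C) : Prop := is_linear (V := C_NormedModule) L.

Lemma Clinear_plus L x y : Clinear L -> L (vadd x y) = (L x + L y)%C.
Proof. intros H; exact (linear_plus L H x y). Qed.

Lemma Clinear_scal L (c : C) x : Clinear L -> L (vscal c x) = (c * L x)%C.
Proof. intros H; exact (linear_scal L H c x). Qed.

Lemma Clinear_zero L : Clinear L -> L zero = 0%C.
Proof. intros H; rewrite <- (vscal0 zero), (Clinear_scal L) by exact H; ring. Qed.

Lemma Clinear_intro (L : X -> C) (M : R) :
  (forall x y, L (vadd x y) = (L x + L y)%C) ->
  (forall (c : C) x, L (vscal c x) = (c * L x)%C) ->
  (forall x, Cmod (L x) <= M * norm x) -> Clinear L.
Proof.
intros H1 H2 H3; split; [exact H1|exact H2|].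
exists (Rmax 1 M); split; [apply Rlt_le_trans with (2 := Rmax_l _ _); lra|].
intros x; eapply Rle_trans; [apply H3|].
apply Rmult_le_compat_r; [apply norm_ge_0|apply Rmax_r].
Qed.

Lemma Clinear_bound L : Clinear L -> exists M, 0 < M /\ forall x, Cmod (L x) <= M * norm x.
Proof. intros H; exact (linear_norm L H). Qed.

Definition Fder g x (L : X -> C) : Prop :=
  Clinear L /\ forall eps, 0 < eps -> exists d, 0 < d /\ forall h,
    norm h < d -> Cmod (g (vadd x h) - g x - L h)%C <= eps * norm h.

Lemma Fder_slice g y h (z : C) L : Fder g (vadd y (vscal z h)) L ->
  Cder (fun w => g (vadd y (vscal w h))) z (L h).
Proof.
intros [HL H] eps He; assert (Hh := norm_ge_0 h).
destruct (H (eps / (1 + norm h))) as [d [Hd K]]; [apply Rdiv_lt_0_compat; lra|].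
exists (d / (1 + norm h)); split; [apply Rdiv_lt_0_compat; lra|]; intros w Hw.
assert (Hc := Cmod_ge_0 (w - z)).
rewrite (vadd_vscal_shift y h z w).
assert (Nw : norm (vscal (w - z)%C h) < d).
{ rewrite norm_vscal; apply <- Rlt_div_r in Hw; [|lra]; nra. }
specialize (K _ Nw); rewrite (Clinear_scal L _ _ HL), norm_vscal in K.
replace (L h * (w - z))%C with ((w - z) * L h)%C by ring.
eapply Rle_trans; [exact K|].
apply scaled_error_le; lra.
Qed.

Lemma Fder_lipschitz_at g x L : Fder g x L -> exists K d, 0 < K /\ 0 < d /\
  forall h, norm h < d -> Cmod (g (vadd x h) - g x)%C <= K * norm h.
Proof.
intros [HL H]; destruct (Clinear_bound L HL) as [M [HM B]].
destruct (H 1 Rlt_0_1) as [d [Hd K]].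
exists (M + 1), d; split; [lra|]; split; [exact Hd|]; intros h Hh.
replace (g (vadd x h) - g x)%C with ((g (vadd x h) - g x - L h) + L h)%C by ring.
eapply Rle_trans; [apply Cmod_triangle|]; specialize (K h Hh); specialize (B h); lra.
Qed.

Lemma Fder_unique g x L L' h : Fder g x L -> Fder g x L' -> L h = L' h.
Proof.
intros H H'; apply (Cder_unique (fun w => g (vadd x (vscal w h))) 0%C).
- apply Fder_slice; now rewrite vscal0, vadd0.
- apply Fder_slice; now rewrite vscal0, vadd0.
Qed.

Lemma Fder_minus g g' x L L' : Fder g x L -> Fder g' x L' ->
  Fder (fun y => g y - g' y)%C x (fun h => L h - L' h)%C.
Proof.
intros [HL H] [HL' H']; split.
- destruct (Clinear_bound L HL) as [M [HM B]].
  destruct (Clinear_bound L' HL') as [M' [HM' B']].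
  apply (Clinear_intro _ (M + M')).
  + intros; rewrite (Clinear_plus L), (Clinear_plus L') by assumption; ring.
  + intros; rewrite (Clinear_scal L), (Clinear_scal L') by assumption; ring.
  + intros y; unfold Cminus; eapply Rle_trans; [apply Cmod_triangle|].
    rewrite Cmod_opp; specialize (B y); specialize (B' y); lra.
- intros eps He; destruct (H (eps / 2)) as [d [Hd K]]; [lra|].
  destruct (H' (eps / 2)) as [d' [Hd' K']]; [lra|].
  exists (Rmin d d'); split; [now apply Rmin_glb_lt|]; intros h Hh.
  assert (K1 := K h (Rlt_le_trans _ _ _ Hh (Rmin_l _ _))).
  assert (K2 := K' h (Rlt_le_trans _ _ _ Hh (Rmin_r _ _))).
  replace (g (vadd x h) - g' (vadd x h) - (g x - g' x) - (L h - L' h))%C with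
    ((g (vadd x h) - g x - L h) + - (g' (vadd x h) - g' x - L' h))%C by ring.
  eapply Rle_trans; [apply Cmod_triangle|]; rewrite Cmod_opp; lra.
Qed.

Lemma Fder_shift g x k L : Fder g (vadd x k) L -> Fder (fun y => g (vadd y k)) x L.
Proof.
intros [HL H]; split; [exact HL|]; intros eps He; destruct (H eps He) as [d [Hd K]].
exists d; split; [exact Hd|]; intros h Hh.
replace (vadd (vadd x h) k) with (vadd (vadd x k) h); [now apply K|].
rewrite <- !vaddA; f_equal; apply vaddC.
Qed.

Lemma Fder_linear L x : Clinear L -> Fder L x L.
Proof.
intros HL; split; [exact HL|]; intros eps He; exists 1; split; [lra|]; intros h _.
rewrite (Clinear_plus L) by exact HL.
replace (L x + L h - L x - L h)%C with (RtoC 0) by ring; rewrite Cmod_0.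
apply Rmult_le_pos; [lra|apply norm_ge_0].
Qed.

(** Explicit [R] and [M] keep the estimates below uniform in the centre [y], as the continuity of
    the second derivative requires. *)
Definition bounded_holo g (dg : X -> X -> C) y (R M : R) : Prop :=
  forall h, norm h < R ->
    Fder g (vadd y h) (dg (vadd y h)) /\ Cmod (g (vadd y h)) <= M.

Lemma bounded_holo_center g dg y R M : 0 < R -> bounded_holo g dg y R M ->
  Fder g y (dg y) /\ Cmod (g y) <= M.
Proof.
intros HR H; rewrite <- (vadd0 y) at 1 2 3; apply H.
now rewrite norm_zero.
Qed.

Lemma bounded_holo_sub g dg y a R R' M : norm a + R' <= R ->
  bounded_holo g dg y R M -> bounded_holo g dg (vadd y a) R' M.
Proof.
intros HR H h Hh; rewrite <- vaddA; apply H.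
eapply Rle_lt_trans; [apply norm_vadd|lra].
Qed.

(** Cauchy's estimate. On the slice [z |-> g(y + z h)] the difference quotient at 0 is at most
    [2 * M / (rho / 2)] on the circle of radius [rho / 2], and its value at 0 is the derivative. *)
Lemma bounded_holo_deriv g dg y R M h : 0 < R -> bounded_holo g dg y R M ->
  Cmod (dg y h) <= 4 * M / R * norm h.
Proof.
intros HR H; destruct (bounded_holo_center _ _ _ _ _ HR H) as [D0 B0].
assert (HL := proj1 D0); assert (M0 := Cmod_ge_0 (g y)).
destruct (Req_dec (norm h) 0) as [E|N].
{ rewrite (norm_eq_zero h E), (Clinear_zero _ HL), Cmod_0, norm_zero; lra. }
assert (Hh : 0 < norm h) by (assert (A := norm_ge_0 h); lra).
set (rho := R / norm h).
assert (Hrho : 0 < rho) by (apply Rdiv_lt_0_compat; lra).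
set (phi := fun z : C => g (vadd y (vscal z h))).
assert (Hin : forall z, Cmod z < rho -> norm (vscal z h) < R).
{ intros z Hz; rewrite norm_vscal.
  apply Rmult_lt_compat_r with (r := norm h) in Hz; [|lra].
  unfold rho, Rdiv in Hz; rewrite Rmult_assoc, Rinv_l, Rmult_1_r in Hz; lra. }
assert (Dphi : forall z, Cmod z < rho ->
  Cder phi z (dg (vadd y (vscal z h)) h)).
{ intros z Hz; apply Fder_slice, H, Hin, Hz. }
assert (E0 : vadd y (vscal (RtoC 0) h) = y)
  by (now rewrite vscal0, vadd0).
assert (D1 : Cder phi 0%C (dg y h)).
{ rewrite <- E0 at 1; apply Dphi; now rewrite Cmod_0. }
destruct (Cder_slope _ _ _ D1) as [Q [Q1 [Q2 Q3]]].
rewrite <- Q2.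
assert (EQ : forall z : C, z <> 0%C -> Q z = ((phi z - phi 0) / z)%C).
{ intros z Nz; rewrite (Q3 z); field; exact Nz. }
replace (4 * M / R * norm h) with (2 * M / (rho / 2)) by (unfold rho; field; lra).
apply (Cmod_le_of_circle Q rho (rho / 2)); [|exact Q1|lra|].
- intros z [Hz1 Hz2]; eexists.
  apply (Cder_ext_loc (fun z => (phi z - phi 0) / z)%C _ _ _ (Cmod z) Hz1).
  + intros w Hw; symmetry; apply EQ; intros E; rewrite E in Hw.
    replace (0 - z)%C with (- z)%C in Hw by ring; rewrite Cmod_opp in Hw; lra.
  + apply Cder_div; [|apply Cder_id|now apply Cmod_gt_0].
    apply Cder_minus; [now apply Dphi|apply Cder_const].
- intros z Hz; assert (Nz : z <> 0%C) by (apply Cmod_gt_0; lra).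
  rewrite (EQ z Nz), Cmod_div, Hz by exact Nz.
  apply Rmult_le_compat_r; [left; apply Rinv_0_lt_compat; lra|].
  unfold Cminus; eapply Rle_trans; [apply Cmod_triangle|]; rewrite Cmod_opp.
  assert (B1 := proj2 (H (vscal z h) (Hin z ltac:(lra)))).
  unfold phi; rewrite E0; lra.
Qed.

(** A complex-valued function has no mean value theorem, but the real part of [u g] has, with [u]
    rotating the increment onto the positive axis. *)
Lemma segment_bound g (dg : X -> X -> C) x k K :
  (forall t, 0 <= t <= 1 ->
     Fder g (vadd x (vscal (RtoC t) k)) (dg (vadd x (vscal (RtoC t) k))) /\
     Cmod (dg (vadd x (vscal (RtoC t) k)) k) <= K) ->
  Cmod (g (vadd x k) - g x)%C <= K.
Proof.
intros H; destruct (C_unimodular_rotation (g (vadd x k) - g x)%C) as [u [U1 U2]].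
set (f := fun t : R => fst (u * g (vadd x (vscal (RtoC t) k)))%C).
assert (Df : forall t, 0 <= t <= 1 ->
  is_derive f t (fst (u * dg (vadd x (vscal (RtoC t) k)) k)%C)).
{ intros t Ht; destruct (H t Ht) as [D _].
  apply Fder_slice in D; apply is_derive_Reals; intros eps He.
  apply (Cder_scal u) in D.
  destruct (D (eps / 2)) as [d [Hd L]]; [lra|].
  exists (mkposreal d Hd); intros s Ns Hs; simpl in Hs.
  assert (E : (RtoC (t + s) - RtoC t)%C = RtoC s) by (rewrite RtoC_plus; ring).
  specialize (L (RtoC (t + s))); rewrite E, Cmod_R in L; specialize (L Hs).
  unfold f.
  match goal with |- Rabs ?a < _ => replace a with
   (fst ((u * g (vadd x (vscal (RtoC (t + s)) k)) - u * g (vadd x (vscal (RtoC t) k))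
     - u * dg (vadd x (vscal (RtoC t) k)) k * RtoC s))%C / s) end.
  2:{ unfold Cminus, Cplus, Copp, RtoC; simpl; field; exact Ns. }
  unfold Rdiv; rewrite Rabs_mult, Rabs_inv.
  assert (Ps : 0 < Rabs s) by now apply Rabs_pos_lt.
  apply Rmult_lt_reg_r with (Rabs s); [exact Ps|].
  rewrite Rmult_assoc, Rinv_l, Rmult_1_r by lra.
  eapply Rle_lt_trans; [apply re_le_Cmod|].
  eapply Rle_lt_trans; [exact L|]; nra. }
destruct (MVT_gen f 0 1 (fun t => fst (u * dg (vadd x (vscal (RtoC t) k)) k)%C))
  as [t [Ht E]].
- rewrite Rmin_left, Rmax_right by lra; intros t Ht; apply Df; lra.
- rewrite Rmin_left, Rmax_right by lra; intros t Ht.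
  apply continuity_pt_filterlim.
  apply (ex_derive_continuous (V := R_NormedModule)); eexists; apply Df, Ht.
- rewrite Rmin_left, Rmax_right in Ht by lra.
  destruct (H t Ht) as [_ B].
  assert (E1 : vscal (RtoC 1) k = k) by apply vscal1.
  assert (E0 : vadd x (vscal (RtoC 0) k) = x)
    by (now rewrite vscal0, vadd0).
  unfold f in E; rewrite E1, E0 in E.
  assert (E2 : Cmod (g (vadd x k) - g x)%C =
    fst (u * g (vadd x k))%C - fst (u * g x)%C).
  { apply (f_equal fst) in U2; simpl in U2; rewrite <- U2.
    unfold Cminus, Cplus, Copp; simpl; ring. }
  rewrite E2, E, Rminus_0_r, Rmult_1_r.
  eapply Rle_trans; [apply Rle_abs|]; eapply Rle_trans; [apply re_le_Cmod|].
  now rewrite Cmod_mult, U1, Rmult_1_l.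
Qed.

Lemma norm_convex x k t r : 0 <= t <= 1 -> norm x < r -> norm (vadd x k) < r ->
  norm (vadd x (vscal (RtoC t) k)) < r.
Proof.
intros Ht H1 H2.
replace (vadd x (vscal (RtoC t) k))
  with (vadd (vscal (RtoC (1 - t)) x) (vscal (RtoC t) (vadd x k))).
- eapply Rle_lt_trans; [apply norm_vadd|].
  rewrite !norm_vscal, !Cmod_R, !Rabs_pos_eq by lra.
  destruct (Rle_dec (norm x) (norm (vadd x k))); nra.
- rewrite vscalDr, vaddA, <- vscalDl.
  rewrite <- RtoC_plus; replace (1 - t + t) with 1 by ring.
  now rewrite vscal1.
Qed.

Lemma bounded_holo_lipschitz g dg y R M a k : 0 < R -> bounded_holo g dg y R M ->
  norm a < R / 2 -> norm (vadd a k) < R / 2 ->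
  Cmod (g (vadd y (vadd a k)) - g (vadd y a))%C <= 8 * M / R * norm k.
Proof.
intros HR H Ha Hk; rewrite vaddA; apply (segment_bound g dg).
intros t Ht; rewrite <- vaddA.
assert (N := norm_convex a k t _ Ht Ha Hk).
split; [apply H; lra|].
replace (8 * M / R) with (4 * M / (R / 2)) by (field; lra).
apply (bounded_holo_deriv g); [lra|].
apply (bounded_holo_sub _ _ _ _ R); [lra|exact H].
Qed.

(** The increment is again holomorphic and is bounded by a multiple of [norm k]. Each estimate for
    [g], applied to it, thus gains a factor [norm k]. *)
Lemma bounded_holo_increment g dg y R M k : 0 < R -> bounded_holo g dg y R M ->
  norm k < R / 4 ->
  bounded_holo (fun x => g (vadd x k) - g x)%C (fun x h => dg (vadd x k) h - dg x h)%C
    y (R / 4) (8 * M / R * norm k).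
Proof.
intros HR H Hk h Hh; split.
- apply Fder_minus; [apply Fder_shift|apply H; lra].
  rewrite <- vaddA; apply H.
  eapply Rle_lt_trans; [apply norm_vadd|lra].
- rewrite <- vaddA; apply (bounded_holo_lipschitz g dg); auto; [lra|].
  eapply Rle_lt_trans; [apply norm_vadd|lra].
Qed.

Lemma bounded_holo_deriv_lipschitz g dg y R M k h : 0 < R -> bounded_holo g dg y R M ->
  norm k < R / 4 ->
  Cmod (dg (vadd y k) h - dg y h)%C <= 128 * M / R ^ 2 * norm k * norm h.
Proof.
intros HR H Hk.
assert (B := bounded_holo_increment _ _ _ _ _ _ HR H Hk).
assert (L := bounded_holo_deriv _ _ y (R / 4) _ h ltac:(lra) B).
eapply Rle_trans; [exact L|]; right; field; lra.
Qed.

(** The mean value inequality along the segment for [g - dg y], whose derivative [dg x - dg y] is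
    small by the preceding Lipschitz bound. *)
Lemma bounded_holo_taylor g dg y R M h : 0 < R -> bounded_holo g dg y R M ->
  norm h < R / 4 ->
  Cmod (g (vadd y h) - g y - dg y h)%C <= 128 * M / R ^ 2 * norm h ^ 2.
Proof.
intros HR H Hh; assert (D0 := proj1 (bounded_holo_center _ _ _ _ _ HR H)).
assert (HM : 0 <= M).
{ assert (B := proj2 (bounded_holo_center _ _ _ _ _ HR H)).
  assert (A := Cmod_ge_0 (g y)); lra. }
assert (HL := proj1 D0).
replace (g (vadd y h) - g y - dg y h)%C with
  ((g (vadd y h) - dg y (vadd y h)) - (g y - dg y y))%C
  by (rewrite (Clinear_plus (dg y)) by exact HL; ring).
apply (segment_bound (fun x => g x - dg y x)%C (fun x k => dg x k - dg y k)%C).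
intros t Ht.
assert (Nt : norm (vscal (RtoC t) h) <= norm h).
{ rewrite norm_vscal, Cmod_R, Rabs_pos_eq by lra.
  assert (A := norm_ge_0 h); nra. }
split.
- apply Fder_minus; [apply H; lra|now apply Fder_linear].
- eapply Rle_trans; [apply (bounded_holo_deriv_lipschitz g dg y R M); auto; lra|].
  assert (A := norm_ge_0 h).
  assert (0 <= 128 * M / R ^ 2) by (apply Rdiv_le_0_compat; [lra|apply pow_lt; lra]).
  replace (128 * M / R ^ 2 * norm h ^ 2) with (128 * M / R ^ 2 * norm h * norm h) by ring.
  apply Rmult_le_compat_r; [exact A|].
  apply Rmult_le_compat_l; [assumption|exact Nt].
Qed.

(** The Taylor bound for the increment in [k], with radius [R / 4] and bound [8 * M / R * norm k];
    hence the constant [128 * 8 * 16]. The second difference is symmetric in [k] and [h], which the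
    next lemma exploits. *)
Lemma second_difference g dg y R M k h : 0 < R -> bounded_holo g dg y R M ->
  norm k < R / 16 -> norm h < R / 16 ->
  Cmod (g (vadd y (vadd k h)) - g (vadd y k) - g (vadd y h) + g y
        - (dg (vadd y k) h - dg y h))%C
  <= 16384 * M / R ^ 3 * (norm k * norm h ^ 2).
Proof.
intros HR H Hk Hh.
assert (B := bounded_holo_increment g dg y R M k HR H ltac:(lra)).
assert (L := bounded_holo_taylor _ _ y (R / 4) _ h ltac:(lra) B ltac:(lra)).
simpl in L; rewrite <- vaddA, (vaddC h k) in L.
match goal with |- Cmod ?a <= _ => match type of L with Cmod ?b <= _ =>
  replace a with b by ring end end.
eapply Rle_trans; [exact L|]; right; field; lra.
Qed.

Lemma deriv_increment_sym g dg y R M k h : 0 < R -> bounded_holo g dg y R M ->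
  norm k < R / 16 -> norm h < R / 16 ->
  Cmod ((dg (vadd y k) h - dg y h) - (dg (vadd y h) k - dg y k))%C
  <= 16384 * M / R ^ 3 * (norm k * norm h * (norm k + norm h)).
Proof.
intros HR H Hk Hh.
assert (A := second_difference _ _ _ _ _ k h HR H Hk Hh).
assert (B := second_difference _ _ _ _ _ h k HR H Hh Hk).
rewrite (vaddC h k) in B.
rewrite Cmod_minus_sym in A.
match type of A with Cmod ?a <= _ => match type of B with Cmod ?b <= _ =>
  assert (S := Cmod_triangle a b); match goal with |- Cmod ?c <= _ =>
  replace c with (a + b)%C by ring end end end.
lra.
Qed.

End Holomorphy.

(** Passage to the limit [t -> 0]. The condition [t * q < r], with [q] a norm, keeps a multiple of a
    vector in a ball and also makes sense for [q = 0]. *)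
Lemma le_of_small_error (a b c q r : R) : 0 <= c -> 0 <= q -> 0 < r ->
  (forall t, 0 < t -> t * q < r -> a <= b + c * t) -> a <= b.
Proof.
intros Hc Hq Hr H; apply Rle_plus_epsilon; intros eps He.
set (t := Rmin (r / (1 + q)) (eps / (1 + c))).
assert (H1 : 0 < r / (1 + q)) by (apply Rdiv_lt_0_compat; lra).
assert (H2 : 0 < eps / (1 + c)) by (apply Rdiv_lt_0_compat; lra).
assert (Ht : 0 < t) by now apply Rmin_glb_lt.
assert (M1 := Rmin_l (r / (1 + q)) (eps / (1 + c))).
assert (M2 := Rmin_r (r / (1 + q)) (eps / (1 + c))).
fold t in M1, M2.
assert (T1 : t * (1 + q) <= r).
{ apply <- Rle_div_r in M1; [|lra]; lra. }
assert (T2 : t * (1 + c) <= eps).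
{ apply <- Rle_div_r in M2; [|lra]; lra. }
specialize (H t Ht ltac:(nra)); nra.
Qed.

Lemma Cmod_le_0 (z : C) : Cmod z <= 0 -> z = 0%C.
Proof. intros H; apply Cmod_eq_0, Rle_antisym; [exact H|apply Cmod_ge_0]. Qed.

Lemma eq_of_small_error (z w : C) (c q r : R) : 0 <= c -> 0 <= q -> 0 < r ->
  (forall t, 0 < t -> t * q < r -> Cmod (z - w)%C <= c * t) -> z = w.
Proof.
intros Hc Hq Hr H.
assert (E : (z - w)%C = 0%C).
{ apply Cmod_le_0, (le_of_small_error _ _ c q r); auto.
  intros t T1 T2; specialize (H t T1 T2); lra. }
replace z with ((z - w) + w)%C by ring; rewrite E; ring.
Qed.

(** The limit with its rate: [F s - K s] never exceeds [F t + K t], so the supremum of the former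
    separates the two families. *)
Lemma R_limit_at_0 (P : R -> Prop) (F : R -> R) (K : R) : (exists t, P t) ->
  (forall s t, P s -> P t -> Rabs (F s - F t) <= K * (s + t)) ->
  exists b, forall t, P t -> Rabs (F t - b) <= K * t.
Proof.
intros [s0 Hs0] H.
assert (B : forall s t, P s -> P t -> F s - K * s <= F t + K * t).
{ intros s t Hs Ht; specialize (H s t Hs Ht).
  assert (A := Rle_abs (F s - F t)); lra. }
destruct (completeness (fun x => exists t, P t /\ x = F t - K * t)) as [b [B1 B2]].
- exists (F s0 + K * s0); intros x [t [Ht ->]]; now apply B.
- now exists (F s0 - K * s0), s0.
- exists b; intros t Ht; apply Rabs_le; split.
  + assert (b <= F t + K * t); [|lra].
    apply B2; intros x [s [Hs ->]]; now apply B.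
  + assert (F t - K * t <= b); [|lra].
    apply B1; now exists t.
Qed.

Lemma C_limit_at_0 (P : R -> Prop) (F : R -> C) (K : R) : (exists t, P t) ->
  (forall s t, P s -> P t -> Cmod (F s - F t)%C <= K * (s + t)) ->
  exists b, forall t, P t -> Cmod (F t - b)%C <= 2 * K * t.
Proof.
intros E H.
destruct (R_limit_at_0 P (fun t => fst (F t)) K E) as [b1 H1].
{ intros s t Hs Ht; eapply Rle_trans; [|exact (H s t Hs Ht)].
  exact (re_le_Cmod (F s - F t)%C). }
destruct (R_limit_at_0 P (fun t => snd (F t)) K E) as [b2 H2].
{ intros s t Hs Ht; eapply Rle_trans; [|exact (H s t Hs Ht)].
  exact (im_le_Cmod (F s - F t)%C). }
exists (b1, b2); intros t Ht; eapply Rle_trans; [apply Cmod_le_abs|].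
specialize (H1 t Ht); specialize (H2 t Ht); simpl in *; unfold Rminus in *; lra.
Qed.

(** * Existence and continuity of the second derivative *)

Section Hessian.
Context {X : NormedModule C_AbsRing}.
Implicit Types (x y h k : X) (g : X -> C).

(** The last clause is differentiability of [dg] in operator norm, with explicit radius and
    constant, hence uniform in [h]. *)
Definition is_hessian (dg : X -> X -> C) y (r K : R) (B : X -> X -> C) : Prop :=
  (forall k h, B k h = B h k) /\ (forall k, Clinear (B k)) /\
  (exists M, forall k h, Cmod (B k h) <= M * norm k * norm h) /\
  forall k h, norm k < r ->
    Cmod (dg (vadd y k) h - dg y h - B k h)%C <= K * norm k ^ 2 * norm h.

Lemma norm_vscal_R (t : R) h : 0 < t -> norm (vscal (RtoC t) h) = t * norm h.
Proof. intros Ht; rewrite norm_vscal, Cmod_R, Rabs_pos_eq; lra. Qed.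

Lemma RtoC_neq_0 (t : R) : t <> 0 -> RtoC t <> 0%C.
Proof. intros N E; apply N; now apply (f_equal fst) in E. Qed.

Theorem hessian_exists g dg y R M : 0 < R -> bounded_holo g dg y R M ->
  exists B, is_hessian dg y (R / 16) (32768 * M / R ^ 3) B.
Proof.
intros HR H.
assert (HM : 0 <= M).
{ assert (B := proj2 (bounded_holo_center _ _ _ _ _ HR H)).
  assert (A := Cmod_ge_0 (g y)); lra. }
remember (16384 * M / R ^ 3) as K eqn:EK.
assert (HK : 0 <= K) by (rewrite EK; apply Rdiv_le_0_compat; [lra|apply pow_lt; lra]).
set (r := R / 16); assert (Hr : 0 < r) by (unfold r; lra).
set (e := fun k h => (dg (vadd y k) h - dg y h)%C).
set (quot := fun k h t => (e (vscal (RtoC t) k) h / RtoC t)%C).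
assert (L0 : Clinear (dg y)) by exact (proj1 (proj1 (bounded_holo_center _ _ _ _ _ HR H))).
assert (L1 : forall k, norm k < r -> Clinear (dg (vadd y k))).
{ intros k Hk; unfold r in Hk; apply (fun A => proj1 (proj1 (H k A))); lra. }
assert (eD : forall k h h', norm k < r -> e k (vadd h h') = (e k h + e k h')%C).
{ intros k h h' Hk; unfold e.
  rewrite (Clinear_plus (dg y)), (Clinear_plus (dg (vadd y k))); auto; ring. }
assert (eZ : forall k c h, norm k < r -> e k (vscal c h) = (c * e k h)%C).
{ intros k c h Hk; unfold e.
  rewrite (Clinear_scal (dg y)), (Clinear_scal (dg (vadd y k))); auto; ring. }
(* [e] is linear in its second argument, so the symmetry estimate for [s k] and [t h], divided by
   [s t], compares quotients with exchanged arguments and independent parameters. *)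
assert (S2 : forall k h s t, 0 < s -> 0 < t -> s * norm k < r -> t * norm h < r ->
  Cmod (quot k h s - quot h k t)%C <= K * (norm k * norm h) * (s * norm k + t * norm h)).
{ intros k h s t Hs Ht Hk Hh.
  rewrite <- (norm_vscal_R s) in Hk by exact Hs.
  rewrite <- (norm_vscal_R t) in Hh by exact Ht.
  assert (D := deriv_increment_sym _ _ _ _ _ _ _ HR H Hk Hh).
  fold (e (vscal (RtoC s) k) (vscal (RtoC t) h)) in D.
  fold (e (vscal (RtoC t) h) (vscal (RtoC s) k)) in D; rewrite <- EK in D.
  rewrite eZ, eZ, !norm_vscal_R in D by assumption.
  assert (Ns := RtoC_neq_0 s ltac:(lra)); assert (Nt := RtoC_neq_0 t ltac:(lra)).
  unfold quot.
  replace (e (vscal (RtoC s) k) h / RtoC s - e (vscal (RtoC t) h) k / RtoC t)%C with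
    ((RtoC t * e (vscal (RtoC s) k) h - RtoC s * e (vscal (RtoC t) h) k) / (RtoC s * RtoC t))%C
    by (field; auto).
  rewrite Cmod_div by now apply Cmult_neq_0.
  rewrite Cmod_mult, !Cmod_R, !Rabs_pos_eq by lra.
  assert (Pst : 0 < s * t) by nra.
  apply Rmult_le_reg_r with (s * t); [exact Pst|].
  unfold Rdiv; rewrite Rmult_assoc, Rinv_l, Rmult_1_r by lra.
  eapply Rle_trans; [exact D|]; right; ring. }
(* Two quotients with the same arguments are compared through [quot h k u]; as [u] tends to 0, a
   bound linear in [s + t] remains. *)
assert (S3 : forall k h, exists b, forall t, 0 < t /\ t * norm k < r ->
  Cmod (quot k h t - b)%C <= 2 * (K * norm k ^ 2 * norm h) * t).
{ intros k h; assert (A := norm_ge_0 k); assert (A' := norm_ge_0 h).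
  apply C_limit_at_0.
  - exists (r / (1 + norm k)).
    assert (P : 0 < r / (1 + norm k)) by (apply Rdiv_lt_0_compat; lra).
    split; [exact P|].
    apply Rlt_le_trans with (r / (1 + norm k) * (1 + norm k)); [nra|].
    right; field; lra.
  - intros s t [Hs Hsk] [Ht Htk].
    apply (le_of_small_error _ _ (2 * K * (norm k * norm h) * norm h) (norm h) r); auto.
    { repeat apply Rmult_le_pos; assumption || lra. }
    intros u Hu Huh.
    assert (D1 := S2 k h s u Hs Hu Hsk Huh).
    assert (D2 := S2 k h t u Ht Hu Htk Huh).
    rewrite Cmod_minus_sym in D2.
    replace (quot k h s - quot k h t)%C with
      ((quot k h s - quot h k u) + (quot h k u - quot k h t))%C by ring.
    eapply Rle_trans; [apply Cmod_triangle|].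
    eapply Rle_trans; [apply Rplus_le_compat; [exact D1|exact D2]|]; right; ring. }
set (B := fun k h => proj1_sig (constructive_indefinite_description _ (S3 k h))).
assert (HB : forall k h t, 0 < t -> t * norm k < r ->
  Cmod (quot k h t - B k h)%C <= 2 * (K * norm k ^ 2 * norm h) * t).
{ intros k h t H1 H2.
  exact (proj2_sig (constructive_indefinite_description _ (S3 k h)) t (conj H1 H2)). }
clearbody B.
assert (Bsym : forall k h, B k h = B h k).
{ intros k h; assert (A := norm_ge_0 k); assert (A' := norm_ge_0 h).
  assert (P1 : 0 <= K * norm k ^ 2 * norm h)
    by (repeat apply Rmult_le_pos; try lra; apply pow_le; lra).
  assert (P2 : 0 <= K * norm h ^ 2 * norm k)
    by (repeat apply Rmult_le_pos; try lra; apply pow_le; lra).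
  apply (eq_of_small_error _ _ (3 * (K * norm k ^ 2 * norm h) + 3 * (K * norm h ^ 2 * norm k))
    (norm k + norm h) r); auto; try lra.
  intros t Ht Hq.
  assert (Q1 := Rmult_le_pos t (norm k) (Rlt_le _ _ Ht) A).
  assert (Q2 := Rmult_le_pos t (norm h) (Rlt_le _ _ Ht) A').
  rewrite Rmult_plus_distr_l in Hq.
  assert (D1 := HB k h t Ht ltac:(lra)); assert (D2 := HB h k t Ht ltac:(lra)).
  assert (D3 := S2 k h t t Ht Ht ltac:(lra) ltac:(lra)).
  rewrite Cmod_minus_sym in D1.
  replace (B k h - B h k)%C with ((B k h - quot k h t) + (quot k h t - quot h k t)
    + (quot h k t - B h k))%C by ring.
  eapply Rle_trans; [apply Cmod_triangle|].
  eapply Rle_trans; [apply Rplus_le_compat_r, Cmod_triangle|].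
  eapply Rle_trans; [apply Rplus_le_compat; [apply Rplus_le_compat; [exact D1|exact D3]|exact D2]|].
  right; ring. }
assert (Nt : forall t k, 0 < t -> t * norm k < r -> norm (vscal (RtoC t) k) < r).
{ intros t k Ht Hk; now rewrite norm_vscal_R. }
assert (Bbd : forall k h, Cmod (B k h) <= 128 * M / R ^ 2 * norm k * norm h).
{ intros k h; assert (A := norm_ge_0 k); assert (A' := norm_ge_0 h).
  assert (P1 : 0 <= K * norm k ^ 2 * norm h)
    by (repeat apply Rmult_le_pos; try lra; apply pow_le; lra).
  apply (le_of_small_error _ _ (2 * (K * norm k ^ 2 * norm h)) (norm k) r); auto; try lra.
  intros t Ht Hq; assert (D1 := HB k h t Ht Hq); rewrite Cmod_minus_sym in D1.
  replace (B k h) with ((B k h - quot k h t) + quot k h t)%C by ring.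
  eapply Rle_trans; [apply Cmod_triangle|].
  assert (D2 : Cmod (quot k h t) <= 128 * M / R ^ 2 * norm k * norm h).
  { unfold quot; rewrite Cmod_div, Cmod_R, Rabs_pos_eq by (try apply RtoC_neq_0; lra).
    apply Rmult_le_reg_r with t; [exact Ht|].
    unfold Rdiv at 1; rewrite Rmult_assoc, Rinv_l, Rmult_1_r by lra.
    assert (D := Nt t k Ht Hq); unfold r in D.
    eapply Rle_trans; [apply (bounded_holo_deriv_lipschitz g dg y R M); auto; lra|].
    rewrite norm_vscal_R by exact Ht; right; ring. }
  lra. }
exists B; split; [exact Bsym|]; split; [|split].
- intros k; assert (A := norm_ge_0 k).
  apply (Clinear_intro _ (128 * M / R ^ 2 * norm k)); [| |apply Bbd].
  + intros h h'; assert (A1 := norm_ge_0 h); assert (A2 := norm_ge_0 h').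
    assert (A3 := norm_ge_0 (vadd h h')).
    assert (P0 : 0 <= K * norm k ^ 2)
      by (apply Rmult_le_pos; try lra; apply pow_le; lra).
    apply (eq_of_small_error _ _
      (2 * (K * norm k ^ 2) * (norm (vadd h h') + norm h + norm h')) (norm k) r); auto.
    { apply Rmult_le_pos; lra. }
    intros t Ht Hq.
    assert (D1 := HB k (vadd h h') t Ht Hq); assert (D2 := HB k h t Ht Hq).
    assert (D3 := HB k h' t Ht Hq); rewrite Cmod_minus_sym in D1.
    assert (E : quot k (vadd h h') t = (quot k h t + quot k h' t)%C).
    { unfold quot; rewrite eD by auto; field; apply RtoC_neq_0; lra. }
    rewrite E in D1.
    replace (B k (vadd h h') - (B k h + B k h'))%C with
      ((B k (vadd h h') - (quot k h t + quot k h' t)) + (quot k h t - B k h)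
       + (quot k h' t - B k h'))%C by ring.
    eapply Rle_trans; [apply Cmod_triangle|].
    eapply Rle_trans; [apply Rplus_le_compat_r, Cmod_triangle|]; lra.
  + intros c h; assert (A1 := norm_ge_0 h); assert (A2 := norm_ge_0 (vscal c h)).
    assert (A3 := Cmod_ge_0 c).
    assert (P0 : 0 <= K * norm k ^ 2)
      by (apply Rmult_le_pos; try lra; apply pow_le; lra).
    apply (eq_of_small_error _ _
      (2 * (K * norm k ^ 2) * (norm (vscal c h) + Cmod c * norm h)) (norm k) r); auto.
    { apply Rmult_le_pos; [lra|]; nra. }
    intros t Ht Hq.
    assert (D1 := HB k (vscal c h) t Ht Hq); assert (D2 := HB k h t Ht Hq).
    rewrite Cmod_minus_sym in D1.
    assert (E : quot k (vscal c h) t = (c * quot k h t)%C).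
    { unfold quot; rewrite eZ by auto; field; apply RtoC_neq_0; lra. }
    rewrite E in D1.
    replace (B k (vscal c h) - c * B k h)%C with
      ((B k (vscal c h) - c * quot k h t) + c * (quot k h t - B k h))%C by ring.
    eapply Rle_trans; [apply Cmod_triangle|]; rewrite Cmod_mult.
    apply Rmult_le_compat_l with (r := Cmod c) in D2; [|exact A3]; lra.
- eexists; exact Bbd.
- intros k h Hk.
  (* At [t = 1] the quotient is the increment of [dg] itself, so the rate of convergence is the
     remainder estimate. *)
  assert (D := HB k h 1 Rlt_0_1 ltac:(lra)); unfold quot in D.
  rewrite vscal1 in D; fold (e k h).
  replace (e k h / RtoC 1 - B k h)%C with (e k h - B k h)%C in D by field.
  eapply Rle_trans; [exact D|]; right; rewrite EK; field; lra.
Qed.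

Lemma hessian_linear_l dg y r K B h : is_hessian dg y r K B -> Clinear (fun k => B k h).
Proof.
intros [S [L [[M HM] _]]]; apply (Clinear_intro _ (M * norm h)).
- intros x z; rewrite !(S _ h); now apply Clinear_plus.
- intros c z; rewrite !(S _ h); now apply Clinear_scal.
- intros z; rewrite S; eapply Rle_trans; [apply HM|]; right; ring.
Qed.

Lemma hessian_Fder dg y r K B h : 0 < r -> is_hessian dg y r K B ->
  Fder (fun x => dg x h) y (fun k => B k h).
Proof.
intros Hr H; split; [now apply (hessian_linear_l dg y r K)|].
destruct H as [_ [_ [_ H]]]; intros eps He.
assert (A := norm_ge_0 h); assert (AK := Rabs_pos K).
assert (P : 0 < eps / (1 + Rabs K * norm h)) by (apply Rdiv_lt_0_compat; nra).
exists (Rmin r (eps / (1 + Rabs K * norm h))); split; [now apply Rmin_glb_lt|].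
intros k Hk.
destruct (Rmin_Rgt_l _ _ _ Hk) as [K1 K2].
assert (Ak := norm_ge_0 k).
eapply Rle_trans; [exact (H k h K1)|].
assert (B1 : norm k * (1 + Rabs K * norm h) <= eps).
{ left; apply <- Rlt_div_r in K2; [|nra]; nra. }
assert (B2 := Rle_abs K).
replace (K * norm k ^ 2 * norm h) with (K * (norm k * norm h) * norm k) by ring.
apply Rmult_le_compat_r; [exact Ak|].
assert (0 <= norm k * norm h) by nra.
apply Rle_trans with (Rabs K * (norm k * norm h)); [now apply Rmult_le_compat_r|].
nra.
Qed.

(** [dg] at [y + a + w] is expanded from [y] and from [y + a], with [w] the multiple of [k] of norm
    [s]. The three remainders give [K'], [4 * K] and [K] times [s ^ 2]; homogeneity in [k] removes
    one factor [s]. *)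
Lemma hessian_close dg y a r r' K K' B B' s : 0 <= K -> 0 < s -> norm a <= s ->
  2 * s < r -> s < r' ->
  is_hessian dg y r K B -> is_hessian dg (vadd y a) r' K' B' ->
  forall k h, Cmod (B' k h - B k h)%C <= (K' + 5 * K) * s * norm k * norm h.
Proof.
intros HK Hs Ha Hr Hr' HB HB' k h.
assert (LB := hessian_linear_l _ _ _ _ _ h HB).
assert (LB' := hessian_linear_l _ _ _ _ _ h HB').
destruct HB as [_ [_ [_ H]]]; destruct HB' as [_ [_ [_ H']]].
assert (A := norm_ge_0 h).
destruct (Req_dec (norm k) 0) as [E|N].
{ rewrite (norm_eq_zero k E), (Clinear_zero _ LB), (Clinear_zero _ LB'), norm_zero.
  replace (0 - 0)%C with (RtoC 0) by ring; rewrite Cmod_0; right; ring. }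
assert (Ak : 0 < norm k) by (assert (Z := norm_ge_0 k); lra).
set (t := s / norm k); assert (Ht : 0 < t) by (apply Rdiv_lt_0_compat; lra).
assert (Et : norm (vscal (RtoC t) k) = s)
  by (rewrite norm_vscal_R by exact Ht; unfold t; field; lra).
set (w := vscal (RtoC t) k) in *.
assert (Nw : norm (vadd a w) <= 2 * s)
  by (eapply Rle_trans; [apply norm_vadd|lra]).
assert (D1 := H (vadd a w) h ltac:(lra)).
assert (D2 := H a h ltac:(lra)).
assert (D3 := H' w h ltac:(lra)).
rewrite <- vaddA in D3; rewrite (Clinear_plus _ _ _ LB) in D1.
rewrite Et in D3.
assert (B1 : Cmod (B' w h - B w h)%C <= (K' + 5 * K) * s ^ 2 * norm h).
{ replace (B' w h - B w h)%C with
    (- (dg (vadd y (vadd a w)) h - dg (vadd y a) h - B' w h)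
     + (dg (vadd y (vadd a w)) h - dg y h - (B a h + B w h))
     + - (dg (vadd y a) h - dg y h - B a h))%C by ring.
  eapply Rle_trans; [apply Cmod_triangle|].
  eapply Rle_trans; [apply Rplus_le_compat_r, Cmod_triangle|].
  rewrite !Cmod_opp.
  assert (Na := norm_ge_0 a); assert (Naw := norm_ge_0 (vadd a w)).
  assert (Q1 : norm (vadd a w) ^ 2 <= 4 * s ^ 2) by nra.
  assert (Q2 : norm a ^ 2 <= s ^ 2) by nra.
  assert (Q3 : K * norm (vadd a w) ^ 2 * norm h <= K * (4 * s ^ 2) * norm h)
    by (apply Rmult_le_compat_r; [exact A|now apply Rmult_le_compat_l]).
  assert (Q4 : K * norm a ^ 2 * norm h <= K * s ^ 2 * norm h)
    by (apply Rmult_le_compat_r; [exact A|now apply Rmult_le_compat_l]).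
  lra. }
unfold w in B1.
rewrite (Clinear_scal _ _ _ LB), (Clinear_scal _ _ _ LB') in B1.
replace (RtoC t * B' k h - RtoC t * B k h)%C with (RtoC t * (B' k h - B k h))%C in B1 by ring.
rewrite Cmod_mult, Cmod_R, Rabs_pos_eq in B1 by lra.
apply Rmult_le_reg_l with t; [exact Ht|].
eapply Rle_trans; [exact B1|]; right; unfold t; field; lra.
Qed.

End Hessian.

(** * Frechet derivatives of x |-> g(x) x *)

Section VectorIdentities.
Context {X : NormedModule C_AbsRing}.

(** Reflection: an identity between linear combinations of three vectors becomes three equalities of
    complex coefficients, which [ring] decides. *)
Inductive vexpr : Type :=
  | VZero | VFst | VSnd | VTrd | VAdd (a b : vexpr) | VScal (c : C) (a : vexpr).

Fixpoint veval (u v w : X) (e : vexpr) : X :=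
  match e with
  | VZero => zero
  | VFst => u | VSnd => v | VTrd => w
  | VAdd a b => vadd (veval u v w a) (veval u v w b)
  | VScal c a => vscal c (veval u v w a)
  end.

Fixpoint vcoef (i : nat) (e : vexpr) : C :=
  match e with
  | VZero => 0%C
  | VFst => match i with 0%nat => 1%C | _ => 0%C end
  | VSnd => match i with 1%nat => 1%C | _ => 0%C end
  | VTrd => match i with 2%nat => 1%C | _ => 0%C end
  | VAdd a b => (vcoef i a + vcoef i b)%C
  | VScal c a => (c * vcoef i a)%C
  end.

Lemma vaddACA (a b c d : X) :
  vadd (vadd a b) (vadd c d) = vadd (vadd a c) (vadd b d).
Proof. rewrite <- !vaddA; f_equal; rewrite !vaddA; f_equal; apply vaddC. Qed.

Lemma veval_coef (u v w : X) (e : vexpr) : veval u v w e =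
  vadd (vscal (vcoef 0 e) u) (vadd (vscal (vcoef 1 e) v) (vscal (vcoef 2 e) w)).
Proof.
induction e as [| | | |a Ha b Hb|c a Ha]; simpl.
- rewrite !vscal0, !vadd0; reflexivity.
- now rewrite !vscal0, vscal1, !vadd0.
- now rewrite !vscal0, vscal1, vadd0, vaddC, vadd0.
- now rewrite !vscal0, vscal1, (vaddC zero w), vadd0, vaddC, vadd0.
- now rewrite Ha, Hb, !vscalDl, vaddACA, (vaddACA (vscal (vcoef 1 a) v)).
- now rewrite Ha, !vscalDr, !vscalA.
Qed.

Lemma veval_eq (u v w : X) (e f : vexpr) :
  vcoef 0 e = vcoef 0 f -> vcoef 1 e = vcoef 1 f -> vcoef 2 e = vcoef 2 f ->
  veval u v w e = veval u v w f.
Proof. intros H0 H1 H2; rewrite !veval_coef; congruence. Qed.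

Lemma minus_vadd (x y : X) : minus x y = vadd x (vscal (Copp (RtoC 1)) y).
Proof. unfold minus; change (plus x (opp y)) with (vadd x (opp y)); f_equal.
symmetry; exact (scal_opp_one y). Qed.

End VectorIdentities.

Ltac vreify u v w t :=
  match t with
  | u => constr:(VFst)
  | v => constr:(VSnd)
  | w => constr:(VTrd)
  | zero => constr:(VZero)
  | vadd ?a ?b => let a' := vreify u v w a in let b' := vreify u v w b in
                  constr:(VAdd a' b')
  | vscal ?c ?a => let a' := vreify u v w a in constr:(VScal c a')
  end.

(** A repeated argument only fills a slot: reification takes the first match, so the later
    coefficients are 0 on both sides. *)
Ltac vring u v w :=
  match goal with |- ?l = ?r =>
    let e := vreify u v w l in let f := vreify u v w r in
    change (veval u v w e = veval u v w f);
    apply veval_eq; simpl; ring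
  end.

Section FrechetOfProduct.
Context {X : NormedModule C_AbsRing}.
Implicit Types (x y h k : X) (g : X -> C).

Lemma minus_vadd_l x h : minus (vadd x h) x = h.
Proof. rewrite minus_vadd; vring x h h. Qed.

Lemma vadd_minus x y : vadd x (minus y x) = y.
Proof. rewrite minus_vadd; vring x y y. Qed.

Lemma locally_vadd (P : X -> Prop) x : locally x P <->
  exists d, 0 < d /\ forall h, norm h < d -> P (vadd x h).
Proof.
split.
- intros H; apply (locally_norm_le_locally x) in H; destruct H as [d H].
  exists d; split; [apply cond_pos|]; intros h Hh; apply H.
  unfold ball_norm; now rewrite minus_vadd_l.
- intros [d [Hd H]]; apply (locally_le_locally_norm x).
  exists (mkposreal d Hd); intros y Hy; rewrite <- (vadd_minus x y); now apply H.
Qed.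

Lemma Fder_of_ex_filterdiff g x :
  ex_filterdiff (V := C_NormedModule) g (locally x) -> exists L, Fder g x L.
Proof.
intros [L [HL H]]; exists L; split; [exact HL|]; intros eps He.
specialize (H x (fun P HP => HP) (mkposreal eps He)).
apply locally_vadd in H; destruct H as [d [Hd K]].
exists d; split; [exact Hd|]; intros h Hh; specialize (K h Hh).
simpl in K; rewrite minus_vadd_l in K; exact K.
Qed.

Lemma ex_filterdiff_of_Fder g x L : Fder g x L ->
  ex_filterdiff (V := C_NormedModule) g (locally x).
Proof.
intros [HL H]; exists L; split; [exact HL|]; intros x' Hx' eps.
rewrite <- (is_filter_lim_locally_unique x x' Hx').
apply locally_vadd; destruct (H eps (cond_pos eps)) as [d [Hd K]].
exists d; split; [exact Hd|]; intros h Hh; rewrite minus_vadd_l; exact (K h Hh).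
Qed.

(** Differentiability at [x] alone bounds [g] near [x], so the quantitative estimates apply without
    any continuity of [dg]. *)
Lemma bounded_holo_local g dg x : norm x < 1 ->
  (forall x, norm x < 1 -> Fder g x (dg x)) ->
  exists R M, 0 < R /\ 0 <= M /\ bounded_holo g dg x R M.
Proof.
intros Hx H; destruct (Fder_lipschitz_at _ _ _ (H x Hx)) as [K [d [HK [Hd L]]]].
set (R := Rmin d (1 - norm x)).
assert (HR : 0 < R) by (apply Rmin_glb_lt; lra).
assert (A := Cmod_ge_0 (g x)).
exists R, (Cmod (g x) + K * d); split; [exact HR|]; split; [nra|]; intros h Hh; split.
- apply H; eapply Rle_lt_trans; [apply norm_vadd|].
  assert (B := Rlt_le_trans _ _ _ Hh (Rmin_r _ _)); lra.
- assert (B := Rlt_le_trans _ _ _ Hh (Rmin_l _ _)); specialize (L h B).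
  replace (g (vadd x h)) with (g x + (g (vadd x h) - g x))%C by ring.
  eapply Rle_trans; [apply Cmod_triangle|]; nra.
Qed.

(** The last two clauses are the differentiability of [dg] and the continuity of [B x], both in
    operator norm. The continuity stands in for a third derivative of [g] when [D^3 F] is computed
    at the origin. *)
Definition second_order_data g (dg : X -> X -> C) (B : X -> X -> X -> C) x : Prop :=
  Fder g x (dg x) /\
  (forall k h, B x k h = B x h k) /\ (forall k, Clinear (B x k)) /\
  (exists M, 0 <= M /\ forall k h, Cmod (B x k h) <= M * norm k * norm h) /\
  (forall eps, 0 < eps -> exists d, 0 < d /\ forall k, norm k < d -> forall h,
    Cmod (dg (vadd x k) h - dg x h - B x k h)%C <= eps * norm k * norm h) /\
  (forall eps, 0 < eps -> exists d, 0 < d /\ forall l, norm l < d -> forall k h,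
    Cmod (B (vadd x l) k h - B x k h)%C <= eps * norm k * norm h).

Lemma second_order_data_exists g dg :
  (forall x, norm x < 1 -> Fder g x (dg x)) ->
  exists B, forall x, norm x < 1 -> second_order_data g dg B x.
Proof.
intros H.
assert (E : forall x, exists B, norm x < 1 ->
  exists r K, 0 < r /\ 0 <= K /\ is_hessian dg x r K B).
{ intros x; destruct (Rlt_dec (norm x) 1) as [Hx|N]; [|exists (fun _ _ => 0%C); lra].
  destruct (bounded_holo_local g dg x Hx H) as [R [M [HR [HM HB]]]].
  destruct (hessian_exists _ _ _ _ _ HR HB) as [B HB']; exists B; intros _.
  exists (R / 16), (32768 * M / R ^ 3); split; [lra|]; split; [|exact HB'].
  apply Rdiv_le_0_compat; [lra|apply pow_lt; lra]. }
set (B := fun x => proj1_sig (constructive_indefinite_description _ (E x))).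
assert (HB : forall x, norm x < 1 -> exists r K, 0 < r /\ 0 <= K /\ is_hessian dg x r K (B x)).
{ intros x; exact (proj2_sig (constructive_indefinite_description _ (E x))). }
clearbody B; exists B; intros x Hx.
destruct (HB x Hx) as [r [K [Hr [HK HH]]]].
destruct (bounded_holo_local g dg x Hx H) as [R [M [HR [HM Hbd]]]].
split; [now apply H|].
destruct HH as [S [L [[N HN] D]]]; split; [exact S|]; split; [exact L|]; split; [|split].
- exists (Rabs N); split; [apply Rabs_pos|]; intros k h; eapply Rle_trans; [apply HN|].
  assert (A := norm_ge_0 k); assert (A' := norm_ge_0 h); assert (A2 := Rle_abs N).
  apply Rmult_le_compat_r; [exact A'|]; now apply Rmult_le_compat_r.
- intros eps He; exists (Rmin r (eps / (1 + K))).
  assert (P : 0 < eps / (1 + K)) by (apply Rdiv_lt_0_compat; lra).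
  split; [now apply Rmin_glb_lt|]; intros k Hk h.
  eapply Rle_trans; [apply D; eapply Rlt_le_trans; [exact Hk|apply Rmin_l]|].
  assert (K2 := Rlt_le_trans _ _ _ Hk (Rmin_r _ _)).
  assert (A := norm_ge_0 k); assert (A' := norm_ge_0 h).
  apply <- Rlt_div_r in K2; [|lra].
  apply Rmult_le_compat_r; [exact A'|].
  replace (K * norm k ^ 2) with (K * norm k * norm k) by ring.
  apply Rmult_le_compat_r; [exact A|]; nra.
- intros eps He.
  remember (32768 * M / (R / 2) ^ 3) as K' eqn:EK.
  assert (HK' : 0 <= K') by (rewrite EK; apply Rdiv_le_0_compat; [lra|apply pow_lt; lra]).
  set (c := K' + 5 * K).
  set (s := Rmin (Rmin (r / 4) (R / 64)) (Rmin (eps / (1 + c)) ((1 - norm x) / 2))).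
  assert (Pe : 0 < eps / (1 + c)) by (apply Rdiv_lt_0_compat; unfold c; lra).
  assert (Hs : 0 < s) by (unfold s; repeat apply Rmin_glb_lt; lra).
  assert (S1 : s <= r / 4) by (eapply Rle_trans; [apply Rmin_l|apply Rmin_l]).
  assert (S2 : s <= R / 64) by (eapply Rle_trans; [apply Rmin_l|apply Rmin_r]).
  assert (S3 : s <= eps / (1 + c)) by (eapply Rle_trans; [apply Rmin_r|apply Rmin_l]).
  assert (S4 : s <= (1 - norm x) / 2) by (eapply Rle_trans; [apply Rmin_r|apply Rmin_r]).
  exists s; split; [exact Hs|]; intros l Hl k h.
  assert (Hxl : norm (vadd x l) < 1)
    by (eapply Rle_lt_trans; [apply norm_vadd|lra]).
  assert (Hsub : bounded_holo g dg (vadd x l) (R / 2) M)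
    by (apply (bounded_holo_sub _ _ _ _ R); [lra|exact Hbd]).
  destruct (hessian_exists g dg _ (R / 2) M ltac:(lra) Hsub) as [B' HB'].
  destruct (HB _ Hxl) as [r2 [K2 [Hr2 [_ HB2]]]].
  (* The constant [K2] that comes with the chosen [B (vadd x l)] may depend on [l]. By uniqueness
     this form equals [B'], obtained from the ball of radius [R / 2], whose constant [K'] does
     not. *)
  assert (EB : B (vadd x l) k h = B' k h).
  { exact (Fder_unique _ _ _ _ k (hessian_Fder _ _ _ _ _ h Hr2 HB2)
      (hessian_Fder _ _ (R / 2 / 16) _ _ h ltac:(lra) HB')). }
  rewrite EB.
  assert (HHx : is_hessian dg x r K (B x))
    by (split; [exact S|split; [exact L|split; [now exists N|exact D]]]).
  rewrite <- EK in HB'.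
  assert (T := hessian_close dg x l r (R / 2 / 16) K K' (B x) B' s HK Hs
    (Rlt_le _ _ Hl) ltac:(lra) ltac:(lra) HHx HB' k h).
  eapply Rle_trans; [exact T|].
  apply Rmult_le_compat_r; [apply norm_ge_0|].
  apply Rmult_le_compat_r; [apply norm_ge_0|].
  apply <- Rle_div_r in S3; [|unfold c; lra].
  change (c * s <= eps); nra.
Qed.
End FrechetOfProduct.

(** * Uniqueness of Frechet derivatives and the first three derivatives of [g(x) x] *)

Section FrechetCalculus.
Context {X : NormedModule C_AbsRing}.
Implicit Types (x y h k l : X) (v : list X) (L : list X -> X).

Lemma prod_norm_pos v : 0 <= Defs.prod_norm v.
Proof.
induction v as [|x v IH]; simpl; [lra|].
apply Rmult_le_pos; [apply norm_ge_0|exact IH].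
Qed.

Lemma prod_norm_app v w : Defs.prod_norm (v ++ w) = Defs.prod_norm v * Defs.prod_norm w.
Proof. induction v as [|x v IH]; simpl; [ring|rewrite IH; ring]. Qed.

Lemma bounded_multilinear_intro n L M : 0 <= M ->
  (forall u w, (length u + S (length w))%nat = n -> forall x y,
     L (u ++ vadd x y :: w) = vadd (L (u ++ x :: w)) (L (u ++ y :: w))) ->
  (forall u w, (length u + S (length w))%nat = n -> forall c x,
     L (u ++ vscal c x :: w) = vscal c (L (u ++ x :: w))) ->
  (forall v, length v = n -> norm (L v) <= M * Defs.prod_norm v) ->
  is_bounded_multilinear n L.
Proof.
intros HM HD HZ HB; split; [|now exists M].
intros u w E; split; [exact (HD u w E)|exact (HZ u w E)|].
assert (A := prod_norm_pos u); assert (A' := prod_norm_pos w).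
assert (P : 0 <= M * Defs.prod_norm u * Defs.prod_norm w) by (repeat apply Rmult_le_pos; lra).
exists (1 + M * Defs.prod_norm u * Defs.prod_norm w); split; [lra|]; intros x.
eapply Rle_trans; [apply HB; rewrite length_app; exact E|].
rewrite prod_norm_app; simpl; assert (Ax := norm_ge_0 x).
replace (M * (Defs.prod_norm u * (norm x * Defs.prod_norm w)))
  with (M * Defs.prod_norm u * Defs.prod_norm w * norm x) by ring; nra.
Qed.

Lemma norm_opp_C x : norm (vscal (Copp (RtoC 1)) x) = norm x.
Proof. now rewrite norm_vscal, Cmod_opp, Cmod_1, Rmult_1_l. Qed.

Lemma frechet_derivative_ext n (G G' : X -> list X -> X) x L :
  (exists d, 0 < d /\ forall h, norm h < d -> forall v, length v = n ->
     G (vadd x h) v = G' (vadd x h) v) ->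
  is_frechet_derivative n G x L -> is_frechet_derivative n G' x L.
Proof.
intros [d [Hd E]] [HL H]; split; [exact HL|]; intros eps.
specialize (H eps); apply locally_vadd in H; destruct H as [d' [Hd' H]].
apply locally_vadd; exists (Rmin d d'); split; [now apply Rmin_glb_lt|].
intros h Hh v Hv.
assert (E0 : G x v = G' x v).
{ rewrite <- (vadd0 x); apply E; [now rewrite norm_zero|exact Hv]. }
rewrite <- E0, <- E; [|eapply Rlt_le_trans; [exact Hh|apply Rmin_l]|exact Hv].
apply H; [eapply Rlt_le_trans; [exact Hh|apply Rmin_r]|exact Hv].
Qed.

(** [frechet_D] takes some derivative by [epsilon]; uniqueness on lists of the right length makes
    its values computable. The two linear maps are compared at a small multiple [t h], and the
    factor [t] cancels. *)
Lemma frechet_derivative_unique n (G : X -> list X -> X) x L L' h v : length v = n ->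
  is_frechet_derivative n G x L -> is_frechet_derivative n G x L' ->
  L (h :: v) = L' (h :: v).
Proof.
intros Hv [[HL _] H] [[HL' _] H'].
specialize (HL nil v ltac:(simpl; lia)); specialize (HL' nil v ltac:(simpl; lia)).
simpl in HL, HL'.
enough (E : norm (minus (L (h :: v)) (L' (h :: v))) <= 0).
{ assert (E' := Rle_antisym _ _ E (norm_ge_0 _)); apply norm_eq_zero in E'.
  rewrite <- (vadd0 (L' (h :: v))), <- E'; symmetry; apply vadd_minus. }
assert (A := norm_ge_0 h); assert (A' := prod_norm_pos v).
assert (P : 0 <= norm h * Defs.prod_norm v) by now apply Rmult_le_pos.
apply (le_of_small_error _ _ (2 * (norm h * Defs.prod_norm v)) 0 1); try lra.
intros eps He _; rewrite Rplus_0_l.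
destruct (proj1 (locally_vadd _ x) (H (mkposreal eps He))) as [d [Hd K]].
destruct (proj1 (locally_vadd _ x) (H' (mkposreal eps He))) as [d' [Hd' K']].
set (t := Rmin d d' / (2 * (1 + norm h))).
assert (Hm : 0 < Rmin d d') by now apply Rmin_glb_lt.
assert (Ht : 0 < t) by (apply Rdiv_lt_0_compat; lra).
assert (Nt : norm (vscal (RtoC t) h) < Rmin d d').
{ rewrite norm_vscal_R by exact Ht; unfold t.
  apply Rle_lt_trans with (Rmin d d' / (2 * (1 + norm h)) * (1 + norm h)).
  - apply Rmult_le_compat_l; [left; exact Ht|lra].
  - replace (Rmin d d' / (2 * (1 + norm h)) * (1 + norm h)) with (Rmin d d' / 2)
      by (field; lra); lra. }
specialize (K _ (Rlt_le_trans _ _ _ Nt (Rmin_l _ _)) v Hv).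
specialize (K' _ (Rlt_le_trans _ _ _ Nt (Rmin_r _ _)) v Hv).
rewrite minus_vadd_l in K, K'.
set (D := minus (G (vadd x (vscal t h)) v) (G x v)).
change (norm (minus D (L (vscal t h :: v))) <= eps * norm (vscal t h) * Defs.prod_norm v) in K.
change (norm (minus D (L' (vscal t h :: v))) <= eps * norm (vscal t h) * Defs.prod_norm v) in K'.
assert (E1 : L (vscal (RtoC t) h :: v) = vscal (RtoC t) (L (h :: v)))
  by exact (linear_scal _ HL (RtoC t) h).
assert (E2 : L' (vscal (RtoC t) h :: v) = vscal (RtoC t) (L' (h :: v)))
  by exact (linear_scal _ HL' (RtoC t) h).
rewrite E1, norm_vscal_R in K by exact Ht; rewrite E2, norm_vscal_R in K' by exact Ht.
rewrite <- norm_opp_C in K; rewrite !minus_vadd in K, K'.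
assert (T := norm_vadd (vscal (Copp (RtoC 1)) (vadd D (vscal (Copp (RtoC 1)) (vscal t (L (h :: v))))))
   (vadd D (vscal (Copp (RtoC 1)) (vscal t (L' (h :: v)))))).
set (a := L (h :: v)) in *; set (b := L' (h :: v)) in *.
assert (E3 : vadd (vscal (Copp (RtoC 1)) (vadd D (vscal (Copp (RtoC 1)) (vscal (RtoC t) a))))
   (vadd D (vscal (Copp (RtoC 1)) (vscal (RtoC t) b))) =
   vscal (RtoC t) (vadd a (vscal (Copp (RtoC 1)) b))) by (vring a b D).
rewrite E3, norm_vscal_R in T by exact Ht; rewrite minus_vadd.
apply Rmult_le_reg_l with t; [exact Ht|]; nra.
Qed.

(** The induction step for [frechet_D]. Agreement with a formula [G] is asked only near [x] and on
    lists of length [m], since nothing is known of the other values. *)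
Lemma frechet_D_step m (F : X -> X) (G : X -> list X -> X) x L h v : length v = m ->
  (exists d, 0 < d /\ forall k, norm k < d -> forall w, length w = m ->
     G (vadd x k) w = frechet_D m F (vadd x k) w) ->
  is_frechet_derivative m G x L -> frechet_D (S m) F x (h :: v) = L (h :: v).
Proof.
intros Hv E H; assert (H' := frechet_derivative_ext _ _ _ _ _ E H).
apply (frechet_derivative_unique m (frechet_D m F) x); auto.
simpl; apply epsilon_spec; now exists L.
Qed.

Definition frechet_form1 (g : X -> C) (dg : X -> X -> C) x v : X :=
  match v with
  | h :: nil => vadd (vscal (g x) h) (vscal (dg x h) x)
  | _ => zero
  end.

Definition frechet_form2 (dg : X -> X -> C) (B : X -> X -> X -> C) x v : X :=
  match v with
  | k :: h :: nil =>
      vadd (vscal (dg x k) h) (vadd (vscal (dg x h) k) (vscal (B x k h) x))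
  | _ => zero
  end.

(** Meant for the origin only: elsewhere a term with the third derivative of [g] times [x] would be
    added. *)
Definition frechet_form3 (B : X -> X -> X -> C) x v : X :=
  match v with
  | l :: k :: h :: nil =>
      vadd (vscal (B x l k) h) (vadd (vscal (B x l h) k) (vscal (B x k h) l))
  | _ => zero
  end.

Lemma norm_vadd3 (a b c : X) (r s t : R) : norm a <= r -> norm b <= s -> norm c <= t ->
  norm (vadd a (vadd b c)) <= r + s + t.
Proof.
intros Ha Hb Hc; eapply Rle_trans; [apply norm_vadd|].
assert (T := norm_vadd b c); lra.
Qed.

Lemma length_sum_3 (u w : list X) : (length u + S (length w))%nat = 3%nat ->
  (u = nil /\ exists a b, w = a :: b :: nil) \/
  (exists a b, u = a :: nil /\ w = b :: nil) \/
  (exists a b, u = a :: b :: nil /\ w = nil).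
Proof.
intros E; destruct u as [|a [|b [|c u]]]; simpl in E; [left|right; left|right; right|lia];
  destruct w as [|d [|e [|f w]]]; simpl in E; try lia; eauto.
Qed.

Lemma length_sum_2 (u w : list X) : (length u + S (length w))%nat = 2%nat ->
  (u = nil /\ exists a, w = a :: nil) \/ (exists a, u = a :: nil /\ w = nil).
Proof.
intros E; destruct u as [|a [|b u]]; simpl in E; [left|right|lia];
  destruct w as [|d [|e w]]; simpl in E; try lia; eauto.
Qed.

Section Product.
Variables (g : X -> C) (dg : X -> X -> C) (B : X -> X -> X -> C) (F : X -> X).
Hypothesis data : forall x, norm x < 1 -> second_order_data g dg B x.
Hypothesis FE : forall x, norm x < 1 -> F x = vscal (g x) x.

Lemma frechet_derivative_product x : norm x < 1 ->
  is_frechet_derivative 0 (fun x _ => vscal (g x) x) x (frechet_form1 g dg x).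
Proof.
intros Hx; destruct (data x Hx) as [D _]; assert (HL := proj1 D).
destruct (Clinear_bound _ HL) as [M [HM HB]].
split.
- apply (bounded_multilinear_intro _ _ (Cmod (g x) + M)).
  + assert (A := Cmod_ge_0 (g x)); lra.
  + intros [|a u] [|b w] E y z; simpl in E; try lia; simpl.
    rewrite (Clinear_plus _ _ _ HL); set (p := g x); vring x y z.
  + intros [|a u] [|b w] E c z; simpl in E; try lia; simpl.
    rewrite (Clinear_scal _ _ _ HL); vring x z z.
  + intros [|z [|a v]] E; simpl in E; try lia; simpl.
    eapply Rle_trans; [apply norm_vadd|]; rewrite !norm_vscal, Rmult_1_r.
    assert (A := norm_ge_0 x); assert (A' := norm_ge_0 z).
    specialize (HB z); assert (A2 := Cmod_ge_0 (dg x z)); nra.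
- intros [eps He]; apply locally_vadd; simpl.
  destruct (proj2 D (eps / 2)) as [d [Hd K]]; [lra|].
  destruct (Fder_lipschitz_at _ _ _ D) as [N [d' [HN [Hd' K']]]].
  set (s := Rmin (Rmin d d') (eps / (2 * N))).
  exists s; split.
  { repeat apply Rmin_glb_lt; auto; apply Rdiv_lt_0_compat; lra. }
  intros h' Hh v Ev.
  assert (S1 : norm h' < d)
    by (eapply Rlt_le_trans; [exact Hh|]; eapply Rle_trans; [apply Rmin_l|apply Rmin_l]).
  assert (S2 : norm h' < d')
    by (eapply Rlt_le_trans; [exact Hh|]; eapply Rle_trans; [apply Rmin_l|apply Rmin_r]).
  assert (S3 : norm h' < eps / (2 * N)) by (eapply Rlt_le_trans; [exact Hh|apply Rmin_r]).
  specialize (K h' S1); specialize (K' h' S2).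
  destruct v; [|discriminate]; rewrite minus_vadd_l; simpl; rewrite !minus_vadd.
  set (a := g (vadd x h')) in *; set (b := g x) in *; set (c := dg x h') in *.
  (* Leibniz's rule: the Taylor error of [g] times [x], plus the increment of [g] times the
     increment of [x]. *)
  match goal with |- norm ?e <= _ =>
    replace e with (vadd (vscal (a - b - c)%C x) (vscal (a - b)%C h')) by (vring x h' h') end.
  eapply Rle_trans; [apply norm_vadd|]; rewrite !norm_vscal.
  apply <- Rlt_div_r in S3; [|lra].
  assert (A := norm_ge_0 x); assert (A' := norm_ge_0 h').
  assert (A2 := Cmod_ge_0 (a - b - c)); assert (A3 := Cmod_ge_0 (a - b)).
  assert (Y1 : Cmod (a - b - c) * norm x <= eps / 2 * norm h') by nra.
  assert (Y2 : Cmod (a - b) * norm h' <= eps / 2 * norm h').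
  { apply Rmult_le_compat_r; [exact A'|]; lra. }
  lra.
Qed.

Lemma frechet_D1_product x h : norm x < 1 ->
  frechet_D 1 F x (h :: nil) = vadd (vscal (g x) h) (vscal (dg x h) x).
Proof.
intros Hx.
apply (frechet_D_step 0 F (fun x _ => vscal (g x) x) x (frechet_form1 g dg x)); auto.
- exists (1 - norm x); split; [lra|]; intros k Hk w _; simpl; symmetry; apply FE.
  eapply Rle_lt_trans; [apply norm_vadd|lra].
- now apply frechet_derivative_product.
Qed.

Lemma holomorphic_product : holomorphic_on_ball F.
Proof.
intros x Hx.
assert (H : is_frechet_derivative 0 (frechet_D 0 F) x (frechet_form1 g dg x)).
{ apply (frechet_derivative_ext 0 (fun x _ => vscal (g x) x));
    [|now apply frechet_derivative_product].
  exists (1 - norm x); split; [lra|]; intros k Hk w _; simpl; symmetry; apply FE.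
  eapply Rle_lt_trans; [apply norm_vadd|lra]. }
destruct H as [[HL _] H]; exists (fun h => frechet_form1 g dg x (h :: nil)).
split; [exact (HL nil nil eq_refl)|]; intros x' Hx' eps.
rewrite <- (is_filter_lim_locally_unique x x' Hx').
specialize (H eps); revert H; apply filter_imp; intros y K.
specialize (K nil eq_refl); simpl Defs.prod_norm in K; rewrite Rmult_1_r in K; exact K.
Qed.

Lemma deriv_continuous x : norm x < 1 -> forall eps, 0 < eps -> exists d, 0 < d /\
  forall k, norm k < d -> forall h, Cmod (dg (vadd x k) h - dg x h)%C <= eps * norm h.
Proof.
intros Hx eps He; destruct (data x Hx) as [_ [_ [_ [[M [HM HB]] [D _]]]]].
destruct (D 1 Rlt_0_1) as [d [Hd K]].
exists (Rmin d (eps / (1 + M))); split.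
{ apply Rmin_glb_lt; [exact Hd|apply Rdiv_lt_0_compat; lra]. }
intros k Hk h.
destruct (Rmin_Rgt_l _ _ _ Hk) as [S1 S2].
specialize (K k S1 h); specialize (HB k h).
replace (dg (vadd x k) h - dg x h)%C with
  ((dg (vadd x k) h - dg x h - B x k h) + B x k h)%C by ring.
eapply Rle_trans; [apply Cmod_triangle|].
apply <- Rlt_div_r in S2; [|lra].
assert (A := norm_ge_0 h).
apply Rle_trans with (norm k * (1 + M) * norm h); [lra|].
apply Rmult_le_compat_r; lra.
Qed.

Lemma frechet_D2_product x k h : norm x < 1 ->
  frechet_D 2 F x (k :: h :: nil) =
  vadd (vscal (dg x k) h) (vadd (vscal (dg x h) k) (vscal (B x k h) x)).
Proof.
intros Hx; destruct (data x Hx) as [D [S [LB [[N [HN BN]] [D2 _]]]]].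
assert (HL := proj1 D).
apply (frechet_D_step 1 F (frechet_form1 g dg) x (frechet_form2 dg B x)); auto.
{ exists (1 - norm x); split; [lra|]; intros a Ha w Ew.
  destruct w as [|b [|c w]]; simpl in Ew; try lia; symmetry; apply frechet_D1_product.
  eapply Rle_lt_trans; [apply norm_vadd|lra]. }
destruct (Clinear_bound _ HL) as [M [HM HB]].
split.
- apply (bounded_multilinear_intro _ _ (2 * M + N)); [lra| | |].
  + intros u w E y z; destruct (length_sum_2 u w E) as [[-> [a ->]]|[a [-> ->]]]; simpl.
    * rewrite (Clinear_plus _ _ _ HL), !(S _ a), (Clinear_plus _ _ _ (LB a)).
      set (p := dg x a).
      transitivity (vadd (vadd (vscal (dg x y) a) (vadd (vscal p y) (vscal (B x a y) x)))
        (vadd (vscal (dg x z) a) (vadd (vscal p z) (vscal (B x a z) x)))); [|reflexivity].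
      rewrite vaddACA, <- vscalDl; f_equal; vring x y z.
    * rewrite (Clinear_plus _ _ _ HL), (Clinear_plus _ _ _ (LB a)).
      rewrite vaddACA, <- vscalDr; f_equal; vring x a a.
  + intros u w E c z; destruct (length_sum_2 u w E) as [[-> [a ->]]|[a [-> ->]]]; simpl.
    * rewrite (Clinear_scal _ _ _ HL), !(S _ a), (Clinear_scal _ _ _ (LB a)).
      vring x a z.
    * rewrite (Clinear_scal _ _ _ HL), (Clinear_scal _ _ _ (LB a)); vring x a z.
  + intros [|z [|a [|b v]]] E; simpl in E; try lia; simpl.
    assert (A := norm_ge_0 x); assert (A1 := norm_ge_0 a); assert (A2 := norm_ge_0 z).
    assert (A3 : 0 <= norm z * norm a) by nra.
    eapply Rle_trans; [apply (norm_vadd3 _ _ _ (M * (norm z * norm a)) (M * (norm z * norm a))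
      (N * (norm z * norm a)))|right; ring]; rewrite norm_vscal.
    * specialize (HB z); rewrite <- Rmult_assoc; now apply Rmult_le_compat_r.
    * specialize (HB a); replace (M * (norm z * norm a)) with (M * norm a * norm z) by ring.
      now apply Rmult_le_compat_r.
    * specialize (BN z a); assert (A4 := Cmod_ge_0 (B x z a)); nra.
- intros [eps He]; apply locally_vadd; simpl.
  destruct (proj2 D (eps / 3)) as [d1 [Hd1 K1]]; [lra|].
  destruct (D2 (eps / 3)) as [d2 [Hd2 K2]]; [lra|].
  destruct (deriv_continuous x Hx (eps / 3)) as [d3 [Hd3 K3]]; [lra|].
  exists (Rmin d1 (Rmin d2 d3)); split; [repeat apply Rmin_glb_lt; assumption|].
  intros a Ha v Ev; rewrite minus_vadd_l.
  destruct (Rmin_Rgt_l _ _ _ Ha) as [S1 S'].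
  destruct (Rmin_Rgt_l _ _ _ S') as [S2 S3].
  destruct v as [|b [|c v]]; simpl in Ev; try lia; simpl; rewrite !minus_vadd.
  specialize (K1 a S1); specialize (K2 a S2 b); specialize (K3 a S3 b).
  set (p := g (vadd x a)) in *; set (q := g x) in *; set (r := dg x a) in *.
  set (s := dg (vadd x a) b) in *; set (t := dg x b) in *; set (u := B x a b) in *.
  match goal with |- norm ?e <= _ =>
    replace e with (vadd (vscal (p - q - r)%C b)
      (vadd (vscal (s - t - u)%C x) (vscal (s - t)%C a))) by (vring x a b) end.
  assert (A := norm_ge_0 x); assert (A1 := norm_ge_0 a); assert (A2 := norm_ge_0 b).
  eapply Rle_trans; [apply (norm_vadd3 _ _ _ (eps / 3 * (norm a * norm b))
    (eps / 3 * (norm a * norm b)) (eps / 3 * (norm a * norm b)))|right; field];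
    rewrite norm_vscal.
  + rewrite <- Rmult_assoc; now apply Rmult_le_compat_r.
  + assert (A4 := Cmod_ge_0 (s - t - u)); nra.
  + replace (eps / 3 * (norm a * norm b)) with (eps / 3 * norm b * norm a) by ring.
    now apply Rmult_le_compat_r.
Qed.

(** In [D^2 F(x)] the form [B x] multiplies [x]. At the origin this product is differentiable as
    soon as [B] is continuous there, with derivative [B 0 k h] times the increment. *)
Lemma frechet_D3_product_0 l k h :
  frechet_D 3 F zero (l :: k :: h :: nil) =
  vadd (vscal (B zero l k) h) (vadd (vscal (B zero l h) k) (vscal (B zero k h) l)).
Proof.
assert (H0 : norm (zero : X) < 1) by (rewrite norm_zero; lra).
destruct (data zero H0) as [D [S [LB [[N [HN BN]] [D2 D3]]]]].
apply (frechet_D_step 2 F (frechet_form2 dg B) zero (frechet_form3 B zero)); auto.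
{ exists 1; split; [lra|]; intros a Ha w Ew.
  destruct w as [|b [|c [|d w]]]; simpl in Ew; try lia; symmetry.
  apply frechet_D2_product; eapply Rle_lt_trans; [apply norm_vadd|]; rewrite norm_zero; lra. }
set (b := B zero) in *.
split.
- apply (bounded_multilinear_intro _ _ (3 * N)); [lra| | |].
  + intros u w E y z; destruct (length_sum_3 u w E) as
      [[-> [a [c ->]]]|[[a [c [-> ->]]]|[a [c [-> ->]]]]]; simpl; fold b.
    * rewrite !(S _ a), !(S _ c), !(Clinear_plus _ _ _ (LB _)).
      rewrite vaddACA, <- vscalDl; f_equal.
      rewrite vaddACA, <- vscalDl, vscalDr; reflexivity.
    * rewrite !(S _ c), !(Clinear_plus _ _ _ (LB _)).
      rewrite vaddACA, <- vscalDl; f_equal.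
      rewrite vaddACA, <- vscalDl, vscalDr; reflexivity.
    * rewrite !(Clinear_plus _ _ _ (LB _)).
      rewrite vaddACA, <- vscalDr; f_equal.
      rewrite vaddACA, <- !vscalDl; reflexivity.
  + intros u w E e z; destruct (length_sum_3 u w E) as
      [[-> [a [c ->]]]|[[a [c [-> ->]]]|[a [c [-> ->]]]]]; simpl; fold b.
    * rewrite !(S _ a), !(S _ c), !(Clinear_scal _ _ _ (LB _)); vring a c z.
    * rewrite !(S _ c), !(Clinear_scal _ _ _ (LB _)); vring a c z.
    * rewrite !(Clinear_scal _ _ _ (LB _)); vring a c z.
  + intros [|p [|q [|r [|s v]]]] E; simpl in E; try lia; simpl; fold b.
    assert (A := norm_ge_0 p); assert (A1 := norm_ge_0 q); assert (A2 := norm_ge_0 r).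
    eapply Rle_trans; [apply (norm_vadd3 _ _ _ (N * norm p * norm q * norm r)
      (N * norm p * norm r * norm q) (N * norm q * norm r * norm p))|right; ring];
      rewrite norm_vscal; now apply Rmult_le_compat_r.
- intros [eps He]; apply locally_vadd; simpl.
  destruct (D2 (eps / 3)) as [d2 [Hd2 K2]]; [lra|].
  destruct (D3 (eps / 3)) as [d3 [Hd3 K3]]; [lra|].
  exists (Rmin d2 d3); split; [now apply Rmin_glb_lt|].
  intros a Ha v Ev; rewrite minus_vadd_l.
  destruct (Rmin_Rgt_l _ _ _ Ha) as [S2 S3].
  destruct v as [|p [|q [|e v]]]; simpl in Ev; try lia; simpl; rewrite !minus_vadd.
  assert (K2p := K2 a S2 p); assert (K2q := K2 a S2 q); specialize (K3 a S3 p q).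
  fold b in K2p, K2q, K3 |- *.
  assert (E0 : vadd zero a = a) by now rewrite vaddC, vadd0.
  rewrite E0 in *.
  set (c1 := dg a p) in *; set (c2 := dg zero p) in *; set (c3 := b a p) in *.
  set (c4 := dg a q) in *; set (c5 := dg zero q) in *; set (c6 := b a q) in *.
  set (c7 := B a p q) in *; set (c8 := b p q) in *.
  match goal with |- norm ?e <= _ =>
    replace e with (vadd (vscal (c1 - c2 - c3)%C q)
      (vadd (vscal (c4 - c5 - c6)%C p) (vscal (c7 - c8)%C a))) by (vring a p q) end.
  assert (A := norm_ge_0 a); assert (A1 := norm_ge_0 p); assert (A2 := norm_ge_0 q).
  eapply Rle_trans; [apply (norm_vadd3 _ _ _ (eps / 3 * norm a * norm p * norm q)
    (eps / 3 * norm a * norm q * norm p) (eps / 3 * norm p * norm q * norm a))|right; field];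
    rewrite norm_vscal; now apply Rmult_le_compat_r.
Qed.

End Product.
End FrechetCalculus.

(** * Coefficient bounds *)

Lemma Cmult_conj (z : C) : (z * Cconj z)%C = RtoC (Cmod z ^ 2).
Proof.
destruct z as [a b]; unfold Cmod; rewrite pow2_sqrt by (simpl; nra).
unfold Cconj, Cmult, RtoC; simpl; f_equal; ring.
Qed.

Lemma Cconj_plus (z w : C) : Cconj (z + w)%C = (Cconj z + Cconj w)%C.
Proof. destruct z, w; unfold Cconj, Cplus; simpl; f_equal; ring. Qed.

Lemma Cconj_mult (z w : C) : Cconj (z * w)%C = (Cconj z * Cconj w)%C.
Proof. destruct z, w; unfold Cconj, Cmult; simpl; f_equal; ring. Qed.

Lemma Cconj_RtoC (r : R) : Cconj (RtoC r) = RtoC r.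
Proof. unfold Cconj, RtoC; simpl; f_equal; ring. Qed.

Lemma Cconj_involutive (z : C) : Cconj (Cconj z) = z.
Proof. destruct z; unfold Cconj; simpl; f_equal; ring. Qed.

Lemma re_conj_minus (z : C) : fst (Cconj z - z)%C = 0.
Proof. destruct z; unfold Cconj, Cminus, Cplus, Copp; simpl; ring. Qed.

(* For |z| = r the quantity Re P |1 + s w + u w^2|^2, with w = z / r and
   P = 1 + z q, is nonnegative and equals Re chi for a chi that is holomorphic in
   the disc: the poles of P times the conjugate factors are reflected in the
   circle. *)
Lemma caratheodory_toeplitz (q : C -> C) (a b s u : C) (r : R) :
  (forall z, Cmod z < 1 -> exists l, Cder q z l) ->
  q 0%C = a -> Cder q 0%C b ->
  (forall z, 0 < Cmod z < 1 -> 0 <= fst (1 + z * q z)%C) ->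
  0 < r < 1 -> Cmod u = 1 ->
  0 <= fst (2 + s * Cconj s + Cconj (s + u * Cconj s) * (RtoC r * a)
            + Cconj u * (RtoC r * RtoC r * b))%C.
Proof.
intros D Ea Db Hpos Hr Hu.
destruct (Cder_slope _ _ _ Db) as [Q [Q1 [Q2 Q3]]]; rewrite Ea in Q3.
assert (Q3' : forall z, q z = (a + Q z * z)%C) by (intros z; rewrite Q3; ring); clear Q3.
assert (Nr : RtoC r <> 0%C) by (apply RtoC_neq_0; lra).
set (A1 := (s + u * Cconj s)%C).
(* The first group is [P] times the part of [|f|^2] without conjugates of [w]. The second consists
   of the conjugates of the terms in which a conjugate of [w] survives; they have the same real
   parts. The third collects the terms where it cancels against [z = r w], after
   [q z = a + Q z * z]. *)
set (chi := fun z : C => ((1 + z * q z) * (2 + s * Cconj s + A1 * (z / RtoC r)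
   + u * ((z / RtoC r) * (z / RtoC r)))
  + (A1 * (z / RtoC r) + u * ((z / RtoC r) * (z / RtoC r))
  + u * RtoC r * Cconj a * (z / RtoC r))
  + (Cconj A1 * RtoC r * q z + Cconj u * (RtoC r * RtoC r) * Q z))%C).
assert (E0 : chi 0%C = (2 + s * Cconj s + Cconj A1 * (RtoC r * a)
            + Cconj u * (RtoC r * RtoC r * b))%C).
{ unfold chi; rewrite Ea, Q2; field; exact Nr. }
fold A1; rewrite <- E0.
assert (DQ : forall z, 0 < Cmod z < 1 -> exists l, Cder Q z l).
{ intros z [Hz1 Hz2]; destruct (D z Hz2) as [l Hl]; eexists.
  apply (Cder_ext_loc (fun z => (q z - a) / z)%C _ _ _ (Cmod z) Hz1).
  - intros w Hw; assert (Nw : w <> 0%C).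
    { intros E; rewrite E in Hw; replace (0 - z)%C with (- z)%C in Hw by ring.
      rewrite Cmod_opp in Hw; lra. }
    rewrite Q3'; field; exact Nw.
  - apply Cder_div; [|apply Cder_id|now apply Cmod_gt_0].
    apply Cder_minus; [exact Hl|apply Cder_const]. }
apply (re_ge_0_of_circle chi 1 r); [| |exact Hr|].
- intros z Hz; destruct (D z (proj2 Hz)) as [l Hl]; destruct (DQ z Hz) as [m Hm].
  eexists; unfold chi.
  assert (Dw : Cder (fun z => z / RtoC r)%C z (/ RtoC r)%C).
  { apply (Cder_ext_loc (fun z => / RtoC r * z)%C _ _ _ 1 Rlt_0_1).
    - intros; field; exact Nr.
    - assert (E : (/ RtoC r * 1 = / RtoC r)%C) by ring.
      refine (eq_ind _ (Cder _ z) _ _ E); apply Cder_scal, Cder_id. }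
  repeat first [apply Cder_plus | apply Cder_scal
    | exact Hl | exact Hm | exact Dw | apply Cder_const | apply Cder_id
    | apply Cder_mult].
- assert (Cw : Ccts (fun z => z / RtoC r)%C 0%C)
    by (apply Ccts_mult; [apply Ccts_id|apply Ccts_const]).
  assert (Cq : Ccts q 0%C) by exact (Cder_Ccts _ _ _ Db).
  unfold chi; repeat first [apply Ccts_plus | exact Cq | exact Q1 | exact Cw
    | apply Ccts_const | apply Ccts_id | apply Ccts_mult].
- intros z Hz; set (w := (z / RtoC r)%C).
  assert (Ew : (w * Cconj w = 1)%C).
  { rewrite Cmult_conj; unfold w; rewrite Cmod_div, Cmod_R, Hz, Rabs_pos_eq
      by (auto; lra).
    f_equal; field; lra. }
  assert (Eu : (u * Cconj u = 1)%C) by (rewrite Cmult_conj, Hu; f_equal; ring).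
  assert (Ez : z = (RtoC r * w)%C) by (unfold w; field; exact Nr).
  set (f := (1 + s * w + u * (w * w))%C).
  assert (Ef : (RtoC (Cmod f ^ 2) = 2 + s * Cconj s + A1 * w + u * (w * w)
    + Cconj A1 * Cconj w + Cconj u * (Cconj w * Cconj w))%C).
  { rewrite <- Cmult_conj; unfold f, A1.
    rewrite !Cconj_plus, !Cconj_mult, Cconj_RtoC, Cconj_involutive.
    set (wb := Cconj w) in *; set (ub := Cconj u) in *; set (sb := Cconj s).
    (* [ring] treats conjugates as independent variables, so the multiples of [w wb - 1] and
       [u ub - 1] are exhibited and then shown to vanish. *)
    transitivity (2 + s * sb + (s + u * sb) * w + u * (w * w)
      + (sb + ub * s) * wb + ub * (wb * wb)
      + (w * wb - 1) * (s * sb + s * ub * wb + u * sb * w + u * ub * (w * wb + 1))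
      + (u * ub - 1))%C; [ring|].
    rewrite Ew, Eu; ring. }
  set (P := (1 + z * q z)%C).
  assert (Echi : chi z = (P * RtoC (Cmod f ^ 2)
    - (Cconj (A1 * w) - A1 * w) - (Cconj (u * (w * w)) - u * (w * w))
    - (Cconj (u * RtoC r * Cconj a * w) - u * RtoC r * Cconj a * w))%C).
  { rewrite Ef; unfold chi; fold w; fold P.
    rewrite !Cconj_mult, Cconj_RtoC, Cconj_involutive.
    set (wb := Cconj w) in *; set (ub := Cconj u) in *; set (A1b := Cconj A1).
    assert (EP : P = (1 + RtoC r * w * q z)%C) by (unfold P; rewrite Ez at 1; reflexivity).
    assert (Eq : q z = (a + Q z * (RtoC r * w))%C) by (rewrite Q3', Ez at 1; rewrite <- Ez; reflexivity).
    transitivity (P * (2 + s * Cconj s + A1 * w + u * (w * w) + A1b * wb + ub * (wb * wb))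
       - (A1b * wb - A1 * w) - (ub * (wb * wb) - u * (w * w))
       - (ub * RtoC r * a * wb - u * RtoC r * Cconj a * w)
       - (w * wb - 1) * (A1b * RtoC r * q z + ub * RtoC r * q z * wb + ub * (RtoC r * RtoC r) * Q z))%C.
    - rewrite EP, Eq; ring.
    - rewrite Ew; ring. }
  rewrite Echi.
  assert (R1 := re_conj_minus (A1 * w)); assert (R2 := re_conj_minus (u * (w * w))).
  assert (R3 := re_conj_minus (u * RtoC r * Cconj a * w)).
  set (z1 := (Cconj (A1 * w) - A1 * w)%C) in *.
  set (z2 := (Cconj (u * (w * w)) - u * (w * w))%C) in *.
  set (z3 := (Cconj (u * RtoC r * Cconj a * w) - u * RtoC r * Cconj a * w)%C) in *.
  clearbody z1 z2 z3.
  assert (HP : 0 <= fst P) by (apply Hpos; lra).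
  assert (Hf := pow2_ge_0 (Cmod f)).
  set (c := Cmod f ^ 2) in *; clearbody c P.
  unfold Cminus, Cplus, Copp, Cmult, RtoC; simpl.
  rewrite R1, R2, R3; assert (0 <= fst P * c) by now apply Rmult_le_pos.
  lra.
Qed.

(** For [P = 1 + z q z], with [p_1 = a] and [p_2 = b], this is the classical
    [|p_2 - p_1^2 / 2| <= 2 - |p_1|^2 / 2]. It is the positivity of the form above for the best [s]
    and [u], in the limit [r -> 1]. *)
Theorem caratheodory_second_coefficient (q : C -> C) (a b : C) :
  (forall z, Cmod z < 1 -> exists l, Cder q z l) ->
  q 0%C = a -> Cder q 0%C b ->
  (forall z, 0 < Cmod z < 1 -> 0 <= fst (1 + z * q z)%C) ->
  Cmod (b - a * a / 2)%C <= 2 - Cmod a ^ 2 / 2.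
Proof.
intros D Ea Db Hpos.
destruct (C_unimodular_rotation (b - a * a / 2)%C) as [v [V1 V2]].
(* This [u] makes [Cconj u * (b - a * a / 2)] equal to minus its modulus. *)
set (u := Cconj (- v)%C).
assert (Hu : Cmod u = 1) by (unfold u; now rewrite Cmod_conj, Cmod_opp).
assert (Eub : Cconj u = (- v)%C) by (unfold u; apply Cconj_involutive).
set (Z := Cmod (b - a * a / 2)%C + Cmod a ^ 2 / 2).
assert (K : forall r, 0 < r < 1 -> r * r * Z <= 2).
{ intros r Hr.
  (* The [s]-dependent part of the form is [|s|^2] plus the real part of
     [Cconj s * r * (a + u * Cconj a)]; the chosen [s] is its minimum. *)
  assert (T := caratheodory_toeplitz q a b (- (RtoC r * (a + u * Cconj a)) / 2)%C u r
    D Ea Db Hpos Hr Hu).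
  set (y := (Cconj u * (a * a))%C).
  match type of T with 0 <= fst ?e => assert (E : e =
    (2 - RtoC (r * r * Z) + RtoC (r * r / 4) * (Cconj y - y))%C) end.
  { assert (Eu : (u * Cconj u = 1)%C) by (rewrite Cmult_conj, Hu; f_equal; ring).
    assert (EZ : RtoC Z = (- (Cconj u * (b - a * a / 2)) + a * Cconj a / 2)%C).
    { unfold Z; rewrite RtoC_plus, RtoC_div, <- Cmult_conj, <- V2, Eub by lra; field. }
    assert (Es : Cconj (- (RtoC r * (a + u * Cconj a)) / 2)%C =
      (- (RtoC r * (Cconj a + Cconj u * a)) / 2)%C).
    { destruct a, u; unfold Cdiv, Cinv, Cconj, Cmult, Cplus, Copp, RtoC; simpl; f_equal; field. }
    rewrite Cconj_plus, !Cconj_mult, Cconj_involutive.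
    unfold y; rewrite !Cconj_mult, Cconj_involutive, Es, !RtoC_mult, EZ, RtoC_div, RtoC_mult by lra.
    set (ub := Cconj u) in *; set (ab := Cconj a) in *.
    transitivity (2 - RtoC r * RtoC r * (- (ub * (b - a * a / 2)) + a * ab / 2) +
      RtoC r * RtoC r / 4 * (u * (ab * ab) - ub * (a * a))
      - (u * ub - 1) * (RtoC r * RtoC r * a * ab / 4))%C; [field|rewrite Eu; ring]. }
  assert (Hy := re_conj_minus y); set (y' := (Cconj y - y)%C) in *; clearbody y'.
  rewrite E in T; unfold Cminus, Cplus, Copp, Cmult, RtoC in T; simpl in T.
  rewrite Hy in T; lra. }
assert (HZ : Z <= 2); [|unfold Z in HZ; lra].
apply (le_of_small_error _ _ (2 * Rabs Z) 1 1); try lra.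
{ assert (A := Rabs_pos Z); lra. }
intros t Ht Ht1; specialize (K (1 - t) ltac:(lra)).
assert (A := Rle_abs Z); assert (A' := Rabs_pos Z).
assert (Z * (2 * t - t * t) <= Rabs Z * (2 * t)); [|nra].
apply Rle_trans with (Rabs Z * (2 * t - t * t)).
- apply Rmult_le_compat_r; nra.
- apply Rmult_le_compat_l; nra.
Qed.

(** * The extremal problem for the determinant *)

Lemma toeplitz_square_form (a b : C) :
  1 - 2 * Cmod a ^ 2 + 2 * Re (a ^ 2 * Cconj b)%C - Cmod b ^ 2 =
  (1 - Cmod a ^ 2) ^ 2 - Cmod (b - a * a)%C ^ 2.
Proof.
assert (E : forall z : C, Cmod z ^ 2 = fst z ^ 2 + snd z ^ 2)
  by (intros z; apply pow2_sqrt; nra).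
rewrite !E; destruct a as [x y], b as [u v].
unfold Re, Cconj, Cminus, Cplus, Copp, Cmult, RtoC; simpl; ring.
Qed.

Lemma toeplitz_bounds (lambda : R) (a b : C) : 1 / 2 <= lambda <= 1 ->
  let mu := lambda + 1 / 2 in
  Cmod ((6 * b - 4 * (a * a)) / RtoC mu - (2 * a / RtoC mu) * (2 * a / RtoC mu) / 2)%C
    <= 2 - Cmod (2 * a / RtoC mu)%C ^ 2 / 2 ->
  T31_lower lambda <= 1 - 2 * Cmod a ^ 2 + 2 * Re (a ^ 2 * Cconj b)%C - Cmod b ^ 2
    <= T31_upper lambda.
Proof.
intros Hl mu H; rewrite toeplitz_square_form.
assert (Hmu : 1 <= mu <= 3 / 2) by (unfold mu; lra).
assert (Nm : RtoC mu <> 0%C) by (apply RtoC_neq_0; lra).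
set (s := Cmod a ^ 2); set (d := Cmod (b - a * a)%C).
assert (Hd : 0 <= d) by apply Cmod_ge_0.
assert (Hs : 0 <= s) by apply pow2_ge_0.
(* The hypothesis times [mu ^ 2 / 2] becomes [|W| <= mu ^ 2 - s]. *)
set (W := (3 * RtoC mu * b - (2 * RtoC mu + 1) * (a * a))%C).
assert (HW : Cmod W <= mu ^ 2 - s).
{ replace ((6 * b - 4 * (a * a)) / RtoC mu - (2 * a / RtoC mu) * (2 * a / RtoC mu) / 2)%C
    with (2 * W / (RtoC mu * RtoC mu))%C in H by (unfold W; field; exact Nm).
  rewrite !Cmod_div, !Cmod_mult, !Cmod_R, !Rabs_pos_eq in H
    by (try apply Cmult_neq_0; auto; lra).
  apply Rmult_le_compat_r with (r := mu * mu / 2) in H; [|nra].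
  replace (2 * Cmod W / (mu * mu) * (mu * mu / 2)) with (Cmod W) in H by (field; lra).
  replace ((2 - (2 * Cmod a / mu) ^ 2 / 2) * (mu * mu / 2)) with (mu ^ 2 - s) in H
    by (unfold s; field; lra).
  exact H. }
assert (Ea : Cmod (a * a)%C = s) by (rewrite Cmod_mult; unfold s; ring).
assert (E1 : (RtoC (3 * mu) * (b - a * a) = W + RtoC (1 - mu) * (a * a))%C).
{ unfold W; rewrite RtoC_minus, RtoC_mult; ring. }
(* [N1] and [N2] are the two triangle inequalities for [E1]: they place [d] between the inner and
   the outer radius of the annulus. *)
assert (N1 : 3 * mu * d <= (mu ^ 2 - s) + (mu - 1) * s).
{ apply Rle_trans with (Cmod (RtoC (3 * mu) * (b - a * a))%C).
  - rewrite Cmod_mult, Cmod_R, Rabs_pos_eq by lra; fold d; lra.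
  - rewrite E1; eapply Rle_trans; [apply Cmod_triangle|].
    rewrite Cmod_mult, Ea, Cmod_R, Rabs_left1 by lra; lra. }
assert (N2 : (mu - 1) * s <= 3 * mu * d + (mu ^ 2 - s)).
{ assert (T := Cmod_triangle (RtoC (3 * mu) * (b - a * a))%C (- W)%C).
  rewrite E1 in T at 1.
  replace (W + RtoC (1 - mu) * (a * a) + - W)%C with (RtoC (1 - mu) * (a * a))%C in T by ring.
  rewrite Cmod_opp, (Cmod_mult (RtoC (1 - mu))), (Cmod_mult (RtoC (3 * mu))), Ea, !Cmod_R, Rabs_left1, Rabs_pos_eq in T by lra.
  fold d in T; lra. }
assert (Hs2 : s <= mu ^ 2) by (assert (A := Cmod_ge_0 W); lra).
clearbody s d; clear H HW Ea E1 W; clear a b Nm.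
assert (El : lambda = mu - 1 / 2) by (unfold mu; ring).
clearbody mu; subst lambda.
split.
- unfold T31_lower.
  set (e := (mu ^ 2 - (2 - mu) * s) / (3 * mu)).
  assert (Hde : d <= e).
  { unfold e; apply Rmult_le_reg_l with (3 * mu); [lra|].
    replace (3 * mu * ((mu ^ 2 - (2 - mu) * s) / (3 * mu))) with (mu ^ 2 - (2 - mu) * s)
      by (field; lra); lra. }
  assert (Hd2 : d ^ 2 <= e ^ 2) by (apply pow_incr; lra).
  apply Rle_trans with ((1 - s) ^ 2 - e ^ 2); [|lra].
  set (m := ((mu - 1) ^ 2 * (mu + 2) ^ 2) / (4 * (2 * mu - 1) * (mu + 1))).
  replace ((2 * (mu - 1 / 2) - 1) ^ 2 * (2 * (mu - 1 / 2) + 5) ^ 2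
     / (64 * (mu - 1 / 2) * (2 * (mu - 1 / 2) + 3))) with m by (unfold m; field; lra).
  set (k := (4 * mu - 2) * (2 * mu + 2) / (9 * mu ^ 2)).
  (* As a difference of squares, [(1 - s) ^ 2 - e ^ 2] has two explicit roots in [s]; [c] is their
     midpoint, [k] the leading coefficient and [- m] the minimum. *)
  set (c := mu * (3 - mu) / (4 * mu - 2) / 2 + mu * (3 + mu) / (2 * mu + 2) / 2).
  assert (Eq : (1 - s) ^ 2 - e ^ 2 = - m + k * (s - c) ^ 2)
    by (unfold e, m, k, c; field; lra).
  assert (Hk : 0 <= k) by (apply Rdiv_le_0_compat; nra).
  assert (0 <= k * (s - c) ^ 2) by (apply Rmult_le_pos; [exact Hk|apply pow2_ge_0]).
  lra.
(* The inner radius [(s - mu) / 3] is positive only for [s > mu]. For [s <= mu <= 3 / 2] already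
   [(1 - s) ^ 2] is at most 1. *)
- assert (Hc : (1 - s) ^ 2 - d ^ 2 <= 1 \/
    (mu < s /\ (1 - s) ^ 2 - d ^ 2 <= (1 - s) ^ 2 - (s - mu) ^ 2 / 9)).
  { destruct (Rle_dec s mu) as [L|L]; [left; nra|right; split; [lra|]].
    assert (s - mu <= 3 * d); [|nra].
    apply Rmult_le_reg_l with mu; nra. }
  (* The value of [(1 - s) ^ 2 - (s - mu) ^ 2 / 9] at [s = mu ^ 2]. *)
  set (U := 1 + (2 / 9) * mu ^ 2 * (4 * mu ^ 2 + mu - 19 / 2)).
  assert (Hmax : (1 - s) ^ 2 - d ^ 2 <= 1 \/ (1 - s) ^ 2 - d ^ 2 <= U).
  { destruct Hc as [Hc|[Hc1 Hc2]]; [now left|].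
    set (h := (1 - s) ^ 2 - (s - mu) ^ 2 / 9) in *.
    assert (Hm1 : 0 < mu ^ 2 - mu) by lra.
    assert (P : 0 <= (mu ^ 2 - mu) * (8 / 9 * ((s - mu) * (mu ^ 2 - s))))
      by (repeat apply Rmult_le_pos; lra).
    (* [h] is convex, so it lies below its chord on [[mu, mu ^ 2]] *)
    assert (Hch : (mu ^ 2 - mu) * h =
      (mu ^ 2 - s) * (1 - mu) ^ 2 + (s - mu) * U
      - (mu ^ 2 - mu) * (8 / 9 * ((s - mu) * (mu ^ 2 - s)))) by (unfold h, U; field).
    assert (Q1 : (1 - mu) ^ 2 <= 1) by nra.
    assert (Q2 : (mu ^ 2 - s) * (1 - mu) ^ 2 <= (mu ^ 2 - s) * 1)
      by (apply Rmult_le_compat_l; lra).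
    destruct (Rle_dec U 1) as [HU|HU]; [left|right]; (eapply Rle_trans; [exact Hc2|]);
      (apply Rmult_le_reg_l with (mu ^ 2 - mu); [exact Hm1|]); rewrite Hch.
    - assert ((s - mu) * U <= (s - mu) * 1) by (apply Rmult_le_compat_l; lra); lra.
    - assert ((mu ^ 2 - s) * 1 <= (mu ^ 2 - s) * U) by (apply Rmult_le_compat_l; lra); lra. }
  assert (EU : 1 + (1 + 2 * (mu - 1 / 2)) ^ 2 * (4 * (mu - 1 / 2) ^ 2 + 5 * (mu - 1 / 2) - 8) / 18
    = U) by (unfold U; field).
  unfold T31_upper; rewrite EU.
  assert (Hr : 0 <= sqrt 153) by apply sqrt_pos.
  assert (Hr2 : sqrt 153 * sqrt 153 = 153) by (apply sqrt_sqrt; lra).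
  set (x := sqrt 153) in *; clearbody x.
  (* The positive root of [4 * lambda ^ 2 + 5 * lambda - 8] separates the cases [U <= 1] and
     [U >= 1]. *)
  assert (EU2 : U = 1 + (8 / 9) * mu ^ 2 *
     ((mu - 1 / 2 - (x - 5) / 8) * (mu - 1 / 2 + (x + 5) / 8))).
  { unfold U; replace ((mu - 1 / 2 - (x - 5) / 8) * (mu - 1 / 2 + (x + 5) / 8))
      with ((mu - 1 / 2) ^ 2 + 5 / 4 * (mu - 1 / 2) + (25 - x * x) / 64) by field.
    rewrite Hr2; field. }
  assert (Q : 0 <= 8 / 9 * mu ^ 2) by nra.
  destruct (Rle_dec (mu - 1 / 2) ((x - 5) / 8)) as [L|L].
  + assert ((mu - 1 / 2 - (x - 5) / 8) * (mu - 1 / 2 + (x + 5) / 8) <= 0) by nra.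
    destruct Hmax; [assumption|]; nra.
  + assert (0 <= (mu - 1 / 2 - (x - 5) / 8) * (mu - 1 / 2 + (x + 5) / 8)) by nra.
    destruct Hmax; [|assumption]; nra.
Qed.

(** * Restriction to the slices [z x0] *)

Section Slices.
Context {X : NormedModule C_AbsRing}.
Implicit Types (x y h k : X) (g : X -> C).

Lemma vadd0l x : vadd zero x = x.
Proof. now rewrite vaddC, vadd0. Qed.

Lemma Fder_line g h (z : C) L : Fder g (vscal z h) L ->
  Cder (fun w => g (vscal w h)) z (L h).
Proof.
intros H; rewrite <- (vadd0l (vscal z h)) in H; apply Fder_slice in H.
apply (Cder_ext_loc (fun w => g (vadd zero (vscal w h))) _ _ _ 1 Rlt_0_1); auto.
intros w _; now rewrite vadd0l.
Qed.

Lemma second_order_Fder g dg (B : X -> X -> X -> C) x h : second_order_data g dg B x ->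
  Fder (fun y => dg y h) x (fun k => B x k h).
Proof.
intros [D [S [LB [[M [HM HB]] [D2 _]]]]]; split.
- apply (Clinear_intro _ (M * norm h)).
  + intros y z; rewrite !(S _ h); now apply Clinear_plus.
  + intros c z; rewrite !(S _ h); now apply Clinear_scal.
  + intros k; eapply Rle_trans; [apply HB|]; right; ring.
- intros eps He; assert (A := norm_ge_0 h).
  destruct (D2 (eps / (1 + norm h))) as [d [Hd K]]; [apply Rdiv_lt_0_compat; lra|].
  exists d; split; [exact Hd|]; intros k Hk; eapply Rle_trans; [exact (K k Hk h)|].
  assert (A' := norm_ge_0 k).
  rewrite Rmult_assoc; apply scaled_error_le; lra.
Qed.

Section Product.
Variables (g : X -> C) (dg : X -> X -> C) (B : X -> X -> X -> C) (F : X -> X).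
Hypothesis data : forall x, norm x < 1 -> second_order_data g dg B x.
Hypothesis FE : forall x, norm x < 1 -> F x = vscal (g x) x.

(** For [x = z x0] and [f z = z g(z x0)] this is [f' z], and [radial_deriv2 x] is [z f'' z]. *)
Definition radial_deriv x : C := (g x + dg x x)%C.
Definition radial_deriv2 x : C := (2 * dg x x + B x x x)%C.

(** [D F(x)] multiplies [x] by [radial_deriv x]. If this vanished, injectivity would give [x = 0],
    where its value is [g 0 = 1]. *)
Lemma radial_deriv_neq_0 x : norm x < 1 -> g zero = RtoC 1 ->
  (exists J, is_bounded_inverse (fun h => frechet_D 1 F x (h :: nil)) J) ->
  radial_deriv x <> 0%C.
Proof.
intros Hx g0 [J [_ [J1 _]]] E; unfold radial_deriv in E.
assert (HL := proj1 (proj1 (data x Hx))).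
assert (A : forall h, frechet_D 1 F x (h :: nil) = vadd (vscal (g x) h) (vscal (dg x h) x))
  by (intros h; now apply (frechet_D1_product g dg B F)).
assert (Ex : x = zero).
{ assert (J1x := J1 x); assert (J1z := J1 zero); rewrite A in J1x, J1z.
  rewrite <- vscalDl, E, vscal0 in J1x.
  rewrite (Clinear_zero _ HL), vscal_zero, vscal0, vadd0 in J1z; congruence. }
rewrite Ex in E, HL; rewrite (Clinear_zero _ HL), g0 in E.
apply (f_equal fst) in E; simpl in E; lra.
Qed.

(** The argument of the inverse is [radial_deriv2 x + radial_deriv x] times [x], and on the line
    through [x] the inverse divides by [radial_deriv x]. *)
Lemma bounded_inverse_product x : norm x < 1 -> radial_deriv x <> 0%C ->
  (exists J, is_bounded_inverse (fun h => frechet_D 1 F x (h :: nil)) J) ->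
  bounded_inverse (fun h => frechet_D 1 F x (h :: nil))
    (plus (frechet_D 2 F x (x :: x :: nil)) (frechet_D 1 F x (x :: nil))) =
  vscal (1 + radial_deriv2 x / radial_deriv x)%C x.
Proof.
intros Hx N H.
assert (HL := proj1 (proj1 (data x Hx))).
assert (A : forall h, frechet_D 1 F x (h :: nil) = vadd (vscal (g x) h) (vscal (dg x h) x))
  by (intros h; now apply (frechet_D1_product g dg B F)).
assert (HJ := epsilon_spec (inhabits (fun h : X => h))
  (is_bounded_inverse (fun h => frechet_D 1 F x (h :: nil))) H).
fold (bounded_inverse (fun h => frechet_D 1 F x (h :: nil))) in HJ.
destruct HJ as [_ [J1 _]].
rewrite <- (J1 (vscal (1 + radial_deriv2 x / radial_deriv x)%C x)); f_equal.
change (vadd (frechet_D 2 F x (x :: x :: nil)) (frechet_D 1 F x (x :: nil)) =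
  frechet_D 1 F x (vscal (1 + radial_deriv2 x / radial_deriv x)%C x :: nil)).
rewrite !A, (frechet_D2_product g dg B F), (Clinear_scal _ _ _ HL) by assumption.
unfold radial_deriv2; unfold radial_deriv in *.
rewrite <- !vscalDl, !vscalA, <- !vscalDl; f_equal; field; exact N.
Qed.

(** The class condition at [z x0] is tested by functionals supporting [z x0], whereas [T] supports
    [x0]; a unimodular factor mediates. *)
Lemma support_functional_rotate (z : C) x0 (T : X -> C) :
  z <> 0%C -> norm x0 = 1 -> support_functional x0 T ->
  support_functional (vscal z x0) (fun y => (RtoC (Cmod z) / z * T y)%C).
Proof.
intros Nz Hn [TL [Tx TN]].
assert (P := proj1 (Cmod_gt_0 z) Nz).
set (c := (RtoC (Cmod z) / z)%C).
assert (Hc : Cmod c = 1).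
{ unfold c; rewrite Cmod_div, Cmod_R, Rabs_pos_eq by (auto; lra); field; lra. }
split; [|split].
- destruct (Clinear_bound T TL) as [M [HM HB]].
  apply (Clinear_intro _ M).
  + intros x y; rewrite (Clinear_plus T) by exact TL; ring.
  + intros d y; rewrite (Clinear_scal T) by exact TL; ring.
  + intros y; rewrite Cmod_mult, Hc, Rmult_1_l; apply HB.
- rewrite (Clinear_scal T) by exact TL; rewrite Tx, norm_vscal, Hn, Rmult_1_r.
  unfold c; field; exact Nz.
- destruct TN as [T1 T2]; split.
  + intros s [y [Hy ->]]; rewrite Cmod_mult, Hc, Rmult_1_l; apply T1; now exists y.
  + intros b Hb; apply T2; intros s [y [Hy ->]]; apply Hb; exists y; split; [exact Hy|].
    now rewrite Cmod_mult, Hc, Rmult_1_l.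
Qed.

Lemma class_F_radial lambda x0 (T : X -> C) (z : C) : g zero = RtoC 1 ->
  class_F lambda F -> norm x0 = 1 -> support_functional x0 T ->
  0 < Cmod z < 1 ->
  1 / 2 - lambda <= fst (1 + radial_deriv2 (vscal z x0) / radial_deriv (vscal z x0))%C.
Proof.
intros g0 [_ [[_ Hinv] HF]] Hn HT Hz.
assert (Nz : z <> 0%C) by (apply Cmod_gt_0; lra).
assert (Hx : norm (vscal z x0) < 1) by (rewrite norm_vscal, Hn; lra).
assert (Nx : vscal z x0 <> zero).
{ intros E; apply (f_equal norm) in E; rewrite norm_vscal, norm_zero, Hn in E; lra. }
assert (HT' := support_functional_rotate z x0 T Nz Hn HT).
specialize (HF _ _ Hx Nx HT').
set (x := vscal z x0) in *.
rewrite (bounded_inverse_product x Hx) in HF; auto.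
2: apply radial_deriv_neq_0; auto.
set (p := (1 + radial_deriv2 x / radial_deriv x)%C) in *.
destruct HT' as [TL [Tx _]].
set (T' := fun y => (RtoC (Cmod z) / z * T y)%C).
change (T' x = RtoC (norm x)) in Tx.
change (Re (T' (vscal (RtoC (/ norm x)) (vscal p x))) >= 1 / 2 - lambda) in HF.
assert (Px : 0 < norm x) by (unfold x; rewrite norm_vscal, Hn; lra).
rewrite (Clinear_scal T'), (Clinear_scal T'), Tx in HF by exact TL.
replace (RtoC (/ norm x) * (p * RtoC (norm x)))%C with p in HF.
- apply Rge_le; exact HF.
- rewrite RtoC_inv by lra; field; apply RtoC_neq_0; lra.
Qed.

(** At the origin with equal arguments [D^2 F] and [D^3 F] are [2 dg x0] and [3 B x0 x0] times [x0];
    division by the factorials leaves the factors 1 and 1/2. *)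
Lemma support_functional_coefA x0 (T : X -> C) : norm x0 = 1 -> support_functional x0 T ->
  coefA 2 F x0 T = dg zero x0 /\ coefA 3 F x0 T = (B zero x0 x0 / 2)%C.
Proof.
intros Hn [TL [Tx _]].
assert (H0 : norm (zero : X) < 1) by (rewrite norm_zero; lra).
unfold coefA; simpl repeat.
rewrite (frechet_D2_product g dg B F), (frechet_D3_product_0 g dg B F) by assumption.
rewrite vscal_zero, vadd0, !(Clinear_plus T), !(Clinear_scal T), Tx, Hn by exact TL.
split; [replace (INR (fact 2)) with 2 by (simpl; ring)|
  replace (INR (fact 3)) with 6 by (simpl; ring)].
- field.
- replace (RtoC 6) with (2 + 2 + 2)%C by (rewrite <- !RtoC_plus; f_equal; ring); field.
Qed.

Definition slice1 x0 (z : C) : C := dg (vscal z x0) x0.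
Definition slice2 x0 (z : C) : C := B (vscal z x0) x0 x0.

Lemma slice_in_ball x0 (z : C) : norm x0 = 1 -> Cmod z < 1 -> norm (vscal z x0) < 1.
Proof. intros Hn Hz; rewrite norm_vscal, Hn; lra. Qed.

Lemma slice_Cder0 x0 z : norm (vscal z x0) < 1 ->
  Cder (fun w => g (vscal w x0)) z (slice1 x0 z).
Proof.
intros Hz; apply Fder_line, (data (vscal z x0) Hz).
Qed.

Lemma slice_Cder1 x0 z : norm (vscal z x0) < 1 ->
  Cder (slice1 x0) z (slice2 x0 z).
Proof.
intros Hz; apply (Fder_line (fun y => dg y x0) x0 z (fun k => B (vscal z x0) k x0)).
exact (second_order_Fder _ _ _ _ x0 (data _ Hz)).
Qed.

(** On a slice one more derivative comes from applying the second-order theorem to the scalar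
    function [y => dg y x0], which is holomorphic itself. *)
Lemma slice_Cder2 x0 z : norm (vscal z x0) < 1 ->
  exists l, Cder (slice2 x0) z l.
Proof.
intros Hz.
destruct (second_order_data_exists (fun y => dg y x0) (fun y k => B y k x0)) as [B2 H2].
- intros x Hx; exact (second_order_Fder _ _ _ _ x0 (data x Hx)).
- eexists; apply (Fder_line (fun y => B y x0 x0) x0 z (fun k => B2 (vscal z x0) k x0)).
  exact (second_order_Fder _ _ _ _ x0 (H2 _ Hz)).
Qed.

Lemma radial_deriv_slice x0 z : norm (vscal z x0) < 1 ->
  radial_deriv (vscal z x0) = (g (vscal z x0) + z * slice1 x0 z)%C.
Proof.
intros Hz; unfold radial_deriv, slice1.
now rewrite (Clinear_scal _ _ _ (proj1 (proj1 (data _ Hz)))).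
Qed.

Lemma radial_deriv2_slice x0 z : norm (vscal z x0) < 1 ->
  radial_deriv2 (vscal z x0) = (z * (2 * slice1 x0 z + z * slice2 x0 z))%C.
Proof.
intros Hz; unfold radial_deriv2, slice1, slice2.
destruct (data _ Hz) as [D [S [LB _]]].
rewrite (Clinear_scal _ _ _ (proj1 D)), (Clinear_scal _ _ _ (LB _)), S.
rewrite (Clinear_scal _ _ _ (LB _)); ring.
Qed.

Lemma radial_deriv_slice_Cder x0 z : norm (vscal z x0) < 1 ->
  Cder (fun w => g (vscal w x0) + w * slice1 x0 w)%C z
    (2 * slice1 x0 z + z * slice2 x0 z)%C.
Proof.
intros Hz.
replace (2 * slice1 x0 z + z * slice2 x0 z)%C
  with (slice1 x0 z + (1 * slice1 x0 z + z * slice2 x0 z))%C by ring.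
apply Cder_plus; [now apply slice_Cder0|].
apply Cder_mult; [apply Cder_id|now apply slice_Cder1].
Qed.

(** The quotient [f'' / f'] of the slice function, which begins [2 A_2 + (6 A_3 - 4 A_2^2) z]. *)
Definition slice_quotient x0 z : C :=
  ((2 * slice1 x0 z + z * slice2 x0 z) / (g (vscal z x0) + z * slice1 x0 z))%C.

Lemma slice_quotient_Cder x0 : norm x0 = 1 -> g zero = RtoC 1 ->
  (forall x, norm x < 1 -> radial_deriv x <> 0%C) ->
  (forall z, Cmod z < 1 -> exists l, Cder (slice_quotient x0) z l) /\
  slice_quotient x0 0%C = (2 * dg zero x0)%C /\
  Cder (slice_quotient x0) 0%C
    (3 * B zero x0 x0 - 4 * (dg zero x0 * dg zero x0))%C.
Proof.
intros Hn g0 N.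
assert (K : forall z, Cmod z < 1 -> forall l, Cder (slice2 x0) z l ->
  Cder (slice_quotient x0) z
  (((2 * slice2 x0 z + (1 * slice2 x0 z + z * l)) * (g (vscal z x0) + z * slice1 x0 z)
   - (2 * slice1 x0 z + z * slice2 x0 z) * (2 * slice1 x0 z + z * slice2 x0 z))
   / ((g (vscal z x0) + z * slice1 x0 z) * (g (vscal z x0) + z * slice1 x0 z)))%C).
{ intros z Hz l Hl.
  apply (Cder_div (fun z => 2 * slice1 x0 z + z * slice2 x0 z)%C
    (fun z => g (vscal z x0) + z * slice1 x0 z)%C).
  - apply Cder_plus; [now apply Cder_scal, slice_Cder1, slice_in_ball|].
    apply Cder_mult; [apply Cder_id|exact Hl].
  - now apply radial_deriv_slice_Cder, slice_in_ball.
  - rewrite <- radial_deriv_slice by (now apply slice_in_ball); now apply N, slice_in_ball. }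
assert (H0 : Cmod 0%C < 1) by (rewrite Cmod_0; lra).
split; [|split].
- intros z Hz; destruct (slice_Cder2 x0 z (slice_in_ball x0 z Hn Hz)) as [l Hl]; eexists; exact (K z Hz l Hl).
- unfold slice_quotient, slice1; rewrite vscal0, g0; field.
- destruct (slice_Cder2 x0 0%C (slice_in_ball x0 0%C Hn H0)) as [l Hl]; specialize (K 0%C H0 l Hl).
  assert (E1 : slice1 x0 0%C = dg zero x0) by (unfold slice1; now rewrite vscal0).
  assert (E2 : slice2 x0 0%C = B zero x0 x0) by (unfold slice2; now rewrite vscal0).
  rewrite E1, E2, vscal0, g0 in K.
  match type of K with Cder _ _ ?e =>
    replace (3 * B zero x0 x0 - 4 * (dg zero x0 * dg zero x0))%C with e end; [exact K|].
  field.
Qed.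

Theorem T31_bounds lambda x0 (T : X -> C) : 1 / 2 <= lambda <= 1 -> g zero = RtoC 1 ->
  class_F lambda F -> norm x0 = 1 -> support_functional x0 T ->
  T31_lower lambda <= T31 F x0 T <= T31_upper lambda.
Proof.
intros Hl g0 HF Hn HT.
assert (N : forall x, norm x < 1 -> radial_deriv x <> 0%C).
{ intros x Hx; apply radial_deriv_neq_0; auto; now apply HF. }
destruct (slice_quotient_Cder x0 Hn g0 N) as [Q1 [Q2 Q3]].
destruct (support_functional_coefA x0 T Hn HT) as [A2 A3].
unfold T31; rewrite A2, A3, toeplitz3E.
set (a := dg zero x0) in *; set (b := B zero x0 x0) in *.
set (mu := lambda + 1 / 2).
assert (Nm : RtoC mu <> 0%C) by (apply RtoC_neq_0; unfold mu; lra).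
apply toeplitz_bounds; [exact Hl|]; fold mu.
replace (6 * (b / 2) - 4 * (a * a))%C with (3 * b - 4 * (a * a))%C by field.
apply (caratheodory_second_coefficient (fun z => slice_quotient x0 z / RtoC mu)%C).
- intros z Hz; destruct (Q1 z Hz) as [l Hl']; eexists.
  apply Cder_div; [exact Hl'|apply Cder_const|exact Nm].
- now rewrite Q2.
- replace ((3 * b - 4 * (a * a)) / RtoC mu)%C with
    (((3 * b - 4 * (a * a)) * RtoC mu - slice_quotient x0 0%C * 0) / (RtoC mu * RtoC mu))%C
    by (field; exact Nm).
  apply (Cder_div (slice_quotient x0) (fun _ => RtoC mu));
    [exact Q3|apply Cder_const|exact Nm].
- intros z Hz.
  assert (K := class_F_radial lambda x0 T z g0 HF Hn HT Hz).
  rewrite radial_deriv_slice, radial_deriv2_slice in K by (apply slice_in_ball; auto; lra).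
  replace (1 + z * (slice_quotient x0 z / RtoC mu))%C with
    (RtoC (/ mu) * (RtoC (mu - 1) + (1 + z * (2 * slice1 x0 z + z * slice2 x0 z) /
      (g (vscal z x0) + z * slice1 x0 z))))%C.
  + set (p := (1 + _)%C) in K |- *.
    assert (E : fst (RtoC (/ mu) * (RtoC (mu - 1) + p))%C = / mu * (mu - 1 + fst p))
      by (unfold Cmult, Cplus, RtoC; simpl; ring).
    rewrite E; apply Rmult_le_pos; [left; apply Rinv_0_lt_compat; unfold mu; lra|].
    unfold mu; lra.
  + unfold slice_quotient; rewrite RtoC_inv, RtoC_minus by (unfold mu; lra).
    field; split; [|exact Nm].
    rewrite <- radial_deriv_slice by (apply slice_in_ball; auto; lra); apply N, slice_in_ball; auto; lra.
Qed.

End Product.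
End Slices.

(** * Support functionals *)

Lemma zorn_preorder (T : Type) (t0 : T) (le : T -> T -> Prop) :
  (forall t, le t t) -> (forall r s t, le r s -> le s t -> le r t) ->
  (forall A : T -> Prop, (forall s t, A s -> A t -> le s t \/ le t s) ->
     exists t, forall s, A s -> le s t) ->
  exists t, forall s, le t s -> le s t.
Proof.
intros Hr Ht Hc.
destruct (@classical_sets.ZL_preorder T t0 (fun x y => boolp.asbool (le x y))) as [t H].
- intros t; now apply boolp.asboolT.
- intros r s t H1 H2; apply boolp.asboolT.
  exact (Ht _ _ _ (boolp.asboolW H1) (boolp.asboolW H2)).
- intros A HA; destruct (Hc A) as [t H].
  + intros s t Hs Ht'; destruct (HA s t Hs Ht') as [H|H]; [left|right];
      exact (boolp.asboolW H).
  + exists t; intros s Hs; apply boolp.asboolT, H, Hs.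
- exists t; intros s Hs; apply (fun K => boolp.asboolW (H s K)).
  now apply boolp.asboolT.
Qed.

Definition is_inf (E : R -> Prop) (m : R) : Prop :=
  (forall x, E x -> m <= x) /\ forall b, (forall x, E x -> b <= x) -> b <= m.

Lemma is_inf_exists (E : R -> Prop) (b : R) :
  (exists x, E x) -> (forall x, E x -> b <= x) -> exists m, is_inf E m.
Proof.
intros [x0 H0] Hb.
destruct (completeness (fun x => E (- x))) as [m [M1 M2]].
- exists (- b); intros x Hx; specialize (Hb _ Hx); lra.
- exists (- x0); change (E (- - x0)); now rewrite Ropp_involutive.
- exists (- m); split.
  + intros x Hx; enough (- x <= m) by lra.
    apply M1; change (E (- - x)); now rewrite Ropp_involutive.
  + intros c Hc; enough (m <= - c) by lra; apply M2; intros x Hx.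
    specialize (Hc _ Hx); lra.
Qed.

Definition inf_of (E : R -> Prop) : R := epsilon (inhabits 0) (is_inf E).

Lemma inf_of_spec (E : R -> Prop) (b : R) :
  (exists x, E x) -> (forall x, E x -> b <= x) -> is_inf E (inf_of E).
Proof.
intros H1 H2.
exact (epsilon_spec (inhabits 0) (is_inf E) (is_inf_exists E b H1 H2)).
Qed.

Section HahnBanach.
Context {X : NormedModule C_AbsRing}.
Implicit Types (x y a : X) (p : X -> R).

(** The Hahn-Banach argument runs over sublinear functionals on all of [X]: a minimal one is
    real-linear, so no partially defined functional has to be extended. *)
Definition sublinear p : Prop :=
  (forall x y, p (vadd x y) <= p x + p y) /\
  (forall t x, 0 < t -> p (vscal (RtoC t) x) <= t * p x).

Definition vopp x : X := vscal (Copp (RtoC 1)) x.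

Lemma sublinear_scal p t x : sublinear p -> 0 < t -> p (vscal (RtoC t) x) = t * p x.
Proof.
intros [_ H] Ht; apply Rle_antisym; [now apply H|].
assert (K := H (/ t) (vscal (RtoC t) x) (Rinv_0_lt_compat _ Ht)).
rewrite vscalA, <- RtoC_mult, Rinv_l, vscal1 in K by lra.
apply Rmult_le_compat_l with (r := t) in K; [|lra].
rewrite <- Rmult_assoc, Rinv_r, Rmult_1_l in K; lra.
Qed.

Lemma sublinear_zero p : sublinear p -> p zero = 0.
Proof.
intros H; assert (K := sublinear_scal p 2 zero H ltac:(lra)).
rewrite vscal_zero in K; lra.
Qed.

Lemma vadd_vopp x : vadd x (vopp x) = zero.
Proof. unfold vopp; vring x x x. Qed.

Lemma sublinear_opp p x : sublinear p -> 0 <= p x + p (vopp x).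
Proof.
intros H; rewrite <- (sublinear_zero p H), <- (vadd_vopp x); apply H.
Qed.

Lemma sublinear_scal0 p t x : sublinear p -> 0 <= t -> p (vscal (RtoC t) x) = t * p x.
Proof.
intros H [Ht|<-]; [now apply sublinear_scal|].
now rewrite vscal0, sublinear_zero, Rmult_0_l.
Qed.

Lemma sublinear_norm : sublinear norm.
Proof.
split; [apply norm_vadd|]; intros t x Ht; now rewrite norm_vscal_R by exact Ht; right.
Qed.

(* The largest sublinear functional below p that is at most - p a at - a. *)
Definition sublinear_shift p a x : R :=
  inf_of (fun r => exists t, 0 <= t /\ r = p (vadd x (vscal (RtoC t) a)) - t * p a).

Lemma sublinear_shift_spec p a x : sublinear p ->
  is_inf (fun r => exists t, 0 <= t /\ r = p (vadd x (vscal (RtoC t) a)) - t * p a)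
    (sublinear_shift p a x).
Proof.
intros H; apply (inf_of_spec _ (- p (vopp x))).
- eexists; exists 0; split; [lra|reflexivity].
- intros r [t [Ht ->]]; rewrite <- (sublinear_scal0 p t a H Ht).
  assert (K := proj1 H (vadd x (vscal (RtoC t) a)) (vopp x)).
  replace (vadd (vadd x (vscal (RtoC t) a)) (vopp x)) with (vscal (RtoC t) a) in K
    by (unfold vopp; vring x a a); lra.
Qed.

Lemma sublinear_shift_le p a x t : sublinear p -> 0 <= t ->
  sublinear_shift p a x <= p (vadd x (vscal (RtoC t) a)) - t * p a.
Proof. intros H Ht; apply (proj1 (sublinear_shift_spec p a x H)); now exists t. Qed.

Lemma sublinear_shift_le_self p a x : sublinear p -> sublinear_shift p a x <= p x.
Proof.
intros H; eapply Rle_trans; [apply (sublinear_shift_le p a x 0 H); lra|].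
rewrite vscal0, vadd0; lra.
Qed.

Lemma sublinear_shift_opp p a : sublinear p -> sublinear_shift p a (vopp a) <= - p a.
Proof.
intros H; eapply Rle_trans; [apply (sublinear_shift_le p a _ 1 H); lra|].
rewrite vscal1, vaddC, vadd_vopp, (sublinear_zero p H); lra.
Qed.

Lemma sublinear_shift_sublinear p a : sublinear p -> sublinear (sublinear_shift p a).
Proof.
intros H; split.
- intros x y.
  assert (K : forall s t, 0 <= s -> 0 <= t -> sublinear_shift p a (vadd x y) <=
    (p (vadd x (vscal (RtoC s) a)) - s * p a) + (p (vadd y (vscal (RtoC t) a)) - t * p a)).
  { intros s t Hs Ht.
    eapply Rle_trans; [apply (sublinear_shift_le p a _ (s + t) H); lra|].
    assert (A := proj1 H (vadd x (vscal (RtoC s) a)) (vadd y (vscal (RtoC t) a))).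
    rewrite vaddACA, <- vscalDl, <- RtoC_plus in A; lra. }
  assert (K2 : sublinear_shift p a (vadd x y) - sublinear_shift p a y <= sublinear_shift p a x).
  { apply (proj2 (sublinear_shift_spec p a x H)); intros r [s [Hs ->]].
    enough (sublinear_shift p a (vadd x y) - (p (vadd x (vscal (RtoC s) a)) - s * p a)
      <= sublinear_shift p a y) by lra.
    apply (proj2 (sublinear_shift_spec p a y H)); intros r [t [Ht ->]].
    specialize (K s t Hs Ht); lra. }
  lra.
- intros r x Hr.
  enough (sublinear_shift p a (vscal (RtoC r) x) / r <= sublinear_shift p a x).
  { apply Rmult_le_compat_l with (r := r) in H0; [|lra].
    replace (r * (sublinear_shift p a (vscal (RtoC r) x) / r))
      with (sublinear_shift p a (vscal (RtoC r) x)) in H0 by (field; lra); exact H0. }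
  apply (proj2 (sublinear_shift_spec p a x H)); intros q [t [Ht ->]].
  apply Rmult_le_reg_l with r; [exact Hr|].
  replace (r * (sublinear_shift p a (vscal (RtoC r) x) / r))
      with (sublinear_shift p a (vscal (RtoC r) x)) by (field; lra).
  eapply Rle_trans; [apply (sublinear_shift_le p a _ (r * t) H); nra|].
  replace (vadd (vscal (RtoC r) x) (vscal (RtoC (r * t)) a))
    with (vscal (RtoC r) (vadd x (vscal (RtoC t) a)))
    by (rewrite RtoC_mult; vring x a a).
  rewrite (sublinear_scal p r) by assumption; right; ring.
Qed.

(** Zorn's lemma for the reversed order. The pointwise infimum of a chain is finite, since its
    members stay above [- p (- x)], and subadditive, since any two members are comparable. *)
Lemma minimal_sublinear_exists p : sublinear p ->
  exists f, sublinear f /\ (forall x, f x <= p x) /\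
    forall q, sublinear q -> (forall x, q x <= f x) -> forall x, f x <= q x.
Proof.
intros H.
set (S := {f : X -> R | sublinear f /\ forall x, f x <= p x}).
set (s0 := exist _ p (conj H (fun x => Rle_refl (p x))) : S).
destruct (zorn_preorder S s0 (fun f g => forall x, proj1_sig g x <= proj1_sig f x))
  as [[f [F1 F2]] Hf].
- intros t x; lra.
- intros r s t H1 H2 x; eapply Rle_trans; [apply H2|apply H1].
- intros A Htot.
  destruct (excluded_middle_informative (exists f, A f)) as [[f0 Hf0]|N];
    [|exists s0; intros s Hs; exfalso; apply N; now exists s].
  set (E := fun x r => exists f, A f /\ r = proj1_sig f x).
  set (m := fun x => inf_of (E x)).
  assert (Hm : forall x, is_inf (E x) (m x)).
  { intros x; apply (inf_of_spec _ (- p (vopp x))).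
    - now exists (proj1_sig f0 x), f0.
    - intros r [[f [Hf1 Hf2]] [_ ->]]; simpl.
      assert (K := sublinear_opp f x Hf1); specialize (Hf2 (vopp x)); lra. }
  assert (Hle : forall f x, A f -> m x <= proj1_sig f x)
    by (intros f x HA; apply (proj1 (Hm x)); now exists f).
  assert (Hms : sublinear m /\ forall x, m x <= p x).
  { split; [split|].
    - intros x y.
      enough (m (vadd x y) - m y <= m x) by lra.
      apply (proj2 (Hm x)); intros r [f [Hf ->]].
      enough (m (vadd x y) - proj1_sig f x <= m y) by lra.
      apply (proj2 (Hm y)); intros r [h [Hh ->]].
      destruct (Htot f h Hf Hh) as [L|L].
      + assert (K1 := Hle h (vadd x y) Hh).
        assert (K2 := proj1 (proj1 (proj2_sig h)) x y); specialize (L x); lra.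
      + assert (K1 := Hle f (vadd x y) Hf).
        assert (K2 := proj1 (proj1 (proj2_sig f)) x y); specialize (L y); lra.
    - intros t x Ht.
      enough (m (vscal (RtoC t) x) / t <= m x).
      { apply Rmult_le_compat_l with (r := t) in H0; [|lra].
        replace (t * (m (vscal (RtoC t) x) / t)) with (m (vscal (RtoC t) x)) in H0
          by (field; lra); exact H0. }
      apply (proj2 (Hm x)); intros r [f [Hf ->]].
      apply Rmult_le_reg_l with t; [exact Ht|].
      replace (t * (m (vscal (RtoC t) x) / t)) with (m (vscal (RtoC t) x)) by (field; lra).
      eapply Rle_trans; [apply (Hle f), Hf|].
      now apply (proj2 (proj1 (proj2_sig f))).
    - intros x; eapply Rle_trans; [apply (Hle f0), Hf0|apply (proj2 (proj2_sig f0))]. }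
  exists (exist _ m Hms); intros s Hs x; simpl; now apply Hle.
- exists f; split; [exact F1|]; split; [exact F2|].
  intros q Hq Hqf.
  assert (Hqp : forall x, q x <= p x)
    by (intros x; eapply Rle_trans; [apply Hqf|apply F2]).
  exact (Hf (exist _ q (conj Hq Hqp)) Hqf).
Qed.

(** By minimality [f] lies below its own shift at [a], so [f (- a) <= - f a]. Thus [f] is odd, and
    an odd subadditive function is additive. *)
Lemma minimal_sublinear_additive f : sublinear f ->
  (forall q, sublinear q -> (forall x, q x <= f x) -> forall x, f x <= q x) ->
  forall x y, f (vadd x y) = f x + f y.
Proof.
intros H Hmin.
assert (Hopp : forall a, f (vopp a) = - f a).
{ intros a; assert (K := sublinear_opp f a H).
  assert (K2 := Hmin _ (sublinear_shift_sublinear f a H)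
    (fun x => sublinear_shift_le_self f a x H) (vopp a)).
  assert (K3 := sublinear_shift_opp f a H); lra. }
intros x y; apply Rle_antisym; [apply H|].
assert (K := proj1 H (vadd x y) (vopp y)); rewrite Hopp in K.
replace (vadd (vadd x y) (vopp y)) with x in K by (unfold vopp; vring x y y); lra.
Qed.

Theorem support_functional_exists x0 : norm x0 = 1 ->
  exists T : X -> C, support_functional x0 T.
Proof.
intros Hn.
(* Starting from the norm shifted at [x0] forces [f (- x0) <= - 1], that is [f x0 >= 1]. *)
assert (Hs := sublinear_shift_sublinear norm x0 sublinear_norm).
destruct (minimal_sublinear_exists _ Hs) as [f [F1 [F2 F3]]].
assert (FD := minimal_sublinear_additive f F1 F3).
assert (F0 := sublinear_zero f F1).
assert (FN : forall x, f (vopp x) = - f x).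
{ intros x; assert (K := FD x (vopp x)); rewrite vadd_vopp, F0 in K; lra. }
assert (FZ : forall t x, f (vscal (RtoC t) x) = t * f x).
{ intros t x; destruct (Rle_dec 0 t) as [Ht|Ht]; [now apply sublinear_scal0|].
  assert (K := sublinear_scal0 f (- t) x F1 ltac:(lra)).
  replace (vscal (RtoC (- t)) x) with (vopp (vscal (RtoC t) x)) in K
    by (unfold vopp; rewrite RtoC_opp; vring x x x).
  rewrite FN in K; lra. }
assert (Fle : forall x, f x <= norm x).
{ intros x; eapply Rle_trans; [apply F2|].
  apply sublinear_shift_le_self, sublinear_norm. }
assert (Fx0 : 1 <= f x0).
{ assert (K := F2 (vopp x0)); rewrite FN in K.
  assert (K2 := sublinear_shift_opp norm x0 sublinear_norm); rewrite Hn in K2; lra. }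
(* The complex functional [f x - i f(i x)] with real part [f]. *)
set (T := fun x => (f x, - f (vscal Ci x))).
assert (TD : forall x y, T (vadd x y) = (T x + T y)%C).
{ intros x y; unfold T; rewrite vscalDr, !FD; unfold Cplus; simpl; f_equal; ring. }
assert (TZ : forall (c : C) x, T (vscal c x) = (c * T x)%C).
{ intros [u v] x; unfold T.
  assert (E1 : vscal (u, v) x = vadd (vscal (RtoC u) x) (vscal (RtoC v) (vscal Ci x))).
  { rewrite vscalA, <- vscalDl; f_equal.
    unfold Ci, RtoC, Cplus, Cmult; simpl; f_equal; ring. }
  assert (E2 : vscal Ci (vscal (u, v) x) =
    vadd (vscal (RtoC (- v)) x) (vscal (RtoC u) (vscal Ci x))).
  { rewrite !vscalA, <- vscalDl; f_equal.
    unfold Ci, RtoC, Cplus, Cmult; simpl; f_equal; ring. }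
  rewrite E2, E1, !FD, !FZ; unfold Cmult; simpl; f_equal; ring. }
assert (TB : forall x, Cmod (T x) <= norm x).
{ intros x; destruct (C_unimodular_rotation (T x)) as [u [U1 U2]].
  rewrite <- TZ in U2; apply (f_equal fst) in U2; simpl in U2; rewrite <- U2.
  eapply Rle_trans; [apply Fle|]; rewrite norm_vscal, U1; lra. }
(* A number of modulus at most 1 with real part 1 has imaginary part 0. *)
assert (Tx0 : T x0 = RtoC 1).
{ assert (K := TB x0); rewrite Hn in K.
  assert (K1 : fst (T x0) = f x0) by reflexivity.
  assert (K2 := Fle x0); rewrite Hn in K2.
  assert (K3 : Cmod (T x0) ^ 2 = fst (T x0) ^ 2 + snd (T x0) ^ 2)
    by (apply pow2_sqrt; nra).
  assert (K4 := Cmod_ge_0 (T x0)).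
  assert (Ef : f x0 = 1) by lra.
  assert (Es : snd (T x0) = 0) by (rewrite K1, Ef in K3; nra).
  rewrite (surjective_pairing (T x0)), K1, Es, Ef; reflexivity. }
exists T; split; [|split].
- apply (Clinear_intro _ 1); auto; intros x; rewrite Rmult_1_l; apply TB.
- now rewrite Tx0, Hn.
- split.
  + intros s [y [Hy ->]]; eapply Rle_trans; [apply TB|exact Hy].
  + intros b Hb; apply Hb; exists x0; split; [lra|]; now rewrite Tx0, Cmod_1.
Qed.
End HahnBanach.

(** * Extremal maps *)

Lemma Ccts_of_continuous (f : C -> C) (z : C) :
  continuous (T := prod_UniformSpace R_UniformSpace R_UniformSpace) (U := R_UniformSpace)
    (fun w => fst (f w)) z ->
  continuous (T := prod_UniformSpace R_UniformSpace R_UniformSpace) (U := R_UniformSpace)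
    (fun w => snd (f w)) z -> Ccts f z.
Proof.
intros H1 H2 eps He.
assert (He2 : 0 < eps / 2) by lra.
specialize (H1 _ (locally_ball (fst (f z)) (mkposreal _ He2))).
specialize (H2 _ (locally_ball (snd (f z)) (mkposreal _ He2))).
destruct H1 as [d1 K1]; destruct H2 as [d2 K2].
exists (Rmin d1 d2); split; [apply Rmin_glb_lt; apply cond_pos|].
intros w Hw; assert (A := re_le_Cmod (w - z)%C); assert (B := im_le_Cmod (w - z)%C).
assert (M1 := Rmin_l d1 d2); assert (M2 := Rmin_r d1 d2).
assert (B1 : Rabs (fst (f w) - fst (f z)) < eps / 2)
  by (apply (K1 w); split; eapply Rle_lt_trans; try eassumption; lra).
assert (B2 : Rabs (snd (f w) - snd (f z)) < eps / 2)
  by (apply (K2 w); split; eapply Rle_lt_trans; try eassumption; lra).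
eapply Rle_lt_trans; [apply Cmod_le_abs|]; simpl; unfold Rminus in *; lra.
Qed.

(* A logarithm only where the real part is positive. *)
Definition Clog (z : C) : C := (ln (Cmod z), atan (snd z / fst z)).

Lemma Cexp_Clog (z : C) : 0 < fst z -> Cexp (Clog z) = z.
Proof.
destruct z as [x y]; simpl; intros Hx.
assert (P : 0 < Cmod (x, y)).
{ apply Cmod_gt_0; intros E; apply (f_equal fst) in E; simpl in E; lra. }
unfold Cexp, Clog; simpl; rewrite exp_ln by exact P.
rewrite cos_atan, sin_atan.
assert (E : sqrt (1 + (y / x)²) = Cmod (x, y) / x).
{ unfold Cmod; simpl.
  replace (x * (x * 1) + y * (y * 1)) with ((1 + (y / x)²) * x ^ 2) by (unfold Rsqr; field; lra).
  rewrite sqrt_mult by (try apply pow2_ge_0; assert (A := Rle_0_sqr (y / x)); lra).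
  rewrite sqrt_pow2 by lra; field; lra. }
rewrite E; f_equal; field; lra.
Qed.

Lemma Clog_im (z : C) : - PI / 2 < snd (Clog z) < PI / 2.
Proof. simpl; assert (K := atan_bound (snd z / fst z)); lra. Qed.

Lemma Ccts_Clog (z : C) : 0 < fst z -> Ccts Clog z.
Proof.
intros Hz; apply Ccts_of_continuous; unfold Clog; simpl.
- apply (continuous_comp (V := R_UniformSpace) (fun w : C => Cmod w) ln).
  + apply (continuous_comp (V := R_UniformSpace)
      (fun w : C => fst w ^ 2 + snd w ^ 2) sqrt).
    * apply (continuous_plus (V := R_NormedModule) (fun w : C => fst w ^ 2) (fun w : C => snd w ^ 2)).
      -- apply (continuous_comp (V := R_UniformSpace) fst (fun x => x ^ 2)); [apply continuous_fst|].
         apply (ex_derive_continuous (V := R_NormedModule)); auto_derive; auto.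
      -- apply (continuous_comp (V := R_UniformSpace) snd (fun x => x ^ 2)); [apply continuous_snd|].
         apply (ex_derive_continuous (V := R_NormedModule)); auto_derive; auto.
    * apply continuous_sqrt.
  + apply (ex_derive_continuous (V := R_NormedModule)); auto_derive.
    apply Cmod_gt_0; intros E; rewrite E in Hz; simpl in Hz; lra.
- apply (continuous_comp (V := R_UniformSpace) (fun w : C => snd w / fst w) atan).
  + apply (continuous_mult (K := R_AbsRing) (fun w : C => snd w) (fun w : C => / fst w)).
    * apply continuous_snd.
    * apply (continuous_comp (V := R_UniformSpace) fst Rinv); [apply continuous_fst|].
      apply (ex_derive_continuous (V := R_NormedModule)); auto_derive; apply Rgt_not_eq, Hz.
  + apply (ex_derive_continuous (V := R_NormedModule)); auto_derive; auto.
Qed.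

Lemma re_pos_near (z : C) : 0 < fst z -> forall w, Cmod (w - z)%C < fst z -> 0 < fst w.
Proof.
intros Hz w Hw; assert (A := re_le_Cmod (w - z)%C).
apply Rle_lt_trans with (2 := Hw) in A; apply Rabs_def2 in A; simpl in A; lra.
Qed.

(** The slope [Q] of [Cexp] at [Clog z] satisfies [w - z = Q (Clog w) * (Clog w - Clog z)]; its
    reciprocal is a slope of [Clog], so only continuity of [Clog] is needed beforehand. *)
Lemma Cder_Clog (z : C) : 0 < fst z -> Cder Clog z (/ z)%C.
Proof.
intros Hz.
assert (Nz : z <> 0%C) by (intros E; rewrite E in Hz; simpl in Hz; lra).
destruct (Cder_slope _ _ _ (Cder_Cexp (Clog z))) as [Q [Q1 [Q2 Q3]]].
rewrite Cexp_Clog in Q2 by exact Hz.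
assert (CQ : Ccts (fun w => Q (Clog w)) z)
  by (apply (Ccts_comp Clog Q); [now apply Ccts_Clog|exact Q1]).
destruct (CQ (Cmod z)) as [d [Hd K]]; [now apply Cmod_gt_0|].
assert (NQ : forall w, Cmod (w - z) < d -> Q (Clog w) <> 0%C).
{ intros w Hw E; specialize (K w Hw); rewrite E, Q2 in K.
  replace (0 - z)%C with (- z)%C in K by ring; rewrite Cmod_opp in K; lra. }
apply (Cder_ext_loc (fun w => Clog z + / Q (Clog w) * (w - z))%C _ _ _ (Rmin d (fst z))).
- apply Rmin_glb_lt; assumption.
- intros w Hw; assert (N := NQ w (Rlt_le_trans _ _ _ Hw (Rmin_l _ _))).
  assert (Pw := re_pos_near z Hz w (Rlt_le_trans _ _ _ Hw (Rmin_r _ _))).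
  specialize (Q3 (Clog w)); rewrite !Cexp_Clog in Q3 by assumption.
  assert (E : (w - z = Q (Clog w) * (Clog w - Clog z))%C).
  { transitivity (z + Q (Clog w) * (Clog w - Clog z) - z)%C; [now rewrite <- Q3|ring]. }
  rewrite E; field; exact N.
- apply (slope_Cder _ (fun w => / Q (Clog w))%C).
  + apply (Ccts_inv (fun w => Q (Clog w))); [exact CQ|now rewrite Q2].
  + now rewrite Q2.
  + intros w; ring.
Qed.

Section ExtremalDerivative.
Variables (e : C) (mu : R).
Hypothesis (He : Cmod e = 1) (Hmu : 1 <= mu <= 3 / 2).

Lemma one_minus_re_pos (u z : C) : Cmod u = 1 -> Cmod z < 1 -> 1 - Cmod z <= fst (1 - u * z)%C.
Proof.
intros Hu Hz; assert (A := re_le_Cmod (u * z)); rewrite Cmod_mult, Hu, Rmult_1_l in A.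
assert (B := Rle_abs (fst (u * z)%C)); unfold Cminus, Cplus, Copp; simpl in *; lra.
Qed.

Lemma Cmod_conj_e : Cmod (Cconj e) = 1.
Proof. now rewrite Cmod_conj. Qed.

Lemma e_conj_e : (e * Cconj e = 1)%C.
Proof. rewrite Cmult_conj, He; f_equal; ring. Qed.

(** For unimodular [e] this is [1 - 2 c z + z^2] with [c = Re e]. It stays factored because each
    factor has positive real part, as [Clog] demands, while the product need not. *)
Definition quad (z : C) : C := ((1 - e * z) * (1 - Cconj e * z))%C.

Definition log_quad (z : C) : C := (Clog (1 - e * z) + Clog (1 - Cconj e * z))%C.

Definition ext_deriv (z : C) : C := Cexp (RtoC (- mu) * log_quad z)%C.

Definition ext_logderiv (z : C) : C :=
  (RtoC mu * (e / (1 - e * z) + Cconj e / (1 - Cconj e * z)))%C.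

Lemma factor_neq_0 (u z : C) : Cmod u = 1 -> Cmod z < 1 -> (1 - u * z <> 0)%C.
Proof.
intros Hu Hz E; assert (K := one_minus_re_pos u z Hu Hz); rewrite E in K.
simpl in K; lra.
Qed.

Lemma log_factor_Cder (u z : C) : Cmod u = 1 -> Cmod z < 1 ->
  Cder (fun w => Clog (1 - u * w))%C z (- u / (1 - u * z))%C.
Proof.
intros Hu Hz.
replace (- u / (1 - u * z))%C with (/ (1 - u * z) * (0 - u * 1))%C
  by (field; now apply factor_neq_0).
apply (Cder_comp (fun w => 1 - u * w)%C Clog).
- apply Cder_minus; [apply Cder_const|apply Cder_scal, Cder_id].
- apply Cder_Clog; assert (K := one_minus_re_pos u z Hu Hz); lra.
Qed.

Lemma ext_deriv_Cder (z : C) : Cmod z < 1 ->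
  Cder ext_deriv z (ext_deriv z * ext_logderiv z)%C.
Proof.
intros Hz; unfold ext_deriv at 1.
replace (ext_logderiv z) with
  (RtoC (- mu) * (- e / (1 - e * z) + - Cconj e / (1 - Cconj e * z)))%C.
- apply (Cder_comp (fun w => RtoC (- mu) * log_quad w)%C Cexp); [|apply Cder_Cexp].
  apply Cder_scal, Cder_plus; apply log_factor_Cder; auto; apply Cmod_conj_e.
- unfold ext_logderiv; rewrite RtoC_opp; field.
  split; apply factor_neq_0; auto; apply Cmod_conj_e.
Qed.

Lemma ext_logderiv_Cder (z : C) : Cmod z < 1 -> Cder ext_logderiv z
  (RtoC mu * ((0 * (1 - e * z) - e * (0 - e * 1)) / ((1 - e * z) * (1 - e * z)) +
    (0 * (1 - Cconj e * z) - Cconj e * (0 - Cconj e * 1))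
      / ((1 - Cconj e * z) * (1 - Cconj e * z))))%C.
Proof.
intros Hz; apply Cder_scal, Cder_plus.
- apply (Cder_div (fun _ => e) (fun w => 1 - e * w)%C); [apply Cder_const| |now apply factor_neq_0].
  apply Cder_minus; [apply Cder_const|apply Cder_scal, Cder_id].
- apply (Cder_div (fun _ => Cconj e) (fun w => 1 - Cconj e * w)%C); [apply Cder_const| |].
  + apply Cder_minus; [apply Cder_const|apply Cder_scal, Cder_id].
  + apply factor_neq_0; [apply Cmod_conj_e|exact Hz].
Qed.

Lemma Clog_1 : Clog 1%C = 0%C.
Proof.
unfold Clog; rewrite Cmod_1, ln_1; simpl.
replace (0 / 1) with 0 by field; now rewrite atan_0.
Qed.

Lemma ext_deriv_0 : ext_deriv 0%C = 1%C.
Proof.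
unfold ext_deriv, log_quad.
replace (1 - e * 0)%C with (RtoC 1) by ring.
replace (1 - Cconj e * 0)%C with (RtoC 1) by ring.
rewrite Clog_1; replace (RtoC (- mu) * (0 + 0))%C with (RtoC 0) by ring; apply Cexp_0.
Qed.

Lemma ext_deriv_neq_0 z : ext_deriv z <> 0%C.
Proof. apply Cexp_neq_0. Qed.

(** Both factors of [quad] have modulus at least [1 - r]. The bound feeds the Taylor estimate that
    justifies differentiation under the integral sign. *)
Lemma ext_deriv_bound (r : R) (z : C) : r < 1 -> Cmod z <= r ->
  Cmod (ext_deriv z) <= exp (- mu * (2 * ln (1 - r))).
Proof.
intros Hr Hz; unfold ext_deriv; rewrite Cmod_Cexp.
assert (K : forall u, Cmod u = 1 -> ln (1 - r) <= fst (Clog (1 - u * z)%C)).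
{ intros u Hu; simpl fst; apply ln_le; [lra|].
  assert (A := one_minus_re_pos u z Hu ltac:(lra)).
  assert (B := re_le_Cmod (1 - u * z)%C).
  assert (D := Rle_abs (fst (1 - u * z)%C)); lra. }
assert (K1 := K e He); assert (K2 := K _ Cmod_conj_e).
assert (E : fst (RtoC (- mu) * log_quad z)%C =
  - mu * (fst (Clog (1 - e * z)%C) + fst (Clog (1 - Cconj e * z)%C)))
  by (unfold log_quad, Cmult, Cplus, RtoC; simpl; ring).
rewrite E.
assert (L : - mu * (fst (Clog (1 - e * z)%C) + fst (Clog (1 - Cconj e * z)%C))
   <= - mu * (2 * ln (1 - r))) by nra.
destruct L as [L|L]; [left; now apply exp_increasing|rewrite L; lra].
Qed.

(** Multiplied by [|1 - w|^2], the inequality reduces to [|w|^2 <= 1]. *)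
Lemma re_moebius (w : C) : Cmod w < 1 -> - 1 / 2 <= fst (w / (1 - w))%C.
Proof.
intros Hw.
assert (N : (1 - w <> 0)%C).
{ replace (1 - w)%C with (1 - 1 * w)%C by ring; apply factor_neq_0; [apply Cmod_1|exact Hw]. }
assert (P := proj1 (Cmod_gt_0 _) N).
assert (E : (w / (1 - w) = w * Cconj (1 - w) / RtoC (Cmod (1 - w) ^ 2))%C).
{ rewrite <- Cmult_conj; field; split; [|exact N].
  intros E; apply N; rewrite <- (Cconj_involutive (1 - w)), E.
  unfold Cconj, RtoC; simpl; f_equal; ring. }
assert (Q : 0 < Cmod (1 - w) ^ 2) by (apply pow_lt; exact P).
assert (E2 : fst (w / (1 - w))%C = fst (w * Cconj (1 - w))%C / Cmod (1 - w) ^ 2).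
{ rewrite E; generalize dependent (Cmod (1 - w) ^ 2); intros d _ Hd.
  unfold Cdiv; rewrite <- RtoC_inv by lra.
  unfold Cmult, RtoC; simpl; field; lra. }
rewrite E2; apply Rmult_le_reg_r with (Cmod (1 - w) ^ 2); [exact Q|].
unfold Rdiv at 2; rewrite Rmult_assoc, Rinv_l, Rmult_1_r by lra.
assert (F : forall z : C, Cmod z ^ 2 = fst z ^ 2 + snd z ^ 2)
  by (intros z; apply pow2_sqrt; nra).
assert (Hw2 : Cmod w ^ 2 < 1) by (assert (A := Cmod_ge_0 w); nra).
rewrite F in Hw2 |- *; destruct w as [x y].
unfold Cminus, Cplus, Copp, Cconj, Cmult, RtoC; simpl in *; nra.
Qed.

Lemma ext_class (z : C) : Cmod z < 1 -> 1 - mu <= fst (1 + z * ext_logderiv z)%C.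
Proof.
intros Hz.
replace (1 + z * ext_logderiv z)%C with (1 + RtoC mu *
  ((e * z) / (1 - e * z) + (Cconj e * z) / (1 - Cconj e * z)))%C.
- assert (K1 := re_moebius (e * z)%C); assert (K2 := re_moebius (Cconj e * z)%C).
  rewrite Cmod_mult, He, Rmult_1_l in K1; rewrite Cmod_mult, Cmod_conj_e, Rmult_1_l in K2.
  specialize (K1 Hz); specialize (K2 Hz).
  set (p := (e * z / (1 - e * z))%C) in *.
  set (q := (Cconj e * z / (1 - Cconj e * z))%C) in *.
  assert (E : fst (1 + RtoC mu * (p + q))%C = 1 + mu * (fst p + fst q))
    by (clearbody p q; unfold Cplus, Cmult, RtoC; simpl; ring).
  rewrite E; nra.
- unfold ext_logderiv; field; split; apply factor_neq_0; auto; apply Cmod_conj_e.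
Qed.

(** The product is [quad ^ (1 - mu)]. The arguments of the two factors of [quad] add up to less than
    [PI] in absolute value, and [|1 - mu| <= 1 / 2] brings this below [PI / 2]. *)
Lemma ext_close_to_convex (z : C) : Cmod z < 1 -> 0 < fst (ext_deriv z * quad z)%C.
Proof.
intros Hz.
assert (A1 := one_minus_re_pos e z He Hz).
assert (A2 := one_minus_re_pos _ z Cmod_conj_e Hz).
assert (Eq : quad z = Cexp (log_quad z)).
{ unfold quad, log_quad; rewrite Cexp_plus, !Cexp_Clog by lra; reflexivity. }
rewrite Eq; unfold ext_deriv; rewrite <- Cexp_plus.
replace (RtoC (- mu) * log_quad z + log_quad z)%C with (RtoC (1 - mu) * log_quad z)%C
  by (rewrite RtoC_opp, RtoC_minus; ring).
set (w := (RtoC (1 - mu) * log_quad z)%C).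
change (0 < exp (fst w) * cos (snd w)); apply Rmult_lt_0_compat; [apply exp_pos|].
assert (B1 := Clog_im (1 - e * z)%C); assert (B2 := Clog_im (1 - Cconj e * z)%C).
assert (E : snd w =
  (1 - mu) * (snd (Clog (1 - e * z)%C) + snd (Clog (1 - Cconj e * z)%C)))
  by (unfold w, log_quad, Cmult, Cplus, RtoC; simpl; ring).
rewrite E.
set (t := snd (Clog (1 - e * z)%C) + snd (Clog (1 - Cconj e * z)%C)).
assert (Ht : - PI < t < PI) by (unfold t; lra).
assert (Hpi := PI_RGT_0); apply cos_gt_0; nra.
Qed.
End ExtremalDerivative.

(** * Integrals over the unit segment and radial primitives *)

Lemma Cder_R_is_derive (f : C -> C) (t : R) (l : C) : Cder f (RtoC t) l ->
  is_derive (fun s => fst (f (RtoC s))) t (fst l) /\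
  is_derive (fun s => snd (f (RtoC s))) t (snd l).
Proof.
intros D; destruct (Cder_total_diff f t 0 l D) as [T1 T2].
assert (K : forall U a b, total_diff U t 0 a b -> is_derive (fun s => U s 0) t a).
{ intros U a b H; apply is_derive_Reals; intros eps He.
  destruct (H (eps / 2)) as [d [Hd K]]; [lra|].
  exists (mkposreal d Hd); intros s Ns Hs; simpl in Hs.
  specialize (K (t + s) 0); rewrite Rminus_diag, Rabs_R0 in K.
  replace (t + s - t) with s in K by ring; specialize (K Hs Hd).
  rewrite Rplus_0_r in K.
  assert (Ps : 0 < Rabs s) by now apply Rabs_pos_lt.
  replace ((U (t + s) 0 - U t 0) / s - a) with ((U (t + s) 0 - U t 0 - a * s - b * 0) / s)
    by (field; exact Ns).
  unfold Rdiv; rewrite Rabs_mult, Rabs_inv.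
  apply Rmult_lt_reg_r with (Rabs s); [exact Ps|].
  rewrite Rmult_assoc, Rinv_l, Rmult_1_r by lra; nra. }
split; [exact (K _ _ _ T1)|exact (K _ _ _ T2)].
Qed.

Lemma Ccts_R_continuous (f : C -> C) (t : R) : Ccts f (RtoC t) ->
  continuous (fun s : R => fst (f (RtoC s))) t /\
  continuous (fun s : R => snd (f (RtoC s))) t.
Proof.
intros H.
assert (K : forall p : C -> R, (forall z w, Rabs (p z - p w) <= Cmod (z - w)%C) ->
  continuous (fun s : R => p (f (RtoC s))) t).
{ intros p Hp; apply continuity_pt_filterlim; intros eps He.
  destruct (H eps He) as [d [Hd K]]; exists d; split; [exact Hd|].
  intros s [_ Hs]; simpl in *; unfold Rdist in *.
  eapply Rle_lt_trans; [apply Hp|]; apply K.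
  rewrite <- RtoC_minus, Cmod_R; exact Hs. }
split; apply K; intros z w.
- exact (re_le_Cmod (z - w)%C).
- exact (im_le_Cmod (z - w)%C).
Qed.

Definition on_unit_interval (f : C -> C) : Prop :=
  forall t : R, 0 <= t <= 1 -> Ccts f (RtoC t).

Definition Cint01 (f : C -> C) : C :=
  (RInt (fun t => fst (f (RtoC t))) 0 1, RInt (fun t => snd (f (RtoC t))) 0 1).

Lemma Cint01_ex (f : C -> C) : on_unit_interval f ->
  ex_RInt (fun t => fst (f (RtoC t))) 0 1 /\ ex_RInt (fun t => snd (f (RtoC t))) 0 1.
Proof.
intros H; split; apply (@ex_RInt_continuous R_CompleteNormedModule); intros t;
  rewrite Rmin_left, Rmax_right by lra; intros Ht; apply (Ccts_R_continuous f t (H t Ht)).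
Qed.

Lemma Cint01_plus (f g : C -> C) : on_unit_interval f -> on_unit_interval g ->
  Cint01 (fun z => f z + g z)%C = (Cint01 f + Cint01 g)%C.
Proof.
intros Hf Hg; destruct (Cint01_ex f Hf) as [F1 F2]; destruct (Cint01_ex g Hg) as [G1 G2].
unfold Cint01, Cplus; simpl; f_equal.
- exact (RInt_plus (V := R_CompleteNormedModule) _ _ 0 1 F1 G1).
- exact (RInt_plus (V := R_CompleteNormedModule) _ _ 0 1 F2 G2).
Qed.

Lemma Cint01_scal (c : C) (f : C -> C) : on_unit_interval f ->
  Cint01 (fun z => c * f z)%C = (c * Cint01 f)%C.
Proof.
intros Hf; destruct (Cint01_ex f Hf) as [F1 F2]; destruct c as [a b].
assert (E : forall u k, ex_RInt u 0 1 -> RInt (fun t => k * u t) 0 1 = k * RInt u 0 1)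
  by (intros u k H; exact (RInt_scal (V := R_CompleteNormedModule) u 0 1 k H)).
assert (S : forall u k, ex_RInt u 0 1 -> ex_RInt (fun t => k * u t) 0 1)
  by (intros u k H; exact (ex_RInt_scal (V := R_NormedModule) u 0 1 k H)).
unfold Cint01, Cmult; simpl; f_equal.
- rewrite <- !E by assumption.
  exact (RInt_minus (V := R_CompleteNormedModule) _ _ 0 1 (S _ a F1) (S _ b F2)).
- rewrite <- !E by assumption.
  exact (RInt_plus (V := R_CompleteNormedModule) _ _ 0 1 (S _ a F2) (S _ b F1)).
Qed.

Lemma Cint01_bound (f : C -> C) (K : R) : on_unit_interval f ->
  (forall t, 0 <= t <= 1 -> Cmod (f (RtoC t)) <= K) -> Cmod (Cint01 f) <= 2 * K.
Proof.
intros Hf HK; destruct (Cint01_ex f Hf) as [F1 F2].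
assert (B1 : Rabs (RInt (fun t => fst (f (RtoC t))) 0 1) <= (1 - 0) * K).
{ apply abs_RInt_le_const; [lra|exact F1|]; intros t Ht.
  eapply Rle_trans; [apply re_le_Cmod|now apply HK]. }
assert (B2 : Rabs (RInt (fun t => snd (f (RtoC t))) 0 1) <= (1 - 0) * K).
{ apply abs_RInt_le_const; [lra|exact F2|]; intros t Ht.
  eapply Rle_trans; [apply im_le_Cmod|now apply HK]. }
eapply Rle_trans; [apply Cmod_le_abs|]; simpl; lra.
Qed.

Lemma Cint01_deriv (f df : C -> C) : on_unit_interval df ->
  (forall t : R, 0 <= t <= 1 -> Cder f (RtoC t) (df (RtoC t))) ->
  Cint01 df = (f (RtoC 1) - f (RtoC 0))%C.
Proof.
intros Hc Hd; unfold Cint01.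
transitivity (fst (f (RtoC 1)) - fst (f (RtoC 0)), snd (f (RtoC 1)) - snd (f (RtoC 0))).
2: reflexivity.
f_equal; apply (is_RInt_unique (V := R_CompleteNormedModule)).
- apply (is_RInt_derive (V := R_CompleteNormedModule) (fun t => fst (f (RtoC t)))); intros t;
    rewrite Rmin_left, Rmax_right by lra; intros Ht.
  + apply (Cder_R_is_derive f t _ (Hd t Ht)).
  + apply (Ccts_R_continuous df t (Hc t Ht)).
- apply (is_RInt_derive (V := R_CompleteNormedModule) (fun t => snd (f (RtoC t)))); intros t;
    rewrite Rmin_left, Rmax_right by lra; intros Ht.
  + apply (Cder_R_is_derive f t _ (Hd t Ht)).
  + apply (Ccts_R_continuous df t (Hc t Ht)).
Qed.

Lemma Cder_Fder (f : C -> C) (z l : C) : Cder f z l ->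
  Fder (X := C_NormedModule) f z (fun h : C => l * h)%C.
Proof.
intros H; split.
- apply (Clinear_intro (X := C_NormedModule) _ (Cmod l)).
  + exact (Cmult_plus_distr_l l).
  + assert (E : forall c x : C, (l * (c * x) = c * (l * x))%C) by (intros; ring).
    exact E.
  + intros x; change (Cmod (l * x) <= Cmod l * Cmod x); rewrite Cmod_mult; lra.
- intros eps He; destruct (H eps He) as [d [Hd K]]; exists d; split; [exact Hd|].
  intros h Hh; change (Cmod h < d) in Hh.
  change (Cmod (f (z + h) - f z - l * h)%C <= eps * Cmod h).
  assert (E : forall x : C, (z + x - z)%C = x) by (intros; ring).
  specialize (K (z + h)%C); rewrite E in K; exact (K Hh).
Qed.

(** The Taylor estimate on normed spaces, for [X = C]. Its constant does not depend on [z] in the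
    smaller disc, as needed under an integral. *)
Lemma Cder_quadratic_bound (y dy : C -> C) (r : R) : 0 <= r < 1 ->
  (forall z, Cmod z < 1 -> Cder y z (dy z)) ->
  (forall s, s < 1 -> exists M, forall z, Cmod z <= s -> Cmod (y z) <= M) ->
  exists K d, 0 <= K /\ 0 < d /\ r + d <= 1 /\ forall z k, Cmod z <= r -> Cmod k < d ->
    Cmod (y (z + k) - y z - dy z * k)%C <= K * Cmod k ^ 2.
Proof.
intros Hr D HB; destruct (HB ((1 + r) / 2)) as [M HM]; [lra|].
set (R := (1 - r) / 2).
assert (HR : 0 < R) by (unfold R; lra).
assert (HM0 : 0 <= M).
{ eapply Rle_trans; [apply (Cmod_ge_0 (y 0%C))|apply HM]; rewrite Cmod_0; lra. }
exists (128 * M / R ^ 2), (R / 4); split; [|split; [|split]].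
- apply Rdiv_le_0_compat; [lra|apply pow_lt; lra].
- lra.
- unfold R; lra.
- intros z k Hz Hk.
  apply (bounded_holo_taylor (X := C_NormedModule) y (fun x h => dy x * h)%C z R M k HR);
    [|exact Hk].
  intros h Hh; change (Cmod h < R) in Hh.
  assert (T := Cmod_triangle z h); split.
  + apply Cder_Fder, D; change (Cmod (z + h) < 1); unfold R in Hh; lra.
  + apply HM; change (Cmod (z + h) <= (1 + r) / 2); unfold R in Hh; lra.
Qed.

(** [h z] is the integral of [y (t z)] and [dh z] that of [t y' (t z)] over [0 <= t <= 1]; the
    equation integrates the derivative of [t y (t z)]. This yields [f / z] directly, without a
    division at 0. *)
Theorem radial_primitive (y dy : C -> C) :
  (forall z, Cmod z < 1 -> Cder y z (dy z)) ->
  (forall z, Cmod z < 1 -> Ccts dy z) ->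
  (forall s, s < 1 -> exists M, forall z, Cmod z <= s -> Cmod (y z) <= M) ->
  exists h dh : C -> C, forall z, Cmod z < 1 ->
    Cder h z (dh z) /\ (h z + z * dh z = y z)%C.
Proof.
intros D Cd HB.
assert (Ht : forall t z, 0 <= t <= 1 -> Cmod (RtoC t * z)%C <= Cmod z).
{ intros t z Ht; rewrite Cmod_mult, Cmod_R, Rabs_pos_eq by lra.
  assert (A := Cmod_ge_0 z); nra. }
assert (Cl : forall (z w : C), Ccts (fun x => x * z)%C w)
  by (intros; apply Ccts_mult; [apply Ccts_id|apply Ccts_const]).
assert (I1 : forall z, Cmod z < 1 -> on_unit_interval (fun x => y (x * z))%C).
{ intros z Hz t H; apply (Ccts_comp (fun x => x * z)%C y); [apply Cl|].
  eapply Cder_Ccts, D; eapply Rle_lt_trans; [now apply Ht|exact Hz]. }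
assert (I2 : forall z, Cmod z < 1 -> on_unit_interval (fun x => x * dy (x * z))%C).
{ intros z Hz t H; apply Ccts_mult; [apply Ccts_id|].
  apply (Ccts_comp (fun x => x * z)%C dy); [apply Cl|].
  apply Cd; eapply Rle_lt_trans; [now apply Ht|exact Hz]. }
exists (fun z => Cint01 (fun x => y (x * z)%C)), (fun z => Cint01 (fun x => x * dy (x * z))%C).
intros z Hz; split.
- destruct (Cder_quadratic_bound y dy (Cmod z)) as [K [d [HK [Hd [Hzd Q]]]]]; auto.
  { split; [apply Cmod_ge_0|exact Hz]. }
  intros eps He.
  assert (P : 0 < eps / (1 + 2 * K)) by (apply Rdiv_lt_0_compat; lra).
  exists (Rmin d (eps / (1 + 2 * K))); split; [now apply Rmin_glb_lt|]; intros w Hw.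
  destruct (Rmin_Rgt_l _ _ _ Hw) as [W1 W2].
  set (k := (w - z)%C) in *.
  assert (Ew : w = (z + k)%C) by (unfold k; ring).
  assert (Hw1 : Cmod w < 1).
  { rewrite Ew; eapply Rle_lt_trans; [apply Cmod_triangle|]; lra. }
  assert (E : (Cint01 (fun x => y (x * w)) - Cint01 (fun x => y (x * z))
    - Cint01 (fun x => x * dy (x * z)) * k)%C =
    Cint01 (fun x => y (x * w) + ((- 1) * y (x * z) + (- k) * (x * dy (x * z))))%C).
  { rewrite Cint01_plus, Cint01_plus, !Cint01_scal; auto; [ring| | |].
    - intros t H; apply Ccts_mult; [apply Ccts_const|now apply I1].
    - intros t H; apply Ccts_mult; [apply Ccts_const|now apply I2].
    - intros t H; apply Ccts_plus; apply Ccts_mult; try apply Ccts_const;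
        [now apply I1|now apply I2]. }
  rewrite E; apply Rle_trans with (2 * (K * Cmod k ^ 2)).
  + apply Cint01_bound.
    * intros t H; apply Ccts_plus; [now apply I1|].
      apply Ccts_plus; apply Ccts_mult; try apply Ccts_const; [now apply I1|now apply I2].
    * intros t H.
      replace (y (RtoC t * w) + ((- 1) * y (RtoC t * z) + (- k) * (RtoC t * dy (RtoC t * z))))%C
        with (y (RtoC t * z + RtoC t * k) - y (RtoC t * z) - dy (RtoC t * z) * (RtoC t * k))%C.
      2:{ rewrite Ew; replace (RtoC t * (z + k))%C with (RtoC t * z + RtoC t * k)%C by ring; ring. }
      assert (Nk := Ht t k H).
      eapply Rle_trans; [apply Q; [now apply Ht|lra]|].
      apply Rmult_le_compat_l; [exact HK|]; apply pow_incr; split; [apply Cmod_ge_0|exact Nk].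
  + assert (A := Cmod_ge_0 k).
    apply <- Rlt_div_r in W2; [|lra].
    replace (2 * (K * Cmod k ^ 2)) with (2 * K * Cmod k * Cmod k) by ring.
    apply Rmult_le_compat_r; [exact A|]; nra.
- rewrite <- Cint01_scal, <- Cint01_plus; auto.
  2:{ intros t H; apply Ccts_mult; [apply Ccts_const|now apply I2]. }
  rewrite (Cint01_deriv (fun x => x * y (x * z))%C (fun x => y (x * z) + z * (x * dy (x * z)))%C).
  + rewrite !Cmult_1_l, Cmult_0_l; ring.
  + intros t H; apply Ccts_plus; [now apply I1|].
    apply Ccts_mult; [apply Ccts_const|now apply I2].
  + intros t H.
    replace (y (RtoC t * z) + z * (RtoC t * dy (RtoC t * z)))%C with
      (1 * y (RtoC t * z) + RtoC t * (dy (RtoC t * z) * (1 * z + RtoC t * 0)))%C by ring.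
    apply (Cder_mult (fun x => x) (fun x => y (x * z))%C); [apply Cder_id|].
    apply (Cder_comp (fun x => x * z)%C y).
    * apply (Cder_mult (fun x => x) (fun _ => z)); [apply Cder_id|apply Cder_const].
    * apply D; eapply Rle_lt_trans; [now apply Ht|exact Hz].
Qed.

Lemma convex_combination_pos (s a b : R) : 0 <= s <= 1 -> 0 < a -> 0 < b ->
  0 < (1 - s) * a + s * b.
Proof. intros Hs Ha Hb; destruct (Rle_dec s (1 / 2)); nra. Qed.

(** * The factor [h] has no zero *)

Section NonVanishing.
Variables (e : C) (mu : R) (h dh : C -> C).
Hypothesis (He : Cmod e = 1) (Hmu : 1 <= mu <= 3 / 2).
Hypothesis (Hh : forall z, Cmod z < 1 ->
  Cder h z (dh z) /\ (h z + z * dh z = ext_deriv e mu z)%C).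

(* Along a path with G' = m quad(G), the derivative of f(G) / m, where
   f z = z h z, is f'(G) quad(G), which has positive real part. *)
Lemma path_nonvanishing (G : C -> C) (m z : C) : m <> 0%C ->
  (forall s : R, 0 <= s <= 1 ->
     Cmod (G (RtoC s)) < 1 /\ Cder G (RtoC s) (m * quad e (G (RtoC s)))%C) ->
  G (RtoC 0) = 0%C -> G (RtoC 1) = z -> h z <> 0%C.
Proof.
intros Nm HG G0 G1 E.
set (f := fun w : C => (/ m * (G w * h (G w)))%C).
set (df := fun s : R => (ext_deriv e mu (G (RtoC s)) * quad e (G (RtoC s)))%C).
assert (Df : forall s : R, 0 <= s <= 1 -> Cder f (RtoC s) (df s)).
{ intros s Hs; destruct (HG s Hs) as [H1 H2]; destruct (Hh _ H1) as [D1 D2].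
  unfold df; rewrite <- D2.
  replace ((h (G (RtoC s)) + G (RtoC s) * dh (G (RtoC s))) * quad e (G (RtoC s)))%C with
    (/ m * (m * quad e (G (RtoC s)) * h (G (RtoC s)) +
      G (RtoC s) * (dh (G (RtoC s)) * (m * quad e (G (RtoC s))))))%C by (field; exact Nm).
  apply Cder_scal, (Cder_mult G (fun w => h (G w))); [exact H2|].
  now apply (Cder_comp G h). }
(* If [h z = 0], then [f] vanishes at both ends of the path, so the real part of its derivative
   vanishes somewhere in between. *)
destruct (MVT_gen (fun s => fst (f (RtoC s))) 0 1 (fun s => fst (df s))) as [t [Ht K]].
- rewrite Rmin_left, Rmax_right by lra; intros s Hs.
  exact (proj1 (Cder_R_is_derive f s _ (Df s ltac:(lra)))).
- rewrite Rmin_left, Rmax_right by lra; intros s Hs; apply continuity_pt_filterlim.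
  apply (Ccts_R_continuous f s); eapply Cder_Ccts, Df, Hs.
- rewrite Rmin_left, Rmax_right in Ht by lra.
  assert (P := ext_close_to_convex e mu He Hmu _ (proj1 (HG t Ht))).
  fold (df t) in P; unfold f in K; rewrite G0, G1, E in K.
  replace (/ m * (z * 0))%C with (RtoC 0) in K by ring.
  replace (/ m * (0 * h 0))%C with (RtoC 0) in K by ring.
  set (v := df t) in *; clearbody v; simpl in K; lra.
Qed.

Lemma h_neq_0_at_0 : h 0%C <> 0%C.
Proof.
destruct (Hh 0%C) as [_ K]; [rewrite Cmod_0; lra|].
rewrite ext_deriv_0 in K; intros E; rewrite E in K.
replace (0 + 0 * dh 0)%C with (RtoC 0) in K by ring.
apply (f_equal fst) in K; simpl in K; lra.
Qed.

Lemma Cmod_sq (z : C) : Cmod z ^ 2 = fst z ^ 2 + snd z ^ 2.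
Proof. apply pow2_sqrt; nra. Qed.

Lemma Cmod_lt_of_sq (z w : C) : Cmod z ^ 2 < Cmod w ^ 2 -> Cmod z < Cmod w.
Proof.
intros H; assert (A := Cmod_ge_0 z); assert (B := Cmod_ge_0 w).
destruct (Rlt_dec (Cmod z) (Cmod w)) as [L|L]; [exact L|nra].
Qed.

Lemma Cmod_div_lt_1 (z w : C) : Cmod z ^ 2 < Cmod w ^ 2 ->
  w <> 0%C /\ Cmod (z / w)%C < 1.
Proof.
intros H; assert (L := Cmod_lt_of_sq z w H); assert (A := Cmod_ge_0 z).
assert (N : w <> 0%C) by (apply Cmod_gt_0; lra).
split; [exact N|]; rewrite Cmod_div by exact N.
apply Rlt_div_l; [lra|]; lra.
Qed.

(** For [e = 1] the coordinate [w / (1 - w)] straightens the equation [G' = m (1 - G)^2] and maps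
    the disc onto a half-plane. The path [G] is the preimage of the segment from 0 to
    [z / (1 - z)]. *)
Lemma h_neq_0_parabolic (z : C) : e = 1%C -> Cmod z < 1 -> h z <> 0%C.
Proof.
intros Ee Hz; destruct (Ceq_dec z 0%C) as [->|Nz]; [apply h_neq_0_at_0|].
assert (N1 : (1 - z <> 0)%C).
{ replace (1 - z)%C with (1 - 1 * z)%C by ring; apply factor_neq_0; [apply Cmod_1|exact Hz]. }
assert (K : forall s : R, 0 <= s <= 1 ->
  (1 - z + RtoC s * z)%C <> 0%C /\ Cmod (RtoC s * z / (1 - z + RtoC s * z))%C < 1).
{ intros s Hs; apply Cmod_div_lt_1; rewrite !Cmod_sq.
  assert (P1 := proj1 (Cmod_gt_0 _) N1).
  assert (Q1 : 0 < Cmod (1 - z) ^ 2) by (apply pow_lt; lra).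
  assert (Q2 : Cmod z ^ 2 < 1) by (assert (A := Cmod_ge_0 z); nra).
  rewrite Cmod_sq in Q1, Q2; destruct z as [x y].
  unfold Cminus, Cplus, Copp, Cmult, RtoC in *; simpl in *.
  assert (A : 0 < (1 - x) ^ 2 + y ^ 2) by lra.
  assert (B : 0 < 1 - (x ^ 2 + y ^ 2)) by lra.
  (* The sum is [|1 - z + s z|^2 - |s z|^2]. *)
  assert (AB : 0 < (1 - s) * ((1 - x) ^ 2 + y ^ 2) + s * (1 - (x ^ 2 + y ^ 2))).
  { now apply convex_combination_pos. }
  lra. }
apply (path_nonvanishing (fun w => w * z / (1 - z + w * z))%C (z / (1 - z))%C).
- intros E; apply Nz; replace z with (z / (1 - z) * (1 - z))%C by (field; exact N1).
  rewrite E; ring.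
- intros s Hs; destruct (K s Hs) as [K1 K2]; split; [exact K2|].
  unfold quad; rewrite Ee, Cconj_RtoC.
  match goal with |- Cder _ _ ?a => replace a with
    (((1 * z + RtoC s * 0) * (1 - z + RtoC s * z) - (RtoC s * z) * (0 - 0 + (1 * z + RtoC s * 0)))
      / ((1 - z + RtoC s * z) * (1 - z + RtoC s * z)))%C by (field; auto) end.
  assert (D : Cder (fun w => w * z)%C (RtoC s) (1 * z + RtoC s * 0)%C)
    by (apply (Cder_mult (fun w => w) (fun _ => z)); [apply Cder_id|apply Cder_const]).
  apply (Cder_div (fun w => w * z)%C (fun w => 1 - z + w * z)%C); [exact D| |exact K1].
  apply Cder_plus; [|exact D]; apply Cder_minus; apply Cder_const.
- field; replace (1 - z + 0 * z)%C with (1 - z)%C by ring; exact N1.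
- field; intros E; apply (f_equal fst) in E; revert E.
  replace (1 - z + 1 * z)%C with (RtoC 1) by ring; simpl; lra.
Qed.

(** [theta + t] lies between [- PI] and [2 * PI], where the sine is positive only on [(0, PI)]. This
    interval contains [theta] too and is convex. *)
Lemma upper_half_plane_cone (theta t s : R) : 0 < theta < PI -> - PI < t < PI ->
  0 < sin (theta + t) -> 0 <= s <= 1 -> 0 < sin (theta + s * t).
Proof.
intros Hth Ht Hsin Hs.
assert (K : 0 < theta + t < PI).
{ split; apply Rnot_le_lt; intros L.
  - assert (A := sin_le_0 (theta + t + 2 * PI) ltac:(lra) ltac:(lra)).
    rewrite sin_plus, cos_2PI, sin_2PI in A; lra.
  - assert (A := sin_le_0 (theta + t) ltac:(lra) ltac:(lra)); lra. }
assert (K1 := convex_combination_pos s theta (theta + t) Hs (proj1 Hth) (proj1 K)).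
assert (K2 := convex_combination_pos s (PI - theta) (PI - (theta + t)) Hs ltac:(lra) ltac:(lra)).
apply sin_gt_0; lra.
Qed.

(** The coordinate [M = (1 - eb w) / (1 - e w)] maps the disc onto [Im (M e) > 0], and
    [log M / (e - eb)] is the primitive of [1 / quad]. The path [G] is the preimage of the segment
    from 0 to [Lam] for [log M]. *)
Lemma h_neq_0_hyperbolic (z : C) : 0 < snd e -> Cmod z < 1 -> h z <> 0%C.
Proof.
intros Hs Hz; destruct (Ceq_dec z 0%C) as [->|Nz]; [apply h_neq_0_at_0|].
set (eb := Cconj e).
assert (Heb : Cmod eb = 1) by (unfold eb; now apply Cmod_conj_e).
assert (Eee : (e * eb = 1)%C) by (now apply e_conj_e).
assert (Ned : (e - eb <> 0)%C).
{ intros E; apply (f_equal snd) in E; unfold eb, Cconj, Cminus, Cplus, Copp in E.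
  simpl in E; lra. }
assert (N1 := factor_neq_0 e z He Hz); assert (N2 := factor_neq_0 eb z Heb Hz).
assert (R1 := one_minus_re_pos e z He Hz); assert (R2 := one_minus_re_pos eb z Heb Hz).
set (Lam := (Clog (1 - eb * z) - Clog (1 - e * z))%C).
assert (EL : Cexp Lam = ((1 - eb * z) / (1 - e * z))%C).
{ assert (A : (Cexp Lam * Cexp (Clog (1 - e * z)) = Cexp (Clog (1 - eb * z)))%C)
    by (rewrite <- Cexp_plus; f_equal; unfold Lam; ring).
  rewrite !Cexp_Clog in A by lra; rewrite <- A; field; exact N1. }
assert (NLam : Lam <> 0%C).
{ intros E; rewrite E, Cexp_0 in EL; apply Nz.
  assert (A : ((e - eb) * z = 0)%C).
  { replace ((e - eb) * z)%C with ((1 - eb * z) / (1 - e * z) * (1 - e * z) - (1 - e * z))%C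
      by (field; exact N1); rewrite <- EL; ring. }
  replace z with ((e - eb) * z / (e - eb))%C by (field; exact Ned); rewrite A; field; exact Ned. }
set (M := fun w : C => Cexp (w * Lam)%C).
set (theta := acos (fst e)).
assert (He2 : fst e ^ 2 + snd e ^ 2 = 1) by (rewrite <- Cmod_sq, He; ring).
assert (Hce : -1 < fst e < 1) by nra.
assert (Hth : 0 < theta < PI) by (apply acos_bound_lt; exact Hce).
assert (Hct : cos theta = fst e) by (apply cos_acos; lra).
assert (Hst : sin theta = snd e).
{ assert (A := sin2_cos2 theta); rewrite Hct in A; unfold Rsqr in A.
  assert (B := sin_gt_0 theta (proj1 Hth) (proj2 Hth)); nra. }
set (t := snd Lam).
assert (Ht : - PI < t < PI).
{ assert (A := Clog_im (1 - eb * z)%C); assert (B := Clog_im (1 - e * z)%C).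
  change (- PI < snd (Clog (1 - eb * z)%C) + - snd (Clog (1 - e * z)%C) < PI); lra. }
clearbody Lam.
assert (Him : forall s : R, snd (M (RtoC s) * e)%C = exp (s * fst Lam) * sin (theta + s * t)).
{ intros s; unfold M, Cexp, Cmult, RtoC; simpl; rewrite (sin_plus theta), Hct, Hst.
  unfold t; replace (s * fst Lam - 0 * snd Lam) with (s * fst Lam) by ring.
  replace (s * snd Lam + 0 * fst Lam) with (s * snd Lam) by ring; ring. }
assert (EM1 : M (RtoC 1) = ((1 - eb * z) / (1 - e * z))%C)
  by (unfold M; now rewrite Cmult_1_l).
(* Since [e eb = 1], the end point satisfies [M e = (e - z) / (1 - e z)], with imaginary part
   [Im e (1 - |z|^2) / |1 - e z|^2]. *)
assert (Hpos1 : 0 < sin (theta + t)).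
{ assert (A := Him 1); rewrite !Rmult_1_l, EM1 in A.
  assert (B : ((1 - eb * z) / (1 - e * z) * e =
    RtoC (/ Cmod (1 - e * z) ^ 2) * ((e - z) * Cconj (1 - e * z)))%C).
  { assert (P : 0 < Cmod (1 - e * z) ^ 2) by (apply pow_lt; now apply Cmod_gt_0).
    rewrite RtoC_inv, <- Cmult_conj by lra.
    transitivity ((e - (e * eb) * z) / (1 - e * z))%C; [field; exact N1|].
    rewrite Eee; field; split; [|exact N1].
    intros E; apply N1; rewrite <- (Cconj_involutive (1 - e * z)), E, Cconj_RtoC; auto. }
  rewrite B in A.
  assert (P : 0 < / Cmod (1 - e * z) ^ 2)
    by (apply Rinv_0_lt_compat, pow_lt; now apply Cmod_gt_0).
  assert (Q : snd ((e - z) * Cconj (1 - e * z))%C = snd e * (1 - Cmod z ^ 2)).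
  { rewrite Cmod_sq; destruct z as [x y], e as [c d]; simpl in He2 |- *.
    assert (He3 : c * c + d * d = 1) by lra.
    transitivity (d * (1 - (x ^ 2 + y ^ 2)) + (c * c + d * d - 1) * y); [simpl; ring|].
    rewrite He3; simpl; ring. }
  assert (Hz2 : Cmod z ^ 2 < 1) by (assert (D := Cmod_ge_0 z); nra).
  assert (A2 : snd (RtoC (/ Cmod (1 - e * z) ^ 2) * ((e - z) * Cconj (1 - e * z)))%C
    = / Cmod (1 - e * z) ^ 2 * (snd e * (1 - Cmod z ^ 2))).
  { rewrite <- Q; generalize (/ Cmod (1 - e * z) ^ 2); intros r.
    generalize ((e - z) * Cconj (1 - e * z))%C; intros w.
    unfold Cmult, RtoC; simpl; ring. }
  rewrite A2 in A.
  assert (0 < / Cmod (1 - e * z) ^ 2 * (snd e * (1 - Cmod z ^ 2)))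
    by (apply Rmult_lt_0_compat; [exact P|apply Rmult_lt_0_compat; lra]).
  assert (E := exp_pos (fst Lam)); nra. }
assert (Hpos : forall s : R, 0 <= s <= 1 -> 0 < snd (M (RtoC s) * e)%C).
{ intros s Hs'; rewrite Him; apply Rmult_lt_0_compat; [apply exp_pos|].
  now apply upper_half_plane_cone. }
assert (K : forall s : R, 0 <= s <= 1 ->
  (e * M (RtoC s) - eb)%C <> 0%C /\ Cmod ((M (RtoC s) - 1) / (e * M (RtoC s) - eb))%C < 1).
{ intros s Hs'; apply Cmod_div_lt_1; assert (A := Hpos s Hs').
  rewrite !Cmod_sq; destruct (M (RtoC s)) as [p q]; unfold eb.
  destruct e as [c d]; simpl in He2, A, Hs |- *.
  assert (He3 : c * c + d * d = 1) by lra.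
  assert (P : 0 < d * (p * d + q * c)) by (apply Rmult_lt_0_compat; lra).
  (* With [|e| = 1] this is [|e M - eb|^2 - |M - 1|^2 = 4 Im e Im (M e)]. *)
  match goal with |- ?l < ?r => assert (E : r - l = (c * c + d * d - 1) * (p * p + q * q + 1 - 2 * p)
    + 4 * (d * (p * d + q * c))) by ring end.
  rewrite He3 in E; lra. }
apply (path_nonvanishing (fun w => (M w - 1) / (e * M w - eb))%C (Lam / (e - eb))%C).
- intros E; apply NLam; replace Lam with (Lam / (e - eb) * (e - eb))%C by (field; exact Ned).
  rewrite E; ring.
- intros s Hs'; destruct (K s Hs') as [K1 K2]; split; [exact K2|].
  unfold quad; fold eb.
  assert (DM : Cder M (RtoC s) (M (RtoC s) * (1 * Lam + RtoC s * 0))%C).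
  { apply (Cder_comp (fun w => w * Lam)%C Cexp); [|apply Cder_Cexp].
    apply (Cder_mult (fun w => w) (fun _ => Lam)); [apply Cder_id|apply Cder_const]. }
  set (m := M (RtoC s)) in *.
  match goal with |- Cder _ _ ?a => replace a with
    (((m * (1 * Lam + RtoC s * 0) - 0) * (e * m - eb)
      - (m - 1) * (e * (m * (1 * Lam + RtoC s * 0)) - 0)) / ((e * m - eb) * (e * m - eb)))%C
    by (field; auto) end.
  apply (Cder_div (fun w => M w - 1)%C (fun w => e * M w - eb)%C); [| |exact K1].
  + apply Cder_minus; [exact DM|apply Cder_const].
  + apply Cder_minus; [now apply Cder_scal|apply Cder_const].
- unfold M; rewrite Cmult_0_l, Cexp_0; field.
  replace (e * 1 - eb)%C with (e - eb)%C by ring; exact Ned.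
- destruct (K 1 ltac:(lra)) as [K1 _]; rewrite EM1 in *.
  assert (E1 : (e * ((1 - eb * z) / (1 - e * z)) - eb = (e - eb) / (1 - e * z))%C).
  { transitivity ((e - eb + (e * eb - e * eb) * z) / (1 - e * z))%C; field; exact N1. }
  rewrite E1; field; split; assumption.
Qed.

End NonVanishing.

(** * Extension from the disc to the ball *)

Section RadialExtension.
Context {X : NormedModule C_AbsRing}.
Variables (x0 : X) (T : X -> C).
Hypothesis (Hn : norm x0 = 1) (HT : support_functional x0 T).

Lemma support_functional_le (x : X) : Cmod (T x) <= norm x.
Proof.
destruct HT as [TL [_ [TB _]]].
destruct (Req_dec (norm x) 0) as [E|N].
{ rewrite (norm_eq_zero x E), (Clinear_zero T TL), Cmod_0, norm_zero; lra. }
assert (P : 0 < norm x) by (assert (A := norm_ge_0 x); lra).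
assert (K : Cmod (T (vscal (RtoC (/ norm x)) x)) <= 1).
{ apply TB; exists (vscal (RtoC (/ norm x)) x); split; [|reflexivity].
  rewrite norm_vscal_R by now apply Rinv_0_lt_compat.
  rewrite Rinv_l by lra; lra. }
rewrite (Clinear_scal T), Cmod_mult, Cmod_R, Rabs_pos_eq in K
  by (try exact TL; left; now apply Rinv_0_lt_compat).
apply Rmult_le_reg_l with (/ norm x); [now apply Rinv_0_lt_compat|].
rewrite Rinv_l by lra; exact K.
Qed.

Lemma Fder_comp_linear (h : C -> C) (l : C) (x : X) : Cder h (T x) l ->
  Fder (fun y => h (T y)) x (fun k => l * T k)%C.
Proof.
intros H; assert (TL : Clinear T) by exact (proj1 HT); split.
- apply (Clinear_intro _ (Cmod l)).
  + intros y z; rewrite (Clinear_plus T) by exact TL; ring.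
  + intros c z; rewrite (Clinear_scal T) by exact TL; ring.
  + intros z; rewrite Cmod_mult; apply Rmult_le_compat_l; [apply Cmod_ge_0|].
    apply support_functional_le.
- intros eps He; destruct (H eps He) as [d [Hd K]]; exists d; split; [exact Hd|].
  intros k Hk; rewrite (Clinear_plus T) by exact TL.
  assert (B := support_functional_le k).
  specialize (K (T x + T k)%C); replace (T x + T k - T x)%C with (T k) in K by ring.
  eapply Rle_trans; [apply K; lra|]; apply Rmult_le_compat_l; lra.
Qed.

Variables (h dh dy : C -> C) (lambda : R).
Hypothesis (h0 : h 0%C = 1%C).
Hypothesis (Hh : forall z, Cmod z < 1 -> Cder h z (dh z)).
Hypothesis (Hy : forall z, Cmod z < 1 -> Cder (fun z => h z + z * dh z)%C z (dy z)).
Hypothesis (Nh : forall z, Cmod z < 1 -> h z <> 0%C).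
Hypothesis (Ny : forall z, Cmod z < 1 -> (h z + z * dh z)%C <> 0%C).
Hypothesis (Hclass : forall z, Cmod z < 1 ->
  1 / 2 - lambda <= fst (1 + z * (dy z / (h z + z * dh z)))%C).

(** For [F x = h(T x) x] the vector in the class condition is a multiple of [x] by a number
    depending on [T x] alone. Every functional supporting [x] therefore gives the same scalar
    condition at [T x]. In the last clause [dy 0 = 2 A_2] and [b = 6 A_3 - 4 A_2^2]. *)
Theorem radial_extension_class_F : exists (g : X -> C) (F : X -> X),
  holomorphic_on_ball (Y := C_NormedModule) g /\ g zero = RtoC 1 /\
  (forall x : X, norm x < 1 -> F x = scal (g x) x) /\ class_F lambda F /\
  forall b, Cder (fun z => dy z / (h z + z * dh z))%C 0%C b ->
    coefA 2 F x0 T = (dy 0 / 2)%C /\ coefA 3 F x0 T = ((b + dy 0 * dy 0) / 6)%C.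
Proof.
assert (TL : Clinear T) by exact (proj1 HT).
assert (Hin : forall x, norm x < 1 -> Cmod (T x) < 1)
  by (intros x Hx; eapply Rle_lt_trans; [apply support_functional_le|exact Hx]).
assert (Tx0 : T x0 = 1%C) by (rewrite (proj1 (proj2 HT)), Hn; reflexivity).
set (g := fun x => h (T x)); set (F := fun x => vscal (g x) x).
set (dg := fun x k => (dh (T x) * T k)%C).
assert (Dg : forall x, norm x < 1 -> Fder g x (dg x))
  by (intros x Hx; apply Fder_comp_linear, Hh, Hin, Hx).
destruct (second_order_data_exists g dg Dg) as [B data].
assert (FE : forall x, norm x < 1 -> F x = vscal (g x) x) by reflexivity.
assert (g0 : g zero = RtoC 1) by (unfold g; now rewrite (Clinear_zero T TL)).
assert (ED : forall x, radial_deriv g dg x = (h (T x) + T x * dh (T x))%C)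
  by (intros x; unfold radial_deriv, g, dg; ring).
assert (ND : forall x, norm x < 1 -> radial_deriv g dg x <> 0%C)
  by (intros x Hx; rewrite ED; apply Ny, Hin, Hx).
(* [B] is known only through its existence; its values on slices are found by differentiating
   [h + z dh] along them and uniqueness of the derivative. *)
assert (ED2 : forall x (z : C), norm (vscal z x) < 1 ->
  (2 * slice1 dg x z + z * slice2 B x z = dy (z * T x) * T x)%C).
{ intros x z Hz.
  apply (Cder_unique (fun w => h (w * T x) + (w * T x) * dh (w * T x))%C z).
  - apply (Cder_ext_loc (fun w => g (vscal w x) + w * slice1 dg x w)%C _ _ _ 1 Rlt_0_1).
    + intros w _; unfold g, slice1, dg; rewrite (Clinear_scal T) by exact TL; ring.
    + now apply (radial_deriv_slice_Cder g dg B data).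
  - replace (dy (z * T x) * T x)%C with (dy (z * T x) * (1 * T x + z * 0))%C by ring.
    apply (Cder_comp (fun w => w * T x)%C (fun z => h z + z * dh z)%C).
    + apply (Cder_mult (fun w => w) (fun _ => T x)); [apply Cder_id|apply Cder_const].
    + apply Hy; rewrite <- (Clinear_scal T) by exact TL; now apply Hin. }
assert (ER2 : forall x, norm x < 1 -> radial_deriv2 dg B x = (T x * dy (T x))%C).
{ intros x Hx; assert (Hx1 : norm (vscal 1%C x) < 1) by now rewrite vscal1.
  assert (K := ED2 x 1%C Hx1); rewrite !Cmult_1_l in K.
  rewrite <- (vscal1 x) at 1; rewrite (radial_deriv2_slice g dg B data) by exact Hx1.
  rewrite !Cmult_1_l, K; ring. }
assert (HJ : forall x, norm x < 1 ->
  exists J, is_bounded_inverse (fun k => frechet_D 1 F x (k :: nil)) J).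
{ intros x Hx.
  assert (A : forall k, frechet_D 1 F x (k :: nil) = vadd (vscal (g x) k) (vscal (dg x k) x))
    by (intros k; now apply (frechet_D1_product g dg B F)).
  assert (Ng : g x <> 0%C) by (apply Nh, Hin, Hx).
  assert (NDx := ND x Hx).
  assert (HL := proj1 (Dg x Hx)); destruct (Clinear_bound _ HL) as [M [HM HB]].
  set (D := radial_deriv g dg x) in *.
  (* [D F(x)] is [g x] times the identity plus a map of rank one, and [J] is the Sherman-Morrison
     inverse. *)
  set (J := fun k => vscal (/ g x)%C (vadd k (vscal (- (dg x k / D))%C x))).
  exists J; split; [|split].
  - assert (JD : forall k l, J (vadd k l) = vadd (J k) (J l)).
    { intros k l; unfold J; rewrite (Clinear_plus _ _ _ HL).
      rewrite <- vscalDr; f_equal; set (p := dg x k); set (q := dg x l).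
      unfold Cdiv; vring x k l. }
    assert (JZ : forall c k, J (vscal c k) = vscal c (J k)).
    { intros c k; unfold J; rewrite (Clinear_scal _ _ _ HL).
      set (p := dg x k); set (r := (/ g x)%C); unfold Cdiv; vring x k k. }
    split; [exact JD|exact JZ|].
    assert (P1 : 0 < Cmod (/ g x)) by (apply Cmod_gt_0; intros E; apply Ng;
      replace (g x) with (g x * g x * / g x)%C by (field; exact Ng); rewrite E; ring).
    assert (P2 := proj1 (Cmod_gt_0 D) NDx).
    exists (Cmod (/ g x) * (1 + M / Cmod D)); split.
    { apply Rmult_lt_0_compat; [exact P1|].
      assert (0 < M / Cmod D) by (apply Rdiv_lt_0_compat; lra); lra. }
    intros k; unfold J; rewrite norm_vscal, Rmult_assoc.
    apply Rmult_le_compat_l; [lra|].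
    eapply Rle_trans; [apply norm_vadd|]; rewrite norm_vscal, Cmod_opp, Cmod_div by exact NDx.
    specialize (HB k); assert (A1 := norm_ge_0 x); assert (A2 := norm_ge_0 k).
    assert (A3 : Cmod (dg x k) / Cmod D <= M / Cmod D * norm k).
    { unfold Rdiv; rewrite (Rmult_comm M), Rmult_assoc, (Rmult_comm (Cmod (dg x k))).
      apply Rmult_le_compat_l; [left; now apply Rinv_0_lt_compat|exact HB]. }
    assert (A4 : 0 <= Cmod (dg x k) / Cmod D)
      by (apply Rdiv_le_0_compat; [apply Cmod_ge_0|exact P2]).
    nra.
  - intros k; rewrite A; unfold J.
    rewrite (Clinear_plus _ _ _ HL), !(Clinear_scal _ _ _ HL).
    assert (E : (dg x x = D - g x)%C) by (unfold D, radial_deriv; ring).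
    rewrite E; set (p := dg x k).
    transitivity (vadd (vscal 1%C k) (vscal 0%C x)); [|now rewrite vscal1, vscal0, vadd0].
    rewrite vscalDr, vscalDr, !vscalA, <- vaddA, <- vscalDl; f_equal; f_equal; field; auto.
  - intros k; rewrite A; unfold J.
    rewrite (Clinear_scal _ _ _ HL), (Clinear_plus _ _ _ HL), (Clinear_scal _ _ _ HL).
    assert (E : (dg x x = D - g x)%C) by (unfold D, radial_deriv; ring).
    rewrite E; set (p := dg x k).
    transitivity (vadd (vscal 1%C k) (vscal 0%C x)); [|now rewrite vscal1, vscal0, vadd0].
    rewrite !vscalDr, !vscalA, <- vaddA, <- vscalDl; f_equal; f_equal; field; auto. }
exists g, F; split; [|split; [exact g0|split; [reflexivity|split]]].
- intros x Hx; exact (ex_filterdiff_of_Fder _ _ _ (Dg x Hx)).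
- split; [split|split; [split|]].
  + unfold F; now rewrite vscal_zero.
  + intros k; rewrite (frechet_D1_product g dg B F) by (auto; rewrite norm_zero; lra).
    now rewrite g0, vscal1, vscal_zero, vadd0.
  + exact (holomorphic_product g dg B F data FE).
  + exact HJ.
  + intros x T' Hx Nx [TL' [Tx' _]].
    rewrite (bounded_inverse_product g dg B F data FE x Hx (ND x Hx) (HJ x Hx)).
    rewrite ER2, ED by exact Hx.
    set (p := (1 + T x * dy (T x) / (h (T x) + T x * dh (T x)))%C).
    change (Re (T' (vscal (RtoC (/ norm x)) (vscal p x))) >= 1 / 2 - lambda).
    assert (Px : norm x <> 0) by (intros E; apply Nx; now apply norm_eq_zero).
    rewrite !(Clinear_scal T') by exact TL'; rewrite Tx'.
    replace (RtoC (/ norm x) * (p * RtoC (norm x)))%C with p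
      by (rewrite RtoC_inv by exact Px; field; now apply RtoC_neq_0).
    apply Rle_ge; replace p with (1 + T x * (dy (T x) / (h (T x) + T x * dh (T x))))%C
      by (unfold p, Cdiv; ring).
    apply Hclass, Hin, Hx.
- intros b Hb.
  destruct (slice_quotient_Cder g dg B data x0 Hn g0 ND) as [_ [Q2 Q3]].
  destruct (support_functional_coefA g dg B F data FE x0 T Hn HT) as [A2 A3].
  assert (EQ : forall z, Cmod z < 1 -> slice_quotient g dg B x0 z = (dy z / (h z + z * dh z))%C).
  { intros z Hz; assert (Hzx := slice_in_ball x0 z Hn Hz); unfold slice_quotient.
    rewrite ED2 by exact Hzx; rewrite <- (radial_deriv_slice g dg B data x0 z Hzx), ED.
    rewrite (Clinear_scal T), Tx0, !Cmult_1_r by exact TL; reflexivity. }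
  assert (H0 : Cmod 0%C < 1) by (rewrite Cmod_0; lra).
  assert (Eb : (3 * B zero x0 x0 - 4 * (dg zero x0 * dg zero x0))%C = b).
  { apply (Cder_unique (slice_quotient g dg B x0) 0%C); [exact Q3|].
    apply (Cder_ext_loc (fun z => dy z / (h z + z * dh z))%C _ _ _ 1 Rlt_0_1); [|exact Hb].
    intros w Hw; symmetry; apply EQ; replace (w - 0)%C with w in Hw by ring; exact Hw. }
  rewrite (EQ 0%C H0), h0 in Q2.
  assert (Ea : dy 0%C = (2 * dg zero x0)%C).
  { rewrite <- Q2; field. }
  rewrite A2, A3, <- Eb, Ea; split; field.
Qed.

End RadialExtension.

Section Extremal.
Context {X : NormedModule C_AbsRing}.

(* The extremal maps have f' = (1 - 2 c z + z^2)^(-mu) on the slice through x0. *)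
Theorem extremal_map (x0 : X) (T : X -> C) (lambda c : R) : norm x0 = 1 ->
  support_functional x0 T -> 1 / 2 <= lambda <= 1 -> -1 < c <= 1 ->
  let mu := lambda + 1 / 2 in
  exists (g : X -> C) (F : X -> X),
  holomorphic_on_ball (Y := C_NormedModule) g /\ g zero = RtoC 1 /\
  (forall x : X, norm x < 1 -> F x = scal (g x) x) /\ class_F lambda F /\
  coefA 2 F x0 T = RtoC (c * mu) /\
  coefA 3 F x0 T = RtoC (mu * (2 * c ^ 2 * (1 + mu) - 1) / 3).
Proof.
intros Hn HT Hl Hc mu.
assert (Hmu : 1 <= mu <= 3 / 2) by (unfold mu; lra).
set (e := (c, sqrt (1 - c ^ 2)) : C).
assert (Hc2 : 0 <= 1 - c ^ 2) by nra.
assert (Hs := sqrt_sqrt _ Hc2).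
assert (He : Cmod e = 1).
{ unfold Cmod, e; cbn [fst snd].
  replace (c ^ 2 + sqrt (1 - c ^ 2) ^ 2) with 1 by lra.
  apply sqrt_1. }
set (y := ext_deriv e mu); set (dy := fun z => (y z * ext_logderiv e mu z)%C).
assert (Dy : forall z, Cmod z < 1 -> Cder y z (dy z))
  by (intros z Hz; now apply ext_deriv_Cder).
destruct (radial_primitive y dy) as [h [dh Hh]]; [exact Dy| | |].
{ intros z Hz; apply Ccts_mult; [eapply Cder_Ccts, Dy, Hz|].
  eapply Cder_Ccts, ext_logderiv_Cder; auto. }
{ intros s Hs1; eexists; intros z Hz; apply (ext_deriv_bound e mu He Hmu s); assumption. }
assert (Ey : forall z, Cmod z < 1 -> (h z + z * dh z = y z)%C) by (intros z Hz; now apply Hh).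
assert (EL : forall z, Cmod z < 1 -> (dy z / (h z + z * dh z) = ext_logderiv e mu z)%C).
{ intros z Hz; rewrite Ey by exact Hz; unfold dy; field; apply ext_deriv_neq_0. }
assert (H0 : Cmod 0%C < 1) by (rewrite Cmod_0; lra).
assert (E0 : forall w d, Cmod (w - 0)%C < d -> Cmod w < d)
  by (intros w d Hw; replace (w - 0)%C with w in Hw by ring; exact Hw).
destruct (radial_extension_class_F x0 T Hn HT h dh dy lambda) as [g [F [P1 [P2 [P3 [P4 P5]]]]]].
- rewrite <- (ext_deriv_0 e mu); fold y; rewrite <- (Ey 0%C H0); ring.
- intros z Hz; now apply Hh.
- intros z Hz; apply (Cder_ext_loc y _ _ _ (1 - Cmod z)); [lra| |now apply Dy].
  intros w Hw; symmetry; apply Ey; replace w with (z + (w - z))%C by ring.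
  eapply Rle_lt_trans; [apply Cmod_triangle|]; lra.
(* For [c < 1] the imaginary part of [e] is positive; [c = 1] means [e = 1]. *)
- intros z Hz; destruct Hc as [Hc1 [Hc3|Hc3]].
  + apply (h_neq_0_hyperbolic e mu h dh He Hmu Hh); [|exact Hz].
    apply sqrt_lt_R0; nra.
  + apply (h_neq_0_parabolic e mu h dh He Hmu Hh); [|exact Hz].
    unfold e; rewrite Hc3; replace (1 - 1 ^ 2) with 0 by ring; now rewrite sqrt_0.
- intros z Hz; rewrite Ey by exact Hz; apply ext_deriv_neq_0.
- intros z Hz; rewrite EL by exact Hz.
  replace (1 / 2 - lambda) with (1 - mu) by (unfold mu; field).
  now apply ext_class.
- exists g, F; do 4 (split; [assumption|]).
  assert (D0 := ext_logderiv_Cder e mu He 0%C H0).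
  apply (Cder_ext_loc _ (fun z => dy z / (h z + z * dh z))%C _ _ 1 Rlt_0_1) in D0;
    [|intros w Hw; symmetry; apply EL; now apply E0].
  destruct (P5 _ D0) as [A2 A3]; rewrite A2, A3.
  assert (Edy : dy 0%C = RtoC (2 * c * mu)).
  { unfold dy, y; rewrite ext_deriv_0; unfold ext_logderiv.
    replace (1 * (RtoC mu * (e / (1 - e * 0) + Cconj e / (1 - Cconj e * 0))))%C
      with (RtoC mu * (e + Cconj e))%C.
    - unfold e, Cconj, Cmult, Cplus, RtoC; simpl; f_equal; ring.
    - field. }
  assert (Ee : (e * e + Cconj e * Cconj e = RtoC (4 * c ^ 2 - 2))%C).
  { unfold e, Cconj, Cmult, Cplus, RtoC; simpl pow in *; simpl; f_equal; [|ring]; lra. }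
  rewrite Edy; split.
  + replace (2 * c * mu) with (2 * (c * mu)) by ring; rewrite RtoC_mult; field.
  + transitivity ((RtoC mu * (e * e + Cconj e * Cconj e)
      + RtoC (2 * c * mu) * RtoC (2 * c * mu)) / 6)%C; [field|].
    rewrite Ee, <- !RtoC_mult, <- RtoC_plus, <- RtoC_div by lra; f_equal; field.
Qed.

(** The case [h = 1], in which the determinant is 1. *)
Lemma identity_class_F (x0 : X) (T : X -> C) (lambda : R) : norm x0 = 1 ->
  support_functional x0 T -> 1 / 2 <= lambda <= 1 ->
  exists (g : X -> C) (F : X -> X),
  holomorphic_on_ball (Y := C_NormedModule) g /\ g zero = RtoC 1 /\
  (forall x : X, norm x < 1 -> F x = scal (g x) x) /\ class_F lambda F /\
  coefA 2 F x0 T = RtoC 0 /\ coefA 3 F x0 T = RtoC 0.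
Proof.
intros Hn HT Hl.
assert (N1 : RtoC 1 <> RtoC 0) by (apply RtoC_neq_0; lra).
assert (N2 : forall z : C, (1 + z * 0)%C <> 0%C)
  by (intros z; replace (1 + z * 0)%C with (RtoC 1) by ring; exact N1).
destruct (radial_extension_class_F x0 T Hn HT (fun _ => 1%C) (fun _ => 0%C) (fun _ => 0%C) lambda)
  as [g [F [P1 [P2 [P3 [P4 P5]]]]]]; auto.
- intros z _; apply Cder_const.
- intros z _; apply (Cder_ext_loc (fun _ => 1%C) _ _ _ 1 Rlt_0_1);
    [intros; ring|apply Cder_const].
- intros z _; replace (1 + z * (0 / (1 + z * 0)))%C with (RtoC 1) by (field; apply N2).
  simpl; lra.
- exists g, F; do 4 (split; [assumption|]).
  destruct (P5 0%C) as [A2 A3].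
  + apply (Cder_ext_loc (fun _ => 0%C) _ _ _ 1 Rlt_0_1);
      [intros; field; apply N2|apply Cder_const].
  + rewrite A2, A3; split; field.
Qed.

Lemma T31_real (F : X -> X) (x0 : X) (T : X -> C) (a b : R) :
  coefA 2 F x0 T = RtoC a -> coefA 3 F x0 T = RtoC b ->
  T31 F x0 T = (1 - b) * (1 + b - 2 * a ^ 2).
Proof.
intros A2 A3; unfold T31; rewrite A2, A3.
unfold toeplitz3, det3, Re, Cconj, RtoC, Cminus, Cplus, Copp, Cmult; simpl; ring.
Qed.

End Extremal.

Theorem theorem5p1 (X : CompleteNormedModule C_AbsRing)
    (X_nontrivial : exists z : X, z <> zero)
    (lambda : R) (lambda_range : 1 / 2 <= lambda <= 1) :
  (forall (g : X -> C) (F : X -> X),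
     holomorphic_on_ball (Y := C_NormedModule) g ->
     g zero = RtoC 1 ->
     (forall x : X, norm x < 1 -> F x = scal (g x) x) ->
     class_F lambda F ->
     forall (x0 : X) (T : X -> C),
       norm x0 = 1 -> support_functional x0 T ->
       T31_lower lambda <= T31 F x0 T <= T31_upper lambda) /\
  (exists (g : X -> C) (F : X -> X) (x0 : X) (T : X -> C),
     holomorphic_on_ball (Y := C_NormedModule) g /\
     g zero = RtoC 1 /\
     (forall x : X, norm x < 1 -> F x = scal (g x) x) /\
     class_F lambda F /\
     norm x0 = 1 /\ support_functional x0 T /\
     T31 F x0 T = T31_lower lambda) /\
  (exists (g : X -> C) (F : X -> X) (x0 : X) (T : X -> C),
     holomorphic_on_ball (Y := C_NormedModule) g /\
     g zero = RtoC 1 /\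
     (forall x : X, norm x < 1 -> F x = scal (g x) x) /\
     class_F lambda F /\
     norm x0 = 1 /\ support_functional x0 T /\
     T31 F x0 T = T31_upper lambda).
Proof.
split.
- intros g F Hg g0 FE HF x0 T Hn HT.
  set (dg := fun x => epsilon (inhabits (fun _ : X => RtoC 0)) (Fder g x)).
  assert (Dg : forall x, norm x < 1 -> Fder g x (dg x)).
  { intros x Hx; apply epsilon_spec, Fder_of_ex_filterdiff, Hg, Hx. }
  destruct (second_order_data_exists g dg Dg) as [B data].
  exact (T31_bounds g dg B F data FE lambda x0 T lambda_range g0 HF Hn HT).
- destruct X_nontrivial as [z Nz].
  assert (Pz : 0 < norm z).
  { destruct (norm_ge_0 z) as [P|E]; [exact P|].
    exfalso; apply Nz; exact (norm_eq_zero z (eq_sym E)). }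
  set (x0 := vscal (RtoC (/ norm z)) z).
  assert (Hn : norm x0 = 1).
  { unfold x0; rewrite norm_vscal_R by now apply Rinv_0_lt_compat.
    field; lra. }
  destruct (support_functional_exists x0 Hn) as [T HT].
  split.
  + (* At this c the value c^2 mu^2 of |A_2|^2 minimizes the lower quadratic bound. *)
    set (k := (2 * lambda + 15) / (8 * lambda * (2 * lambda + 3))).
    assert (Hk : 0 <= k <= 1).
    { unfold k; split; [apply Rdiv_le_0_compat; nra|].
      apply Rmult_le_reg_r with (8 * lambda * (2 * lambda + 3)); [nra|].
      unfold Rdiv; rewrite Rmult_assoc, Rinv_l by nra; nra. }
    assert (Hc : -1 < sqrt k <= 1).
    { split; [assert (A := sqrt_pos k); lra|].
      rewrite <- sqrt_1; apply sqrt_le_1_alt; lra. }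
    destruct (extremal_map x0 T lambda (sqrt k) Hn HT lambda_range Hc)
      as [g [F [P1 [P2 [P3 [P4 [A2 A3]]]]]]].
    exists g, F, x0, T; do 6 (split; [assumption|]).
    rewrite (T31_real F x0 T _ _ A2 A3), Rpow_mult_distr, !pow2_sqrt by lra.
    unfold T31_lower, k; field; lra.
  + destruct (Rle_dec lambda ((sqrt 153 - 5) / 8)) as [L|L].
    * destruct (identity_class_F x0 T lambda Hn HT lambda_range)
        as [g [F [P1 [P2 [P3 [P4 [A2 A3]]]]]]].
      exists g, F, x0, T; do 6 (split; [assumption|]).
      rewrite (T31_real F x0 T _ _ A2 A3); unfold T31_upper.
      destruct (Rle_dec lambda ((sqrt 153 - 5) / 8)); [ring|contradiction].
    (* [c = 1] gives [A_2 = mu], the end point [s = mu ^ 2] at which the value [U] of the upper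
       estimate is taken. *)
    * destruct (extremal_map x0 T lambda 1 Hn HT lambda_range ltac:(lra))
        as [g [F [P1 [P2 [P3 [P4 [A2 A3]]]]]]].
      exists g, F, x0, T; do 6 (split; [assumption|]).
      rewrite (T31_real F x0 T _ _ A2 A3); unfold T31_upper.
      destruct (Rle_dec lambda ((sqrt 153 - 5) / 8)); [contradiction|field].
Qed.
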